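(* Let $\varepsilon>0$ and let $A_1,A_2\subset\widehat{\mathbb{C}}$ be open, non-empty, disjoint sets with common boundary $J$ ($\partial A_1=\partial A_2=J$) satisfying $\widehat{\mathbb{C}}=A_1\sqcup A_2\sqcup J$. Then there is a hyperbolic rational map $r$ with two attracting basins $\mathcal{A}_1$ and $\mathcal{A}_2$, sharing a common boundary $\mathcal{J}(r)$ and satisfying $\widehat{\mathbb{C}}=\mathcal{A}_1\sqcup\mathcal{A}_2\sqcup\mathcal{J}(r)$, such that $$d_H(A_i,\mathcal{A}_i)<\varepsilon\ \text{ for } i=1,2,\quad\text{and}\quad d_H(J,\mathcal{J}(r))<\varepsilon.$$ Moreover, if $A_1$ has finitely many components, $P$ is a set consisting of exactly one point from each component of $A_1$, and $p\in P$, then $r$ may be chosen so that in addition $r(p)=p$, $r^{-1}(p)=P$, and $\mathcal{A}_1$ is the basin of attraction for $p$.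
   Context: $\widehat{\mathbb{C}}$ is the Riemann sphere with the spherical metric, $\sqcup$ denotes disjoint union, and $d_H$ denotes Hausdorff distance with respect to the spherical metric. $\mathcal{J}(r)$ is the Julia set of $r$. An attracting basin of $r$ is the full basin of attraction (open, not necessarily connected) of an attracting cycle of $r$, where attracting includes super-attracting. A rational map is hyperbolic if the orbit of every critical point converges to an attracting cycle. *)

(* Defs.v *)
From HB Require Import structures.
From mathcomp Require Import all_boot all_order all_algebra.
From mathcomp Require Import complex ring lra.
From mathcomp Require Import all_classical all_reals all_analysis.

Set Implicit Arguments.
Unset Strict Implicit.
Unset Printing Implicit Defensive.

Import Order.TTheory GRing.Theory Num.Theory.
Import numFieldNormedType.Exports.

Local Open Scope classical_set_scope.
Local Open Scope ring_scope.
Local Open Scope complex_scope.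

(* [None] is the point at infinity.  The topology is the one induced by the
   spherical metric below. *)
Definition sphere (R : realType) : Type := option R[i].

HB.instance Definition _ (R : realType) := Choice.copy (sphere R) (option R[i]).

Section SphericalMetric.
Variable R : realType.
Implicit Types (x y z : sphere R) (u v w : R * R * R).

(* Inverse stereographic projection onto the unit sphere of R^3, with infinity
   sent to the north pole. *)
Definition stereo x : R * R * R :=
  match x with
  | Some (a +i* b) =>
      let s := a ^+ 2 + b ^+ 2 in
      (2 * a / (s + 1), 2 * b / (s + 1), (s - 1) / (s + 1))
  | None => (0, 0, 1)
  end.

Definition dot3 u v : R := u.1.1 * v.1.1 + u.1.2 * v.1.2 + u.2 * v.2.

(* Great-circle distance, i.e. the length metric of 2|dz| / (1 + |z|^2). *)
Definition sdist x y : R := acos (dot3 (stereo x) (stereo y)).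

Lemma stereo_unit x : dot3 (stereo x) (stereo x) = 1.
Proof.
case: x => [[a b]|]; rewrite /dot3 /=; last by ring.
have s1 : a ^+ 2 + b ^+ 2 + 1 != 0.
  by rewrite gt_eqF// ltr_wpDl// addr_ge0// sqr_ge0.
by field.
Qed.

Lemma dot3C u v : dot3 u v = dot3 v u.
Proof. by rewrite /dot3; ring. Qed.

Lemma dot3_cauchy u v : dot3 u v ^+ 2 <= dot3 u u * dot3 v v.
Proof.
case: u v => [[a b] c] [[d e] f]; rewrite /dot3 /= -subr_ge0.
rewrite (_ : _ - _ = (a * e - b * d) ^+ 2 + (a * f - c * d) ^+ 2
   + (b * f - c * e) ^+ 2); last by ring.
by rewrite !addr_ge0// sqr_ge0.
Qed.

Lemma dot3_bound x y : -1 <= dot3 (stereo x) (stereo y) <= 1.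
Proof.
rewrite -ler_norml -(@ler_pXn2r _ 2)// ?nnegrE// expr1n real_normK ?num_real//.
by rewrite (le_trans (dot3_cauchy _ _))// !stereo_unit mulr1.
Qed.

Lemma sdistxx x : sdist x x = 0.
Proof. by rewrite /sdist stereo_unit acos1. Qed.

Lemma sdist_sym x y : sdist x y = sdist y x.
Proof. by rewrite /sdist dot3C. Qed.

Lemma stereo_inj : injective stereo.
Proof.
have pos (a b : R) : a ^+ 2 + b ^+ 2 + 1 != 0.
  by rewrite gt_eqF// ltr_wpDl// addr_ge0// sqr_ge0.
have nn (a b : R) : (a ^+ 2 + b ^+ 2 - 1) / (a ^+ 2 + b ^+ 2 + 1) != 1.
  apply/negP => /eqP h; have := pos a b => p.
  by move: (congr1 ( *%R^~ (a ^+ 2 + b ^+ 2 + 1)) h); rewrite /= divfK//; lra.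
move=> [[a b]|] [[c d]|]//=.
- move=> [] /= h1 h2 h3; have p := pos a b; have q := pos c d.
  have e : a ^+ 2 + b ^+ 2 = c ^+ 2 + d ^+ 2.
    have h4 (s : R) : s + 1 != 0 -> (s + 1)^-1 = (1 - (s - 1) / (s + 1)) / 2.
      by move=> s0; field.
    have : (a ^+ 2 + b ^+ 2 + 1)^-1 = (c ^+ 2 + d ^+ 2 + 1)^-1.
      by rewrite h4// [in RHS]h4// h3.
    by move=> /invr_inj /addIr.
  move: h1 h2; rewrite e => /(mulIf (invr_neq0 q)) h1 /(mulIf (invr_neq0 q)) h2.
  by congr (Some (_ +i* _)); lra.
- by move=> [] _ _ /eqP; rewrite (negPf (nn _ _)).
- by move=> [] _ _ /esym /eqP; rewrite (negPf (nn _ _)).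
Qed.

Lemma sdist_positivity x y : sdist x y = 0 -> x = y.
Proof.
move=> h; apply: stereo_inj.
have /acos_def[_] := dot3_bound x y; rewrite -/(sdist x y) h cos0 => /esym e.
have := stereo_unit x; have := stereo_unit y; move: e.
case: (stereo x) (stereo y) => [[a b] c] [[d e] f]; rewrite /dot3 /=.
move=> h1 h2 h3.
have s : (a - d) ^+ 2 + (b - e) ^+ 2 + (c - f) ^+ 2 = 0.
  transitivity ((a * a + b * b + c * c) + (d * d + e * e + f * f)
    - 2 * (a * d + b * e + c * f)); first by ring.
  by rewrite h1 h2 h3; lra.
have /eqP := s; rewrite !paddr_eq0 ?addr_ge0 ?sqr_ge0// !sqrf_eq0 !subr_eq0.
by move=> /andP[/andP[/eqP -> /eqP ->] /eqP ->].
Qed.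

Lemma sdist_triangle y x z : sdist x z <= sdist x y + sdist y z.
Proof.
have bxy := dot3_bound x y; have byz := dot3_bound y z.
have bxz := dot3_bound x z.
have /acos_def[/andP[xy0 xypi] cxy] := bxy.
have /acos_def[/andP[yz0 yzpi] cyz] := byz.
have /acos_def[/andP[xz0 xzpi] cxz] := bxz.
rewrite -!/(sdist _ _) in xy0 xypi cxy yz0 yzpi cyz xz0 xzpi cxz.
have [pile|pigt] := leP pi (sdist x y + sdist y z).
  exact: le_trans xzpi pile.
rewrite leNgt; apply/negP => lt.
have : cos (sdist x z) < cos (sdist x y + sdist y z).
  by rewrite ltr_cos// in_itv/= ?xz0 ?xzpi ?addr_ge0// ltW.
apply/negP; rewrite -leNgt cosD cxz cxy cyz.
rewrite [X in sin X * _]/sdist [X in _ * sin X]/sdist !sin_acos//.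
rewrite lerBlDl -lerBlDr -sqrtrM; last first.
  have := dot3_cauchy (stereo x) (stereo y).
  by rewrite !stereo_unit mulr1 subr_ge0.
set A := dot3 (stereo x) (stereo y); set B := dot3 (stereo y) (stereo z).
set D := dot3 (stereo x) (stereo z).
rewrite (le_trans (ler_norm _))// -sqrtr_sqr ler_wsqrtr//.
have := stereo_unit x; have := stereo_unit y; have := stereo_unit z.
rewrite /A /B /D.
case: (stereo x) (stereo y) (stereo z) => [[a1 a2] a3] [[b1 b2] b3] [[c1 c2] c3].
move=> h3 h2 h1.
set a := dot3 _ (b1, b2, b3); set b := dot3 _ (c1, c2, c3).
set d := dot3 _ (c1, c2, c3).
pose p := (a1 - a * b1, a2 - a * b2, a3 - a * b3).
pose q := (c1 - b * b1, c2 - b * b2, c3 - b * b3).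
have := dot3_cauchy p q.
have -> : dot3 p q = d - a * b - a * b + a * b * dot3 (b1, b2, b3) (b1, b2, b3).
  by rewrite /dot3 /p /q /a /b /d /dot3 /=; ring.
have -> : dot3 p p = dot3 (a1,a2,a3) (a1,a2,a3) - 2 * a ^+ 2
    + a ^+ 2 * dot3 (b1, b2, b3) (b1, b2, b3).
  by rewrite /dot3 /p /a /dot3 /=; ring.
have -> : dot3 q q = dot3 (c1,c2,c3) (c1,c2,c3) - 2 * b ^+ 2
    + b ^+ 2 * dot3 (b1, b2, b3) (b1, b2, b3).
  by rewrite /dot3 /q /b /dot3 /=; ring.
rewrite h1 h2 h3 => h.
have -> : (a * b - d) ^+ 2 = (d - a * b - a * b + a * b * 1) ^+ 2 by ring.
apply: (le_trans h); rewrite le_eqVlt; apply/orP; left; apply/eqP; ring.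
Qed.

HB.instance Definition _ := @isMetric.Build R (sphere R) sdist
  sdistxx sdist_positivity sdist_sym sdist_triangle.

End SphericalMetric.

Section Topology.

Definition boundary (T : topologicalType) (A : set T) : set T :=
  closure A `&` closure (~` A).

Definition components (T : topologicalType) (A : set T) : set (set T) :=
  [set connected_component A x | x in A].

Definition disjoint_cover3 (T : Type) (A B C : set T) : Prop :=
  [/\ A `|` B `|` C = setT, A `&` B = set0, A `&` C = set0 & B `&` C = set0].

(* Extended-real valued, so that empty sets do not get a junk distance. *)
Definition hausdorff_dist (R : realType) (T : pseudoMetricType R)
    (A B : set T) : \bar R :=
  maxe (ereal_sup [set edist_inf B a | a in A])
       (ereal_sup [set edist_inf A b | b in B]).

(* A normal family: every sequence of members has a subsequence which converges
   uniformly on the compact subsets of U. *)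
Definition normal_family (T : topologicalType) (V : uniformType)
    (F : set (T -> V)) (U : set T) : Prop :=
  forall s : nat -> T -> V, (forall n, F (s n)) ->
  exists phi : nat -> nat, {homo phi : m n / (m < n)%N} /\
  exists g : T -> V, forall K : set T, compact K -> K `<=` U ->
    {uniform K, (fun n => s (phi n)) @ \oo --> g}.

End Topology.

Section RationalDynamics.
Variable R : realType.
Local Notation C := (R[i]).
Implicit Types (x z : sphere R) (f : sphere R -> sphere R).

(* Value at infinity: the limit of p/q, read off the leading terms; recall that
   [size p] is deg p + 1. *)
Definition ratfun (p q : {poly C}) z : sphere R :=
  match z with
  | Some a => if q.[a] == 0 then None else Some (p.[a] / q.[a])
  | None => if (size q < size p)%N then None
            else Some (p`_(size q).-1 / lead_coef q)
  end.

Definition rational_map f : Prop :=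
  exists p q : {poly C}, coprimep p q /\ f = ratfun p q.

(* Local coordinate centred near x: the identity of C if x is finite, z |-> 1/z
   if x is infinity.  Points outside the domain of the coordinate get the
   irrelevant value 0, which is also correct for [None] in the second chart. *)
Definition chart x z : C :=
  match x, z with
  | Some _, Some a => a
  | None, Some a => a^-1
  | _, None => 0
  end.

Definition chart_inv x (a : C) : sphere R :=
  match x with
  | Some _ => Some a
  | None => if a == 0 then None else Some a^-1
  end.

(* f has complex derivative l at x, read in the coordinates at x and f x. *)
Definition has_derivative f x (l : C) : Prop :=
  is_derive (chart x x : C^o) 1
    (fun a : C^o => chart (f x) (f (chart_inv x a)) : C^o) l.

Definition critical_point f x : Prop := has_derivative f x 0.

Definition orbit f x : set (sphere R) := [set iter n f x | n in setT].

(* The multiplier l is coordinate independent since f^n fixes x; l = 0 is the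
   super-attracting case. *)
Definition attracting_periodic_point f x : Prop :=
  exists2 n : nat, (0 < n)%N & iter n f x = x /\
    exists2 l : C, has_derivative (iter n f) x l & `|l| < 1.

Definition attracting_cycle f (O : set (sphere R)) : Prop :=
  exists2 x, attracting_periodic_point f x & O = orbit f x.

Definition orbit_converges_to f (O : set (sphere R)) z : Prop :=
  edist_inf O (iter n f z) @[n --> \oo] --> 0%E.

Definition basin f (O : set (sphere R)) : set (sphere R) :=
  [set z | orbit_converges_to f O z].

Definition attracting_basin f (B : set (sphere R)) : Prop :=
  exists2 O, attracting_cycle f O & B = basin f O.

Definition hyperbolic f : Prop :=
  forall c, critical_point f c ->
    exists2 O, attracting_cycle f O & orbit_converges_to f O c.

Definition fatou_set f : set (sphere R) :=
  [set z | exists U : set (sphere R),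
     [/\ open U, U z & normal_family [set iter n f | n in setT] U]].

Definition julia_set f : set (sphere R) := ~` fatou_set f.

End RationalDynamics.

Section Approximation.
Variable R : realType.

Definition approximates (eps : R) (A1 A2 J : set (sphere R))
    (r : sphere R -> sphere R) (B1 B2 : set (sphere R)) : Prop :=
  [/\ rational_map r /\ hyperbolic r,
      attracting_basin r B1 /\ attracting_basin r B2,
      boundary B1 = julia_set r /\ boundary B2 = julia_set r,
      disjoint_cover3 B1 B2 (julia_set r) &
      [/\ (hausdorff_dist A1 B1 < eps%:E)%E,
          (hausdorff_dist A2 B2 < eps%:E)%E &
          (hausdorff_dist J (julia_set r) < eps%:E)%E]].

Definition component_transversal (T : topologicalType) (A P : set T) : Prop :=
  P `<=` A /\ forall K, components A K -> exists x, P `&` K = [set x].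

End Approximation.

(* Main.v *)
Require Import Defs.
From HB Require Import structures.
From mathcomp Require Import all_boot all_order all_algebra.
From mathcomp Require Import complex ring lra.
From mathcomp Require Import all_classical all_reals all_analysis.

(* The map is r(z) = q + T(z)^n with T a fraction such that |T| is at most 1/2 off A1 and at
   least 4 on a compact core of A1, the poles of T being the points of P, and T(q) = 0;
   coordinates are chosen by a rotation of the sphere so that p is infinity, and n = 2^m is large.
   Then p and q are superattracting fixed points whose basins contain {|T| >= 1 + eta} and
   {|T| <= 1 - eta}.  What remains lies in the tube | |T| - 1 | < eta, where T may be assumed
   to have no critical point (scale T), so that T lifts small displacements with a fixed
   Lipschitz constant; taking n-th roots first makes the inverse branches of r contract.  A point
   outside both basins is therefore a limit of points of each basin, hence in the Julia set, and
   it is not critical.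
     The fraction T is a lemniscate function: its zeros are almost Fekete points of the complement
   of A1 for the weight given by the poles.  Lagrange interpolation at those points shows that T
   separates at least as well as the powers of any fraction f with poles in P for which |f| <= 1
   off A1 and |f(a)| >= 2.  Such f exist for every a in A1, by pushing poles along the component
   of a (Runge). *)

Set Implicit Arguments.
Unset Strict Implicit.
Unset Printing Implicit Defensive.

Import Order.TTheory GRing.Theory Num.Theory.
Import numFieldNormedType.Exports.

Local Open Scope classical_set_scope.
Local Open Scope ring_scope.
Local Open Scope complex_scope.

(** * Complex modulus and polynomials *)

(** The obstacle is uniformity. A separating fraction exists for each single a, but sums or products
    of such fractions may cancel or vanish elsewhere, while one T has to be large on the whole core.
    Fekete points remove the choice: their polynomial is built without reference to a, and
    interpolation compares it with every f at the price of a factor linear in the degree, which the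
    powers of f outgrow. The two sets play different roles. Everything off [A1] is sent to q and
    only a core of [A1] to p, so the basin of p is squeezed between the core and [A1]. The core is
    compact and therefore meets finitely many components of [A1]; this provides a finite P when none
    is given. The order of the choices matters: the traps around p and q and the Lipschitz constant
    of the lifting are fixed before n, and the core is fixed before P. The exponent 2^m turns n-th
    roots into iterated square roots, each of which contracts towards 1 by a fixed factor. *)

Section ComplexModulus.
Variable R : rcfType.
Local Notation C := R[i].
Implicit Types (x y z : C).

(** The library norm of a complex number is again complex; a real-valued modulus keeps the estimates
    in R, within reach of [lra] and [nra]. *)
Definition nm z : R := Normc.normc z.

Lemma nmE z : `|z| = (nm z)%:C. Proof. by case: z. Qed.
Lemma nm_sqr (a b : R) : nm (a +i* b) ^+ 2 = a ^+ 2 + b ^+ 2.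
Proof. by rewrite /nm /= sqr_sqrtr// addr_ge0// sqr_ge0. Qed.
Lemma nm_ge0 z : 0 <= nm z. Proof. by case: z => a b; exact: sqrtr_ge0. Qed.
Lemma nm0 : nm 0 = 0. Proof. exact: Normc.normc0. Qed.
Lemma nm1 : nm 1 = 1. Proof. exact: Normc.normc1. Qed.
Lemma nmM x y : nm (x * y) = nm x * nm y. Proof. exact: Normc.normcM. Qed.
Lemma nmV x : nm x^-1 = (nm x)^-1. Proof. exact: Normc.normcV. Qed.
Lemma nmN x : nm (- x) = nm x. Proof. exact: normcN. Qed.
Lemma nmD x y : nm (x + y) <= nm x + nm y. Proof. exact: le_normcD. Qed.
Lemma nmB x y : nm (x - y) <= nm x + nm y. Proof. by rewrite -(nmN y) nmD. Qed.
Lemma nmC x y : nm (x - y) = nm (y - x). Proof. by rewrite -nmN opprB. Qed.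
Lemma nm_eq0 x : (nm x == 0) = (x == 0).
Proof. by apply/eqP/eqP => [/Normc.eq0_normc//|->]; rewrite nm0. Qed.
Lemma nm_gt0 x : (0 < nm x) = (x != 0).
Proof. by rewrite lt_neqAle nm_ge0 andbT eq_sym nm_eq0. Qed.
Lemma nmX x n : nm (x ^+ n) = nm x ^+ n.
Proof. by elim: n => [|n IH]; rewrite ?expr0 ?nm1// !exprS nmM IH. Qed.
Lemma nm_div x y : nm (x / y) = nm x / nm y. Proof. by rewrite nmM nmV. Qed.
Lemma nm_real (a : R) : nm a%:C = `|a|.
Proof. by rewrite /nm /= expr0n addr0 sqrtr_sqr. Qed.
Lemma nm_nat n : nm n%:R = n%:R.
Proof. by rewrite -(rmorph_nat (real_complex R)) nm_real normr_nat. Qed.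
Lemma nm_triangle y x z : nm (x - z) <= nm (x - y) + nm (y - z).
Proof. by rewrite (_ : x - z = (x - y) + (y - z)) ?nmD//; ring. Qed.
Lemma nm_lerB x y : nm x - nm y <= nm (x - y).
Proof. by rewrite lerBlDr -{1}(subrK y x) nmD. Qed.
Lemma nm_lerBC x y : nm y - nm x <= nm (x - y).
Proof. by rewrite nmC nm_lerB. Qed.
Lemma nm_lerD x y : nm x - nm y <= nm (x + y).
Proof. by rewrite -{2}(opprK y) -(nmN y) nm_lerB. Qed.
Lemma nm_prod (I : Type) (r : seq I) (P : pred I) (F : I -> C) :
  nm (\prod_(i <- r | P i) F i) = \prod_(i <- r | P i) nm (F i).
Proof. exact: (big_morph nm nmM nm1). Qed.
Lemma nm_sum (I : Type) (r : seq I) (P : pred I) (F : I -> C) :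
  nm (\sum_(i <- r | P i) F i) <= \sum_(i <- r | P i) nm (F i).
Proof.
elim/big_rec2 : _ => [|i u v _ h]; first by rewrite nm0.
by rewrite (le_trans (nmD _ _))// lerD2l.
Qed.
Lemma nm_re (a b : R) : `|a| <= nm (a +i* b).
Proof. by rewrite -sqrtr_sqr /nm /= ler_wsqrtr// lerDl sqr_ge0. Qed.

(* The root of positive real part stays away from -1, so [xi' * (2 + xi') = xi] contracts. *)
Lemma sqrt_near1 (xi : C) : nm xi <= 2^-1 ->
  exists2 xi', (1 + xi') ^+ 2 = 1 + xi & nm xi' <= 2 / 3 * nm xi.
Proof.
move=> h; pose s := sqrtc (1 + xi).
have s2 : s ^+ 2 = 1 + xi by exact: sqr_sqrtc.
have sRe : 0 <= complex.Re s.
  by rewrite /s; case: (1 + xi) => a b /=; exact: sqrtr_ge0.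
exists (s - 1); first by rewrite addrC subrK.
have e : (s - 1) * (s + 1) = xi by rewrite -subr_sqr s2; ring.
have n1 : 1 <= nm (s + 1).
  case: s sRe {s2 e} => a b /= a0.
  by rewrite (le_trans _ (nm_re _ _))// ger0_norm; lra.
have en : nm (s - 1) * nm (s + 1) = nm xi by rewrite -nmM e.
have n0 := nm_ge0 (s - 1).
have n2 : nm (s - 1) <= 2^-1 by rewrite (le_trans _ h)// -en ler_peMr.
have n3 : 3 / 2 <= nm (s + 1).
  have := nm_lerD 2 (s - 1); rewrite (_ : 2 + (s - 1) = s + 1); last by ring.
  by rewrite nm_nat; lra.
by rewrite -en; nra.
Qed.

(** Each square root shrinks the distance to 1 by the factor 2/3. This is the contraction of the
    inverse branches, arbitrarily strong as m grows. *)
Lemma root_pow2_near1 (m : nat) (xi : C) : nm xi <= 2^-1 ->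
  exists2 zeta, zeta ^+ (2 ^ m) = 1 + xi & nm (zeta - 1) <= (2 / 3) ^+ m * nm xi.
Proof.
elim: m xi => [|m IH] xi h.
  by exists (1 + xi); rewrite ?expr1// expr0 mul1r addrC addKr.
have [xi' e l] := sqrt_near1 h.
have [|z ez lz] := IH xi'.
  by have := nm_ge0 xi; lra.
exists z; first by rewrite expnS mulnC exprM ez.
rewrite (le_trans lz)// exprSr -mulrA ler_wpM2l// exprn_ge0//; lra.
Qed.

End ComplexModulus.

Arguments nm : simpl never.

Section ComplexPolynomials.
Variable R : rcfType.
Local Notation C := R[i].
Implicit Types (p q h : {poly C}) (z : C).

(** The logarithmic derivative of the product is the sum of the 1 / (z - c), of modulus at most
    [size s] / m; denominators are cleared so that z may be a root. *)
Lemma deriv_prod_bound (s : seq C) z (m : R) : 0 <= m ->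
  (forall c, c \in s -> m <= nm (z - c)) ->
  nm ((\prod_(c <- s) ('X - c%:P))^`().[z]) * m <=
  (size s)%:R * nm (\prod_(c <- s) ('X - c%:P)).[z].
Proof.
move=> m0; elim: s => [|c s IH] hs.
  by rewrite big_nil -polyC1 derivC horner0 nm0 !mul0r.
rewrite big_cons derivM derivXsubC mul1r hornerD !hornerM hornerXsubC /=.
have hc : m <= nm (z - c) by rewrite hs// mem_head.
have {}IH := IH (fun d ds => hs d (@mem_behead _ (c :: s) d ds)).
set g := (\prod_(j <- s) _).[z] in IH *; set g' := (\prod_(j <- s) _)^`().[z] in IH *.
rewrite (le_trans (ler_wpM2r m0 (nmD _ _)))// !nmM mulrDl -natr1.
rewrite mulrDl addrC mul1r lerD//.
  by rewrite -mulrA [leRHS]mulrCA ler_wpM2l// nm_ge0.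
by rewrite mulrC ler_wpM2r// nm_ge0.
Qed.

Lemma poly_factor h : h != 0 ->
  exists2 s : seq C, h = lead_coef h *: \prod_(c <- s) ('X - c%:P) &
     size s = (size h).-1.
Proof.
move=> h0; have [s e] := closed_field_poly_normal h; exists s => //.
by have := congr1 (fun p : {poly C} => size p) e;
   rewrite size_scale ?lead_coef_eq0// size_prod_XsubC => ->.
Qed.

(** Take c nearest to z: the distance |z - c| is then a legitimate m in [deriv_prod_bound]. This is
    the quantitative inverse function theorem behind the lifting. *)
Lemma near_root h z : h^`().[z] != 0 ->
  exists2 c, root h c & nm (z - c) * nm h^`().[z] <= (size h).-1%:R * nm h.[z].
Proof.
move=> h'0; have h0 : h != 0 by apply: contraNneq h'0 => ->; rewrite deriv0 horner0.
have [s e ss] := poly_factor h0.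
have s0 : s != [::].
  apply: contraNneq h'0 => s0; rewrite e s0 big_nil alg_polyC derivC horner0 //.
have [c cs cmin] : exists2 c, c \in s & forall d, d \in s -> nm (z - c) <= nm (z - d).
  elim: s s0 {e ss} => // a [|b s] IH _.
    by exists a; rewrite ?mem_head// => d; rewrite inE => /eqP ->.
  have [//|c cs cm] := IH; have [le|lt] := leP (nm (z - a)) (nm (z - c)).
    exists a; rewrite ?mem_head// => d; rewrite in_cons => /predU1P[->//|ds].
    exact: le_trans le (cm _ ds).
  exists c; first by apply/predU1P; right.
  by move=> d; rewrite in_cons => /predU1P[->|/cm//]; exact: ltW.
exists c.
  rewrite e rootZ ?lead_coef_eq0// root_prod_XsubC//.
rewrite e derivZ !hornerZ !nmM size_scale ?lead_coef_eq0// size_prod_XsubC.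
rewrite mulrCA [leRHS]mulrCA ler_wpM2l ?nm_ge0// mulrC.
exact: deriv_prod_bound (nm_ge0 _) cmin.
Qed.

Lemma poly_bounded p (M : R) : exists2 B : R, 0 < B & forall z, nm z <= M -> nm p.[z] <= B.
Proof.
elim/poly_ind: p => [|p c [B B0 hB]].
  by exists 1 => // z _; rewrite horner0 nm0.
exists (B * (`|M| + 1) + nm c + 1).
  by rewrite ltr_wpDl// addr_ge0 ?nm_ge0// mulr_ge0 ?ltW// ltr_wpDl.
move=> z zM; rewrite hornerMXaddC (le_trans (nmD _ _))// nmM.
rewrite -addrA lerD ?lerDl// ler_pM ?nm_ge0 ?hB//.
by rewrite (le_trans zM)// (le_trans (ler_norm _))// lerDl.
Qed.

Lemma poly_lipschitz p c : exists2 L : R, 0 < L &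
  forall z, nm (z - c) <= 1 -> nm (p.[z] - p.[c]) <= L * nm (z - c).
Proof.
have /factor_theorem[g e] : root (p - p.[c]%:P) c.
  by rewrite rootE !hornerE subrr.
have [L L0 hL] := poly_bounded g (nm c + 1); exists L => // z zc.
have -> : p.[z] - p.[c] = (p - p.[c]%:P).[z] by rewrite !hornerE.
rewrite e hornerM hornerXsubC nmM ler_wpM2r ?nm_ge0// hL//.
by rewrite -(subrK c z) (le_trans (nmD _ _))// addrC lerD2l.
Qed.

Lemma poly_continuous p c (e : R) : 0 < e ->
  exists2 d : R, 0 < d & forall z, nm (z - c) < d -> nm (p.[z] - p.[c]) < e.
Proof.
move=> e0; have [L L0 hL] := poly_lipschitz p c.
exists (Num.min 1 (e / L)); first by rewrite lt_min ltr01 divr_gt0.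
move=> z; rewrite lt_min => /andP[z1]; rewrite ltr_pdivlMr// mulrC => z2.
by rewrite (le_lt_trans _ z2)// hL// ltW.
Qed.

Lemma poly_upper p n : (size p <= n.+1)%N ->
  exists2 B : R, 0 < B & forall z, 1 <= nm z -> nm p.[z] <= B * nm z ^+ n.
Proof.
move=> sp; exists (\sum_(i < size p) nm p`_i + 1).
  by rewrite ltr_wpDl// sumr_ge0// => i _; exact: nm_ge0.
move=> z z1; rewrite horner_coef (le_trans (nm_sum _ _ _))//.
rewrite mulrDl mul1r ler_wpDr ?exprn_ge0 ?nm_ge0// mulr_suml ler_sum// => i _.
rewrite nmM nmX ler_wpM2l ?nm_ge0// ler_weXn2l//.
by rewrite -ltnS (leq_trans (ltn_ord i)).
Qed.

Lemma poly_lower p : p != 0 -> exists2 b : R, 0 < b &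
  exists M, forall z, M <= nm z -> b * nm z ^+ (size p).-1 <= nm p.[z].
Proof.
move=> p0; have [s e ss] := poly_factor p0.
pose M := \sum_(c <- s) nm c.
exists (nm (lead_coef p) * 2^-1 ^+ (size p).-1).
  by rewrite mulr_gt0 ?nm_gt0 ?lead_coef_eq0// exprn_gt0// invr_gt0.
exists (2 * M) => z zM; rewrite [in leRHS]e hornerZ nmM -mulrA -ss.
rewrite ler_wpM2l ?nm_ge0//.
rewrite -exprMn horner_prod nm_prod.
have hs c : c \in s -> nm c <= M.
  move=> cs; rewrite /M (big_rem c cs) /= lerDl sumr_ge0// => i _; exact: nm_ge0.
clearbody M; elim: s hs {e ss} => [|c s IH] hs; first by rewrite big_nil expr0.
rewrite big_cons /= exprS ler_pM ?exprn_ge0 ?mulr_ge0 ?nm_ge0 ?invr_ge0//.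
  rewrite hornerXsubC; have := hs c (mem_head _ _); have := nm_lerB z c.
  by have := nm_ge0 c; lra.
by rewrite IH// => d ds; rewrite hs// in_cons ds orbT.
Qed.

Lemma poly_little_o p q (e : R) : (size p < size q)%N -> 0 < e ->
  exists M, forall z, M <= nm z -> nm p.[z] <= e * nm q.[z].
Proof.
move=> spq e0; have q0 : q != 0 by rewrite -size_poly_gt0 (leq_trans _ spq).
have [b b0 [M hM]] := poly_lower q0.
case: (posnP (size p)) => [/eqP|sp].
  by rewrite size_poly_eq0 => /eqP ->; exists 0 => z _;
     rewrite horner0 nm0 mulr_ge0 ?nm_ge0// ltW.
have [|B B0 hB] := @poly_upper p (size p).-1; first by rewrite prednK.
exists (`|M| + 1 + B / (e * b)) => z hz.
have eb0 : 0 < e * b by rewrite mulr_gt0.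
have Bb : 0 < B / (e * b) by rewrite divr_gt0.
have z1 : 1 <= nm z by have := normr_ge0 M; lra.
have zM : M <= nm z by have := ler_norm M; lra.
have zB : B <= e * b * nm z by rewrite mulrC -ler_pdivrMr//; have := normr_ge0 M; lra.
rewrite (le_trans (hB z z1))// (@le_trans _ _ (e * (b * nm z ^+ (size q).-1)))//; last first.
  by rewrite ler_wpM2l ?hM// ltW.
rewrite (@le_trans _ _ (e * b * nm z * nm z ^+ (size p).-1))//.
  by rewrite ler_wpM2r// exprn_ge0// nm_ge0.
rewrite -!mulrA -exprS !ler_pM2l// ler_weXn2l//.
by rewrite prednK// -ltnS prednK// (leq_trans _ spq).
Qed.

End ComplexPolynomials.

(** * Lifting through a fraction *)

Section Lifting.
Variable R : rcfType.
Local Notation C := R[i].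
Implicit Types (A E : {poly C}) (z v c : C).

(** Numerator of the derivative of A / E. For coprime A and E its roots are the finite critical
    points off the poles, together with the multiple poles. *)
Definition wronskian A E := A^`() * E - A * E^`().

(** If A' E = A E', coprimality makes A divide A', which has smaller degree, so A' = 0; but A is not
    constant and the characteristic is 0. *)
Lemma wronskian_neq0 A E : E != 0 -> coprimep A E -> (size E < size A)%N ->
  wronskian A E != 0.
Proof.
move=> E0 cAE sEA; apply/eqP => /eqP; rewrite subr_eq0 => /eqP e.
have sA : (1 < size A)%N by rewrite (leq_trans _ sEA)// ltnS size_poly_gt0.
have A'0 : A^`() != 0.
  have chr : [pchar C] =i pred0 by exact: pchar_num.
  apply/eqP => /(congr1 (coefp (size A).-2)); rewrite /= coef0 coef_deriv.
  rewrite prednK -?subn1 ?subn_gt0// subn1 => /eqP.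
  rewrite mulrn_eq0 -lead_coefE lead_coef_eq0 -size_poly_eq0.
  by case: (size A) sA => [|[]].
have : A %| A^`() by rewrite -(Gauss_dvdpl _ cAE) e dvdp_mulr.
by move=> /(dvdp_leq A'0); rewrite leqNgt lt_size_deriv// -size_poly_gt0 ltnW.
Qed.

Lemma exists_notin (s : seq R) : exists2 t : R, 1 <= t <= 2 & t \notin s.
Proof.
pose u := mkseq (fun k => 1 + (k.+1)%:R^-1 : R) (size s).+1.
have uu : uniq u.
  by apply: mkseq_uniq => i j /addrI/invr_inj/eqP; rewrite eqr_nat => /eqP[].
have /allPn[t tu ts] : ~~ all [in s] u.
  apply/negP => /allP h; have := uniq_leq_size uu h.
  by rewrite size_mkseq ltnn.
exists t => //; move: tu => /mapP[k _ ->].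
have : (k.+1)%:R^-1 <= 1 :> R by rewrite invf_le1 ?ltr0n// ler1n.
have : 0 <= (k.+1)%:R^-1 :> R by rewrite invr_ge0.
by move: (_^-1) => x a b; apply/andP; split; lra.
Qed.

(** Each of the finitely many roots c forbids at most one value of t, namely |E(c)| / |A(c)|.
    Keeping t within [1, 2] costs at most a factor two in upper bounds on A / E. *)
Lemma generic_scale A E : coprimep A E -> E != 0 -> (size E < size A)%N ->
  exists2 t : R, 1 <= t <= 2 &
  forall c, root (wronskian A E) c -> t * nm A.[c] != nm E.[c].
Proof.
move=> cAE E0 sEA; have W0 := wronskian_neq0 E0 cAE sEA.
have [s e _] := poly_factor W0.
have [t t12 ts] := exists_notin [seq nm E.[c] / nm A.[c] | c <- s].
exists t => // c; rewrite {1}e rootZ ?lead_coef_eq0// root_prod_XsubC => cs.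
have [A0|A0] := eqVneq A.[c] 0.
  rewrite A0 nm0 mulr0 eq_sym nm_eq0.
  apply/negP => Ec; have := coprimep_root cAE; move=> /(_ c).
  by rewrite rootE A0 eqxx => /(_ isT); rewrite (eqP Ec) eqxx.
apply: contra ts => /eqP e1; apply/mapP; exists c => //.
by rewrite -e1 mulfK// nm_eq0.
Qed.

Lemma finite_radius (P : C -> R -> Prop) (s : seq C) :
  (forall c d e, e <= d -> P c d -> P c e) ->
  (forall c, c \in s -> exists2 d : R, 0 < d & P c d) ->
  exists2 d : R, 0 < d & forall c, c \in s -> P c d.
Proof.
move=> mono; elim: s => [|c s IH] hs; first by exists 1.
have [|d d0 hd] := IH; first by move=> b bs; apply: hs; rewrite in_cons bs orbT.
have [e e0 he] := hs c (mem_head _ _).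
exists (Num.min d e); first by rewrite lt_min d0.
move=> b; rewrite in_cons => /predU1P[->|bs].
  by apply: mono he; rewrite ge_min lexx orbT.
by apply: mono (hd _ bs); rewrite ge_min lexx.
Qed.

(** The estimate concerns (|A| - |E|) / |E|: near c the numerator stays away from 0 and |E| stays
    bounded. Hence c may be a pole, as it must, since multiple poles are roots of the wronskian. *)
Lemma generic_tube A E c : nm A.[c] != nm E.[c] ->
  exists2 d : R, 0 < d & forall z, nm (z - c) < d -> E.[z] != 0 ->
    d < `|nm (A.[z] / E.[z]) - 1|.
Proof.
move=> AEc; pose k : R := `|nm A.[c] - nm E.[c]|.
have k0 : 0 < k by rewrite normr_gt0 subr_eq0.
have [d1 d10 h1] := poly_continuous A c (divr_gt0 k0 (ltr0n _ 4)).
have [d2 d20 h2] := poly_continuous E c (divr_gt0 k0 (ltr0n _ 4)).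
have Ec := nm_ge0 E.[c].
have e0 : 0 < k / (4 * (nm E.[c] + k)) by rewrite divr_gt0//; lra.
exists (Num.min (Num.min d1 d2) (k / (4 * (nm E.[c] + k)))).
  by rewrite !lt_min d10 d20.
move=> z; rewrite !lt_min => /andP[/andP[z1 z2] _] Ez.
have Ez0 : 0 < nm E.[z] by rewrite nm_gt0.
suff : k / (4 * (nm E.[c] + k)) < `|nm (A.[z] / E.[z]) - 1|.
  by apply: le_lt_trans; rewrite ge_min lexx orbT.
rewrite ltr_pdivrMr; last lra.
have -> : nm (A.[z] / E.[z]) - 1 = (nm A.[z] - nm E.[z]) / nm E.[z].
  by rewrite nm_div; field; rewrite gt_eqF.
rewrite normf_div (gtr0_norm Ez0) mulrAC ltr_pdivlMr//.
have H1 := h1 z z1; have H2 := h2 z z2.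
have := nm_lerB A.[z] A.[c]; have := nm_lerBC A.[z] A.[c] => a1 a2.
have := nm_lerB E.[z] E.[c]; have := nm_lerBC E.[z] E.[c] => a3 a4.
have H3 : k / 2 < `|nm A.[z] - nm E.[z]|.
  rewrite lter_normr; move: H1 H2; rewrite /k.
  by case: (ger0P (nm A.[c] - nm E.[c])) => s1 H1 H2; apply/orP;
     [left|right]; lra.
nra.
Qed.


(* [h := A - v *: E] has a root within deg h * |h(z) / h'(z)| of z. *)
Lemma tube_lift A E : E != 0 -> coprimep A E -> (size E < size A)%N ->
  (forall c, root (wronskian A E) c -> nm A.[c] != nm E.[c]) ->
  exists d L : R, [/\ 0 < d, 0 < L & forall z v, E.[z] != 0 ->
    `|nm (A.[z] / E.[z]) - 1| <= d -> nm (v - A.[z] / E.[z]) <= d ->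
    exists y, [/\ E.[y] != 0, A.[y] / E.[y] = v &
                  nm (y - z) <= L * nm (v - A.[z] / E.[z])]].
Proof.
move=> E0 cAE sEA hW; have W0 := wronskian_neq0 E0 cAE sEA.
have [s e _] := poly_factor W0.
have [r r0 hr] : exists2 d : R, 0 < d & forall c, c \in s ->
    forall z, nm (z - c) < d -> E.[z] != 0 -> d < `|nm (A.[z] / E.[z]) - 1|.
  apply: finite_radius => [c d d' dd h z zd Ez|c cs].
    exact: le_lt_trans dd (h z (lt_le_trans zd dd) Ez).
  apply: generic_tube; apply: hW.
  by rewrite e rootZ ?lead_coef_eq0// root_prod_XsubC.
(* Beyond M, and off the poles, |A / E| is at least 3, so the tube is bounded. *)
have [M hM] : exists M : R, forall z, M <= nm z -> nm E.[z] <= 3^-1 * nm A.[z].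
  by apply: poly_little_o sEA _; rewrite invr_gt0.
have [e1 e10 he1] := poly_bounded E M.
have [e2 e20 he2] := poly_bounded E^`() M.
pose w := nm (lead_coef (wronskian A E)) * r ^+ size s.
have w0 : 0 < w by rewrite mulr_gt0 ?exprn_gt0// nm_gt0 lead_coef_eq0.
pose d := Num.min (Num.min r 1) (w / (2 * e1 * e2)).
have d0 : 0 < d by rewrite !lt_min r0 ltr01 divr_gt0// !mulr_gt0.
pose L := (size A)%:R * (2 * e1 ^+ 2) / w.
exists d, L; split => //.
  rewrite divr_gt0// mulr_gt0 ?mulr_gt0 ?exprn_gt0// ltr0n.
  exact: leq_ltn_trans sEA.
move=> z v Ez tz; set T := A.[z] / E.[z] in tz * => vT.
have [dr d1 dw] : [/\ d <= r, d <= 1 & d <= w / (2 * e1 * e2)].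
  by rewrite /d; split; rewrite !ge_min lexx ?orbT.
have Ez0 : 0 < nm E.[z] by rewrite nm_gt0.
have TE : nm T * nm E.[z] = nm A.[z] by rewrite -nmM divfK.
have zM : nm z <= M.
  rewrite leNgt; apply/negP => /ltW /hM; rewrite -TE.
  have : nm T <= 2 by have := ler_norm (nm T - 1); lra.
  nra.
have E1 := he1 z zM; have E2 := he2 z zM.
(* By the choice of r, a point of the tube is at distance at least r from every root of the
   wronskian. *)
have Wz : w <= nm (wronskian A E).[z].
  rewrite [in leRHS]e hornerZ nmM ler_wpM2l ?nm_ge0// horner_prod nm_prod.
  have hs c : c \in s -> r <= nm (z - c).
    by move=> cs; rewrite leNgt; apply/negP => /(hr c cs) /(_ Ez); lra.
  elim: s hs {e hr w w0 L d d0 tz vT dr d1 dw} => [|c s IH] hs.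
    by rewrite big_nil expr0.
  have rge0 := ltW r0; rewrite big_cons exprS ler_pM ?exprn_ge0//.
    by rewrite hornerXsubC hs// mem_head.
  by apply: IH => b bs; rewrite hs// in_cons bs orbT.
pose h := A - v *: E.
have sh : size h = size A.
  by rewrite size_polyDl// size_polyN (leq_ltn_trans (size_scale_leq _ _)).
have hz : nm h.[z] = nm E.[z] * nm (v - T).
  by rewrite -nmM -nmN /h !hornerE /T; congr nm; field.
have h'z : E.[z] * h^`().[z] = (wronskian A E).[z] - (v - T) * E.[z] * E^`().[z].
  by rewrite /h /wronskian !poly.derivE !hornerE /T; field.
(* The bound d <= w / (2 e1 e2) makes the correction term in [h'z] at most w / 2. *)
have h'b : w / 2 <= e1 * nm h^`().[z].
  have := nm_lerB (wronskian A E).[z] ((v - T) * E.[z] * E^`().[z]).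
  rewrite -h'z !nmM.
  have k1 : nm (v - T) * (nm E.[z] * nm E^`().[z]) <= w / (2 * e1 * e2) * (e1 * e2).
    rewrite ler_pM ?mulr_ge0 ?nm_ge0//; first exact: le_trans vT dw.
    by rewrite ler_pM// nm_ge0.
  have k2 : w / (2 * e1 * e2) * (e1 * e2) = w / 2.
    by field; rewrite !gt_eqF.
  have k3 : nm E.[z] * nm h^`().[z] <= e1 * nm h^`().[z] by rewrite ler_wpM2r ?nm_ge0.
  rewrite k2 in k1; lra.
have h'0 : h^`().[z] != 0.
  by rewrite -nm_gt0; have := nm_ge0 h^`().[z]; nra.
have [y hy yz] := near_root h'0.
have hy0 : A.[y] = v * E.[y].
  by move: hy; rewrite rootE /h !hornerE subr_eq0 => /eqP.
have Ey : E.[y] != 0.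
  apply/negP => Ey; have := coprimep_root cAE; move=> /(_ y).
  by rewrite rootE hy0 (eqP Ey) mulr0 eqxx => /(_ isT).
exists y; split => //; first by rewrite hy0 mulfK.
rewrite nmC /L mulrAC ler_pdivlMr//.
rewrite sh hz in yz.
have N0 : 0 <= (size A).-1%:R :> R by [].
have NA : (size A).-1%:R <= (size A)%:R :> R by rewrite ler_nat leq_pred.
have k1 : nm (z - y) * (w / 2) <= e1 * ((size A).-1%:R * (e1 * nm (v - T))).
  rewrite (le_trans (ler_wpM2l (nm_ge0 _) h'b))// [leLHS]mulrCA (ler_wpM2l (ltW e10))//.
  by rewrite (le_trans yz)// ler_wpM2l// ler_wpM2r// nm_ge0.
have k2 : (size A).-1%:R * (e1 ^+ 2 * nm (v - T)) <= (size A)%:R * (e1 ^+ 2 * nm (v - T)).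
  by rewrite ler_wpM2r// mulr_ge0 ?nm_ge0// exprn_ge0// ltW.
lra.
Qed.

End Lifting.

(** * Fekete points *)

Section Fekete.
Variable R : realType.
Local Notation C := R[i].
Implicit Types (B D : {poly C}) (a z : C).

Lemma lagrange_interpolation (N : nat) (w : 'I_N -> C) B a :
  injective w -> (size B <= N)%N ->
  B.[a] = \sum_i B.[w i] * \prod_(j | j != i) ((a - w j) / (w i - w j)).
Proof.
move=> inj sB.
pose L i := \prod_(j | j != i) ((w i - w j)^-1 *: ('X - (w j)%:P)).
have LE i x : (L i).[x] = \prod_(j | j != i) ((x - w j) / (w i - w j)).
  rewrite horner_prod; apply: eq_bigr => j _.
  by rewrite hornerZ hornerXsubC mulrC.
have sL i : (size (L i) <= N)%N.
  have cP : #|[pred j | j != i]| = N.-1 by rewrite -[in RHS](card_ord N) -(cardC1 i).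
  have N0 : (0 < N)%N by rewrite (leq_ltn_trans _ (ltn_ord i)).
  apply: leq_trans (size_poly_prod_leq _ _) _; rewrite cP leq_subLR.
  rewrite (@leq_trans (\sum_(j | j != i) 2).+1)%N// ?ltnS.
    apply: leq_sum => j _; apply: leq_trans (size_scale_leq _ _) _.
    by rewrite size_XsubC.
  by rewrite sum_nat_const cP muln2 -addnn -addnS prednK.
pose P := \sum_i B.[w i] *: L i.
have Pw i : P.[w i] = B.[w i].
  rewrite /P horner_sum (bigD1 i)//= hornerZ LE [X in _ + X]big1; last first.
    move=> j ji; rewrite hornerZ LE (bigD1 i) 1?eq_sym//=.
    by rewrite subrr mul0r mul0r mulr0.
  rewrite big1 ?mulr1 ?addr0// => j ji.
  by rewrite divff// subr_eq0 (inj_eq inj) eq_sym.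
suff e : B = P.
  rewrite {1}e /P horner_sum; apply: eq_bigr => i _; by rewrite hornerZ LE.
apply/eqP; rewrite -subr_eq0; apply/eqP.
apply: (@roots_geq_poly_eq0 _ _ [seq w i | i <- enum 'I_N]).
- by apply/allP => _ /mapP[i _ ->]; rewrite rootE hornerD hornerN subr_eq0 Pw.
- by rewrite map_inj_uniq// enum_uniq.
- rewrite size_map size_enum_ord (leq_trans (size_polyD _ _))// size_polyN geq_max sB /=.
  apply: leq_trans (size_sum _ _ _) _; apply/bigmax_leqP => i _.
  exact: leq_trans (size_scale_leq _ _) (sL i).
Qed.

(** Bernoulli bounds (3/2)^t below only linearly in t; with l = 2 t this bound is squared and beats
    the left side. The factor b l + 1 is the number of nodes when a polynomial of degree b l is
    interpolated. *)
Lemma exp_beats_linear (b : nat) (c : R) : exists2 l : nat, (0 < l)%N &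
  c * ((b * l)%N.+1)%:R <= (3 / 2) ^+ l.
Proof.
pose t := (Num.bound (4 * (`|c| + 1) * (2 * b%:R + 1))).+1.
have b0 : 0 <= b%:R :> R by [].
have c0 := normr_ge0 c; have c1 := ler_norm c.
have ht : 4 * (`|c| + 1) * (2 * b%:R + 1) < t%:R.
  have h0 : 0 <= 4 * (`|c| + 1) * (2 * b%:R + 1) by apply: mulr_ge0; lra.
  by rewrite (lt_trans (archi_boundP h0))// ltr_nat.
exists (2 * t)%N => //.
have -> : (3 / 2) ^+ (2 * t) = ((3 / 2) ^+ t) ^+ 2 :> R by rewrite mulnC exprM.
have bern : 1 + t%:R / 2 <= (3 / 2) ^+ t :> R.
  elim: t {ht} => [|t IH]; first by rewrite mul0r addr0 expr0.
  by rewrite exprS -natr1; have t0 : 0 <= t%:R :> R by []; nra.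
have t1 : 1 <= t%:R :> R by rewrite ler1n.
rewrite -natr1 !natrM.
apply: (@le_trans _ _ ((1 + t%:R / 2) ^+ 2)); last first.
  by rewrite ler_pXn2r// nnegrE; lra.
apply: (@le_trans _ _ (t%:R ^+ 2 / 4)); last nra.
apply: (@le_trans _ _ (`|c| * ((2 * b%:R + 1) * t%:R))).
  apply: (@le_trans _ _ (`|c| * (b%:R * (2 * t%:R) + 1))).
    by rewrite ler_wpM2r//; nra.
  by rewrite ler_wpM2l//; nra.
have h : `|c| * (2 * b%:R + 1) <= t%:R / 4 by nra.
by rewrite mulrA expr2 [leRHS]mulrAC ler_wpM2r.
Qed.

(** A substitute for an attained maximum. In the application f contains the square of the factor
    that changes, so 4 becomes the factor 2 of [fekete_points]. *)
Lemma near_maximizer (T : Type) (A : set T) (f : T -> R) (M : R) :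
  (exists2 x, A x & 0 < f x) -> (forall x, A x -> f x <= M) ->
  exists x, [/\ A x, 0 < f x & forall y, A y -> f y <= 4 * f x].
Proof.
move=> [x0 Ax0 fx0] fM; pose S := [set f x | x in A]%classic.
have hS : has_sup S.
  by split; [exists (f x0), x0|exists M => _ [x Ax <-]; exact: fM].
have ub y : A y -> f y <= sup S by move=> Ay; apply: ub_le_sup; [case: hS|exists y].
have sS : 0 < sup S by apply: lt_le_trans (ub _ Ax0).
have [|_ [x Ax <-] hx] := @sup_adherent _ S (sup S * (3 / 4)) _ hS.
  by lra.
exists x; split => //; first lra.
by move=> y /ub; lra.
Qed.

Section FeketePoints.
Variables (F : set C) (g : C -> R) (N : nat) (M G : R).
Hypothesis F_inf : forall s : seq C, exists2 z, F z & z \notin s.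
Hypothesis F_bd : forall z, F z -> nm z <= M.
Hypothesis g_bd : forall z, F z -> 0 < g z <= G.

(** [phi] is the square of the weighted Vandermonde product: every pair of nodes enters twice and
    every weight squared. The part involving node i is then the square of [lag v i (v i)], and
    [rest] is free of that node. *)
Let phi (v : 'I_N -> C) := \prod_i (\prod_(j | j != i) nm (v i - v j) * g (v i) ^+ 2).
Let lag (v : 'I_N -> C) i z := \prod_(j | j != i) nm (z - v j) * g z.
Let rest (v : 'I_N -> C) i :=
  \prod_(j | j != i) (\prod_(k | (k != j) && (k != i)) nm (v j - v k) * g (v j) ^+ 2).

Let phiE v i : phi v = lag v i (v i) ^+ 2 * rest v i.
Proof.
have -> : phi v = lag v i (v i) * g (v i) * \prod_(j | j != i) (nm (v i - v j) *
    (\prod_(k | (k != j) && (k != i)) nm (v j - v k) * g (v j) ^+ 2)).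
  rewrite /phi (bigD1 i)//= /lag; congr (_ * _); first by ring.
  apply: eq_bigr => j ji; rewrite (bigD1 i) 1?eq_sym//= nmC mulrA.
  by [].
by rewrite big_split /= /lag /rest; ring.
Qed.

(* Replacing [w i] by z multiplies [phi w] by the square of [lag w i z / lag w i (w i)], so an
   almost maximal [phi w] is enough and F need not be closed. *)
Lemma fekete_points : exists w : 'I_N -> C, [/\ injective w, forall i, F (w i) &
  forall i z, F z -> lag w i z <= 2 * lag w i (w i)].
Proof.
have [v vinj Fv] : exists2 v : 'I_N -> C, injective v & forall i, F (v i).
  have [s us [ss Fs]] : exists2 s : seq C, uniq s & size s = N /\ forall z, z \in s -> F z.
    elim: N => [|n [s us [ss Fs]]]; first by exists [::].
    have [z Fz zs] := F_inf s; exists (z :: s); first by rewrite /= zs.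
    by split => [|y]; rewrite /= ?ss// in_cons => /predU1P[->|/Fs].
  exists (fun i : 'I_N => nth 0 s i) => [i j|i]; last by apply/Fs/mem_nth; rewrite ss.
  by move=> /eqP; rewrite nth_uniq ?ss// => /eqP/val_inj.
have [z0 Fz0 _] := F_inf [::].
have M0 : 0 <= M by apply: le_trans (F_bd Fz0); exact: nm_ge0.
have G0 : 0 < G by have /andP[] := g_bd Fz0; exact: lt_le_trans.
have phi_gt0 u : (forall i, F (u i)) -> injective u -> 0 < phi u.
  move=> Fu ui; apply: prodr_gt0 => i _; rewrite mulr_gt0//; last first.
    by rewrite exprn_gt0//; have /andP[] := g_bd (Fu i).
  by apply: prodr_gt0 => j ji; rewrite nm_gt0 subr_eq0 (inj_eq ui) eq_sym.
have lag_ge0 u i z : F z -> 0 <= lag u i z.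
  move=> Fz; rewrite mulr_ge0//; first by apply: prodr_ge0 => j _; exact: nm_ge0.
  by have /andP[/ltW] := g_bd Fz.
have [||w [Fw pw hw]] := @near_maximizer _ [set u : 'I_N -> C | forall i, F (u i)]%classic
   phi (\prod_(i < N) (\prod_(j < N | j != i) (2 * M) * G ^+ 2)).
- by exists v => //; exact: phi_gt0.
- move=> u Fu; apply: ler_prod => i _.
  have /andP[g0 gG] := g_bd (Fu i).
  have p0 : 0 <= \prod_(j | j != i) nm (u i - u j) by apply: prodr_ge0 => j _; exact: nm_ge0.
  have g0' := ltW g0; rewrite mulr_ge0 ?exprn_ge0//= ler_pM ?exprn_ge0//.
  + apply: ler_prod => j _; rewrite nm_ge0 /= (le_trans (nmB _ _))//.
    by rewrite mulr_natl mulr2n lerD// F_bd.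
  + by rewrite ler_pXn2r// nnegrE// ltW.
exists w; split => //.
  move=> i j wij; apply/eqP; rewrite eq_sym; apply/negPn/negP => ij.
  move: pw; rewrite /phi (bigD1 i)//= (bigD1 j)//= wij subrr nm0 !mul0r ltxx.
  by [].
move=> i z Fz; pose u j := if j == i then z else w j.
have Fu j : F (u j) by rewrite /u; case: ifP.
have := hw u Fu; rewrite (phiE u i) (phiE w i).
have -> : lag u i (u i) = lag w i z.
  by rewrite /lag /u eqxx; congr (_ * _); apply: eq_bigr => j /negbTE ->.
have -> : rest u i = rest w i.
  apply: eq_bigr => j ji; rewrite /u (negbTE ji); congr (_ * _).
  by apply: eq_bigr => k /andP[_ /negbTE ->].
move: pw; rewrite (phiE w i); set r := rest w i => pw.
have l0 := lag_ge0 w i z Fz; have l1 := lag_ge0 w i (w i) (Fw i).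
have r0 : 0 < r.
  by rewrite ltNge; apply/negP => r0; move: pw; rewrite ltNge => /negP; apply; nra.
rewrite mulrA ler_pM2r// => h; rewrite leNgt; apply/negP; nra.
Qed.

End FeketePoints.

(** Put g = |D|^-(k l). Interpolating B^l at the nodes, where |B^l| g <= 1, bounds |B^l(a)| g(a) by
    the sum over i of lag i a / lag i (w i). Each term is at most |T(a)| g(a) / dlt / lag i0 (w i0),
    and there are only b l + 1 of them, against a left side of at least (3/2)^l. The bound on F is
    the Fekete property of the single node i0. *)
Lemma fekete_separation (F K : set C) D (b k : nat) (M d0 dlt Lam : R) :
  0 < d0 -> 0 < dlt -> 0 < Lam ->
  (forall s : seq C, exists2 z, F z & z \notin s) ->
  (forall z, F z -> nm z <= M) -> (forall z, F z -> d0 <= nm D.[z]) ->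
  (forall a, K a -> D.[a] != 0 /\ forall z, F z -> dlt <= nm (a - z)) ->
  (forall a, K a -> exists B, [/\ (size B <= b.+1)%N,
     forall z, F z -> nm B.[z] <= nm D.[z] ^+ k &
     3 / 2 * nm D.[a] ^+ k <= nm B.[a]]) ->
  exists l : nat, (0 < l)%N /\ exists w : 'I_((b * l).+1) -> C,
    (forall i, F (w i)) /\ exists2 m : R, 0 < m &
    let T := \prod_i ('X - (w i)%:P) in
    (forall z, F z -> nm T.[z] <= m * nm D.[z] ^+ (k * l)) /\
    (forall a, K a -> Lam * m * nm D.[a] ^+ (k * l) <= nm T.[a]).
Proof.
move=> d00 dlt0 Lam0 Finf FM FD KD hB.
have [z0 Fz0 _] := Finf [::].
have M0 : 0 <= M by apply: le_trans (FM _ Fz0); exact: nm_ge0.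
pose M' := M + 1; have M'0 : 0 < M' by rewrite /M'; lra.
have [l l0 hl] := exp_beats_linear b (Lam * (4 * M') / dlt).
exists l; split => //.
pose g z := (nm D.[z])^-1 ^+ (k * l).
have FD0 z : F z -> 0 < nm D.[z] by move=> /FD; apply: lt_le_trans.
have gD z : D.[z] != 0 -> 0 < g z by move=> Dz; rewrite exprn_gt0// invr_gt0 nm_gt0.
have gK z x : D.[z] != 0 -> x * g z * nm D.[z] ^+ (k * l) = x.
  move=> Dz; rewrite /g -mulrA -exprMn mulVf ?expr1n ?mulr1// nm_eq0 //.
have gF z : F z -> 0 < g z <= d0^-1 ^+ (k * l).
  move=> Fz; rewrite gD -?nm_gt0 ?FD0//= lerXn2r ?nnegrE ?invr_ge0 ?nm_ge0 ?(ltW d00)//.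
  by rewrite lef_pV2 ?posrE ?FD0// FD.
have [w [winj Fw hw]] := fekete_points (b * l).+1 Finf FM gF.
exists w; split => //.
pose lag i z := \prod_(j | j != i) nm (z - w j) * g z.
have lag_ge0 i z : D.[z] != 0 -> 0 <= lag i z.
  by move=> /gD/ltW gz; apply: mulr_ge0 => //; apply: prodr_ge0 => j _; exact: nm_ge0.
have lag_gt0 i : 0 < lag i (w i).
  rewrite mulr_gt0//; last by have /andP[] := gF _ (Fw i).
  by apply: prodr_gt0 => j ji; rewrite nm_gt0 subr_eq0 (inj_eq winj) eq_sym.
(* The Fekete property of any one node gives the bound on F; the smallest value is chosen for the
   bound on K, where every node enters through the inverse of its value. *)
have [i0 hi0] : exists i0, forall i, lag i0 (w i0) <= lag i (w i).
  case: (@arg_minP _ _ _ ord0 predT (fun i => lag i (w i)) isT) => i0 _ h.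
  by exists i0 => i; apply: h.
pose T := \prod_i ('X - (w i)%:P).
have TE i z : nm T.[z] * g z = nm (z - w i) * lag i z.
  rewrite /T horner_prod nm_prod (bigD1 i)//= hornerXsubC /lag mulrA; congr (_ * _ * _).
  by apply: eq_bigr => j _; rewrite hornerXsubC.
exists (4 * M' * lag i0 (w i0)); first by rewrite mulr_gt0// mulr_gt0.
split => [z Fz|a Ka].
  have Dz : D.[z] != 0 by rewrite -nm_gt0 FD0.
  rewrite -[leLHS](gK z)// ler_wpM2r ?exprn_ge0 ?nm_ge0// (TE i0).
  have -> : 4 * M' * lag i0 (w i0) = (2 * M') * (2 * lag i0 (w i0)) by ring.
  rewrite ler_pM ?nm_ge0 ?lag_ge0// ?hw//.
  have := FM _ Fz; have := FM _ (Fw i0); have := nmB z (w i0); rewrite /M'; lra.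
have [Da aF] := KD _ Ka.
rewrite -[leRHS](gK a)// ler_wpM2r ?exprn_ge0 ?nm_ge0//.
have [B [sB BF Ba]] := hB _ Ka.
have Ta i : lag i a <= nm T.[a] * g a / dlt.
  rewrite ler_pdivlMr// (TE i) mulrC ler_wpM2r ?aF//.
  exact: lag_ge0.
have Tg0 : 0 <= nm T.[a] * g a / dlt.
  by rewrite !mulr_ge0 ?nm_ge0 ?invr_ge0 ?(ltW (gD _ _))// ltW.
have ineq : (3 / 2) ^+ l <= \sum_i lag i a / lag i (w i).
  have : (3 / 2) ^+ l <= nm (B ^+ l).[a] * g a.
    have Dk : 0 < nm D.[a] ^+ k by rewrite exprn_gt0// nm_gt0.
    have h1 : 3 / 2 <= nm B.[a] * (nm D.[a])^-1 ^+ k by rewrite exprVn ler_pdivlMr.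
    have h0 : 0 <= 3 / 2 :> R by lra.
    by rewrite horner_exp nmX /g exprM -exprMn lerXn2r ?nnegrE// (le_trans h0).
  move/le_trans; apply.
  have sBl : (size (B ^+ l) <= (b * l).+1)%N.
    apply: leq_trans (size_poly_exp_leq _ _) _.
    by rewrite ltnS leq_mul// -subn1 leq_subLR add1n.
  rewrite (lagrange_interpolation a winj sBl).
  rewrite (le_trans (ler_wpM2r (ltW (gD _ Da)) (nm_sum _ _ _)))// mulr_suml.
  apply: ler_sum => i _; rewrite nmM nm_prod.
  rewrite (eq_bigr (fun j => nm (a - w j) * (nm (w i - w j))^-1)); last first.
    by move=> j _; rewrite nm_div.
  rewrite big_split /= prodfV -mulrA mulrAC.
  have gwi : 0 < g (w i) by have /andP[] := gF _ (Fw i).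
  have -> : lag i a / lag i (w i) = (g (w i))^-1 * (lag i a / \prod_(j | j != i) nm (w i - w j)).
    by rewrite /lag invfM; ring.
  rewrite -/(lag i a) ler_wpM2r//.
    rewrite divr_ge0 ?prodr_ge0//; last by move=> *; exact: nm_ge0.
    exact: lag_ge0.
  rewrite horner_exp nmX /g exprVn invrK exprM ler_pXn2r ?nnegrE ?exprn_ge0 ?nm_ge0//.
  exact: BF.
have ineq2 : \sum_i lag i a / lag i (w i) <=
   (b * l).+1%:R * (nm T.[a] * g a / dlt / lag i0 (w i0)).
  rewrite mulr_natl -[X in _ *+ X]card_ord -sumr_const; apply: ler_sum => i _.
  rewrite ler_pM ?Ta ?lag_ge0 ?invr_ge0 ?(ltW (lag_gt0 _))//.
  by rewrite lef_pV2 ?posrE.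
have := le_trans hl (le_trans ineq ineq2).
rewrite mulrC ler_pM2l ?ltr0n// ler_pdivlMr// ler_pdivlMr//.
by move=> h; rewrite (le_trans _ h)// le_eqVlt; apply/orP; left; apply/eqP; field; rewrite gt_eqF.
Qed.

End Fekete.

(** * Pole pushing *)

Section PolePushing.
Variable R : realType.
Local Notation C := R[i].
Variables (F : set C) (D : {poly C}).
Hypothesis DF : forall z, F z -> D.[z] != 0.
Implicit Types (f g : C -> C) (a b z : C) (B : {poly C}).

(** Fractions whose poles lie among the roots of D and infinity; the values of f at the roots of D
    are left free. *)
Definition regular f :=
  exists B k, forall z, D.[z] != 0 -> f z = B.[z] / D.[z] ^+ k.

Lemma regular_cst a : regular (fun=> a).
Proof. by exists a%:P, 0%N => z _; rewrite expr0 divr1 hornerC. Qed.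

Lemma regularD f g : regular f -> regular g -> regular (fun z => f z + g z).
Proof.
move=> [A [k hA]] [B [l hB]]; exists (A * D ^+ l + B * D ^+ k), (k + l)%N => z Dz.
rewrite hA// hB// !(hornerE, horner_exp) exprD; field.
by rewrite !expf_neq0.
Qed.

Lemma regularM f g : regular f -> regular g -> regular (fun z => f z * g z).
Proof.
move=> [A [k hA]] [B [l hB]]; exists (A * B), (k + l)%N => z Dz.
by rewrite hA// hB// hornerM exprD invfM mulrACA.
Qed.

Lemma regularX f n : regular f -> regular (fun z => f z ^+ n).
Proof.
move=> rf; elim: n => [|n IH]; first exact: regular_cst.
by under eq_fun do rewrite exprS; exact: regularM.
Qed.

Lemma regularB f g : regular f -> regular g -> regular (fun z => f z - g z).
Proof.
move=> rf rg; under eq_fun do rewrite -mulN1r.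
by apply: regularD => //; apply: regularM => //; exact: regular_cst.
Qed.

Lemma regular_div_XsubC f a : D.[a] != 0 -> regular f -> f a = 0 ->
  exists2 g, regular g & forall z, D.[z] != 0 -> f z = (z - a) * g z.
Proof.
move=> Da [B [k hB]]; rewrite hB// => /eqP.
rewrite mulf_eq0 invr_eq0 expf_eq0 (negbTE Da) andbF orbF => /factor_theorem[W BW].
exists (fun z => W.[z] / D.[z] ^+ k); first by exists W, k.
by move=> z Dz; rewrite hB// BW hornerM hornerXsubC mulrAC mulrA mulrC mulrA; ring.
Qed.

Definition separated a := D.[a] != 0 /\
  exists f, [/\ regular f, forall z, F z -> nm (f z) <= 1 & 2 <= nm (f a)].

(* Truncated geometric series for 1/(z - b) in powers of an approximation w of 1/(z - a) on F. *)
Lemma push_separated a b (r : R) : 0 < r -> (forall z, F z -> r <= nm (z - a)) ->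
  2 * nm (b - a) <= r -> D.[b] != 0 -> separated a -> separated b.
Proof.
move=> r0 Fr ab Db [Da [f [rf fF fa]]]; split => //.
have fa0 : f a != 0 by rewrite -nm_gt0; lra.
(* [e] is 1 at a and at most 1/16 on F. Hence 1 - e is divisible by z - a, and the quotient w is
   close to 1 / (z - a) on F without having a pole at a. *)
pose e z := (f z / f a) ^+ 4.
have re : regular e by apply/regularX/regularM => //; exact: regular_cst.
have eF z : F z -> nm (e z) <= 16^-1.
  move=> Fz; rewrite nmX nm_div (_ : 16^-1 = 2^-1 ^+ 4 :> R); last by field.
  apply: lerXn2r; rewrite ?nnegrE ?divr_ge0 ?nm_ge0 ?invr_ge0//.
  rewrite ler_pdivrMr; last lra.
  by have := fF z Fz; lra.
have [||w rw hw] := @regular_div_XsubC (fun z => 1 - e z) a Da.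
- by apply: regularB => //; exact: regular_cst.
- by rewrite /e divff// expr1n subrr.
pose t z := (b - a) * w z.
pose s z := 1 + t z * (1 + t z * (1 + t z * (1 + t z))).
have rt : regular t by apply: regularM => //; exact: regular_cst.
have r1 : regular (fun=> 1) by exact: regular_cst.
have rs : regular s.
  by do 3! (apply: regularD => //; apply: regularM => //); exact: regularD.
(* The value at b is exactly 2. On F the bracket equals t^5 + e s, of modulus at most (17/32)^5 +
   4/16 <= 1/2. *)
exists (fun z => 2 * (1 - (z - b) * w z * s z)); split.
- apply: regularM; first exact: regular_cst.
  apply: regularB => //; apply: regularM => //; apply: regularM => //.
  apply: regularB; last exact: regular_cst.
  by exists 'X, 0%N => z _; rewrite expr0 divr1 hornerX.
- move=> z Fz; have Dz := DF Fz; have hwz : 1 - e z = (z - a) * w z := hw z Dz.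
  have -> : 1 - (z - b) * w z * s z = t z ^+ 5 + e z * s z.
    have -> : (z - b) * w z = 1 - e z - t z by rewrite hwz /t; ring.
    by rewrite /s; ring.
  have tz : nm (t z) <= 17 / 32.
    have z0 : nm (z - a) * nm (w z) <= 17 / 16.
      by rewrite -nmM -hwz (le_trans (nmB _ _))// nm1; have := eF z Fz; lra.
    rewrite /t nmM; have := Fr z Fz; have := nm_ge0 (w z); have := nm_ge0 (b - a).
    nra.
  have sz : nm (s z) <= 4.
    have n0 := nm_ge0 (t z).
    have step x y : nm x <= y -> nm (1 + t z * x) <= 1 + 17 / 32 * y.
      move=> xy; rewrite (le_trans (nmD _ _))// nm1 lerD2l nmM.
      by rewrite ler_pM ?nm_ge0.
    have h1 : nm (1 + t z) <= 1 + 17 / 32 by rewrite (le_trans (nmD _ _))// nm1 lerD2l.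
    have := step _ _ (step _ _ (step _ _ h1)); rewrite -/(s z); lra.
  rewrite nmM nm_nat.
  have t4 : nm (t z ^+ 5) <= (17 / 32) ^+ 5.
    by rewrite nmX; apply: lerXn2r; rewrite ?nnegrE ?nm_ge0//; lra.
  have es : nm (e z * s z) <= 16^-1 * 4 by rewrite nmM ler_pM ?nm_ge0 ?eF.
  have := nmD (t z ^+ 5) (e z * s z).
  have h5 : (17 / 32) ^+ 5 <= 4^-1 :> R by lra.
  lra.
- by rewrite subrr !mul0r subr0 mulr1 nm_nat.
Qed.

(** [separated] with the degree of the numerator and the pole order made explicit, and denominators
    cleared. Interpolation needs a common n and k for all points of the core. *)
Definition separated_by (t : R) (n k : nat) a := exists B, [/\ (size B <= n.+1)%N,
     forall z, F z -> nm B.[z] <= nm D.[z] ^+ k &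
     t * nm D.[a] ^+ k <= nm B.[a]].

Lemma separated_by_separated n k a : D.[a] != 0 -> separated_by 2 n k a -> separated a.
Proof.
move=> Da [B [_ BF Ba]]; split => //; exists (fun z => B.[z] / D.[z] ^+ k); split.
- by exists B, k.
- move=> z Fz; rewrite nm_div nmX ler_pdivrMr ?mul1r ?BF// exprn_gt0// nm_gt0.
  exact: DF.
- by rewrite nm_div nmX ler_pdivlMr// exprn_gt0// nm_gt0.
Qed.

(** The fraction d / (z - p), written over D. *)
Lemma separated_near_pole p (d : R) : 0 < d -> root D p ->
  (forall z, F z -> d <= nm (z - p)) ->
  exists n k, forall b, 2 * nm (b - p) <= d -> separated_by 2 n k b.
Proof.
move=> d0 Dp Fd; have /factor_theorem[D1 eD] := Dp.
exists (size (d%:C *: D1)), 1%N => b bd; exists (d%:C *: D1); split => //.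
- move=> z /Fd h; rewrite eD !hornerE expr1 !nmM nm_real gtr0_norm// mulrC.
  by rewrite ler_wpM2l// nm_ge0.
- rewrite eD !hornerE expr1 !nmM nm_real gtr0_norm// mulrCA [leRHS]mulrC.
  by rewrite ler_wpM2l// nm_ge0.
Qed.

(** The polynomial z / M. *)
Lemma separated_near_infty (M : R) : 0 < M -> (forall z, F z -> nm z <= M) ->
  exists n k, forall b, 2 * M <= nm b -> separated_by 2 n k b.
Proof.
move=> M0 FM; exists (size (M^-1%:C *: 'X : {poly C})), 0%N => b bM.
exists (M^-1%:C *: 'X); split => //.
- move=> z /FM h; rewrite !hornerE nmM nm_real gtr0_norm ?invr_gt0// mulrC.
  by rewrite ler_pdivrMr// mul1r.
- by rewrite mulr1 !hornerE nmM nm_real gtr0_norm ?invr_gt0// mulrC ler_pdivlMr.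
Qed.

(** Numerator and denominator are multiplied by D^k'; this brings two pairs (n, k) to a common
    one. *)
Lemma separated_by_mono t (n k n' k' : nat) a : separated_by t n k a ->
  (n + (size D).-1 * k' <= n')%N -> separated_by t n' (k + k') a.
Proof.
move=> [B [sB BF Ba]] le; exists (B * D ^+ k'); split.
- apply: leq_trans (size_polyMleq _ _) _; rewrite -subn1 leq_subLR add1n.
  apply: leq_trans (leq_add sB (size_poly_exp_leq D k')) _.
  by rewrite addSn addnS !ltnS.
- move=> z Fz; rewrite hornerM horner_exp nmM nmX exprD ler_wpM2r ?exprn_ge0 ?nm_ge0//.
  exact: BF.
- by rewrite hornerM horner_exp nmM nmX exprD mulrA ler_wpM2r ?exprn_ge0 ?nm_ge0.
Qed.

Lemma separated_byW t n k a : t <= 2 -> separated_by 2 n k a -> separated_by t n k a.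
Proof.
move=> t2 [B [sB BF Ba]]; exists B; split => //; apply: le_trans Ba.
by rewrite ler_wpM2r// exprn_ge0// nm_ge0.
Qed.

(** The margin between 2 and 3/2 pays for moving the point; 3/2 exceeds 1, so it still grows under
    powers. *)
Lemma separated_by_near a : separated a -> exists n k, exists2 d : R, 0 < d &
  forall y, nm (y - a) < d -> separated_by (3 / 2) n k y.
Proof.
move=> [Da [f [[B [k hB]] fF fa]]]; exists (size B), k.
have Dk0 : 0 < nm (D ^+ k).[a] by rewrite horner_exp nm_gt0 expf_neq0.
have Dk1 : 0 < nm (D ^+ k).[a] / 5 by rewrite divr_gt0.
have [d1 d10 h1] := poly_continuous B a Dk1.
have [d2 d20 h2] := poly_continuous (D ^+ k) a Dk1.
exists (Num.min d1 d2); first by rewrite lt_min d10.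
move=> y; rewrite lt_min => /andP[/h1 H1 /h2 H2]; exists B; split => //.
  move=> z Fz; have := fF z Fz; rewrite hB ?DF// nm_div nmX ler_pdivrMr ?mul1r//.
  by rewrite exprn_gt0// nm_gt0 DF.
move: fa; rewrite hB// nm_div ler_pdivlMr; last by rewrite -horner_exp.
rewrite -!nmX -!horner_exp => fa.
have := nm_lerBC B.[y] B.[a]; have := nm_lerB (D ^+ k).[y] (D ^+ k).[a].
lra.
Qed.

End PolePushing.

(** * The spherical metric *)

Section Trigonometry.
Variable R : realType.
Implicit Types x y : R.

Lemma sin_MVT x : 0 <= x -> exists2 c, 0 <= c <= x & sin x = cos c * x.
Proof.
move=> x0; have [|c] := @MVT_segment R sin cos 0 x x0 (fun y _ => is_derive_sin y).
  exact/continuous_subspaceT/continuous_sin.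
by rewrite in_itv /= sin0 !subr0; exists c.
Qed.

Lemma sin_le_id x : 0 <= x -> sin x <= x.
Proof. by move=> x0; have [c _ ->] := sin_MVT x0; rewrite ler_piMl// cos_le1. Qed.

Lemma cos_half x : cos x = 1 - 2 * sin (x / 2) ^+ 2.
Proof.
have e : x = (x / 2) *+ 2 by rewrite -mulr_natr; field.
by rewrite {1}e cos_mulr2n cos2sin2; ring.
Qed.

Lemma one_sub_cos_le x : 0 <= x <= pi -> 1 - cos x <= x ^+ 2 / 2.
Proof.
move=> /andP[x0 xpi]; have x2 : 0 <= x / 2 by lra.
have s0 : 0 <= sin (x / 2) by rewrite sin_ge0_pi// x2; lra.
by rewrite cos_half; have := sin_le_id x2; nra.
Qed.

(** For x / 2 <= 1 the mean value theorem gives sin y >= y / 2 at y = x / 2. Beyond, sin (x / 2) >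
    1/2 while x < 4, which is where 32 comes from. *)
Lemma le_one_sub_cos x : 0 <= x <= pi -> x ^+ 2 <= 32 * (1 - cos x).
Proof.
move=> /andP[x0 xpi]; have x2 : 0 <= x / 2 by lra.
have half y : 0 <= y <= 1 -> y / 2 <= sin y.
  move=> /andP[y0 y1]; have [c /andP[c0 cy] ->] := sin_MVT y0.
  have := one_sub_cos_le (x := c); rewrite c0 /= (le_trans cy)//; last first.
    by have := @pi_ge2 R; lra.
  by move=> /(_ isT) h; nra.
have pih := @pihalf_lt2 R.
have [h|h] := leP (x / 2) 1.
  by rewrite cos_half; have := half (x / 2); rewrite x2 h => /(_ isT); nra.
have h1 := half 1; rewrite ler01 lexx in h1.
have := h1 isT; rewrite cos_half.
have : sin 1 < sin (x / 2).
  by rewrite ltr_sin// in_itv /=; apply/andP; split; have := @pi_ge2 R; lra.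
nra.
Qed.

End Trigonometry.

Section SphereMetric.
Variable R : realType.
Local Notation C := R[i].
Local Notation S := (sphere R).
Implicit Types (a b q : C) (x y z : S).

Definition spread a : R := 1 + nm a ^+ 2.

Lemma spread_ge1 a : 1 <= spread a.
Proof. by rewrite /spread lerDl exprn_ge0// nm_ge0. Qed.

Lemma spread_gt0 a : 0 < spread a.
Proof. by have := spread_ge1 a; lra. Qed.

(* Half the squared chord. *)
Definition gap x y : R :=
  match x, y with
  | Some a, Some b => 2 * nm (a - b) ^+ 2 / (spread a * spread b)
  | Some a, None | None, Some a => 2 / spread a
  | None, None => 0
  end.

Lemma gapE x y : gap x y = 1 - dot3 (stereo x) (stereo y).
Proof.
have pos (a b : R) : a ^+ 2 + b ^+ 2 + 1 != 0.
  by rewrite gt_eqF// ltr_wpDl// addr_ge0// sqr_ge0.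
have pos' (a b : R) : 1 + (a ^+ 2 + b ^+ 2) != 0 by rewrite addrC pos.
case: x y => [[a b]|] [[c d]|] /=; rewrite /dot3 /spread /= ?nm_sqr.
- by field; rewrite ?pos ?pos'.
- by field; rewrite ?pos ?pos'.
- by field; rewrite ?pos ?pos'.
- by ring.
Qed.

Lemma cos_sdist x y : cos (sdist x y) = 1 - gap x y.
Proof. by rewrite gapE /sdist acosK ?in_itv ?dot3_bound//; ring. Qed.

Lemma sdist_bound x y : 0 <= sdist x y <= pi.
Proof. by rewrite /sdist acos_ge0 ?acos_lepi ?dot3_bound. Qed.

Lemma sdist_ge0 x y : 0 <= sdist x y.
Proof. by case/andP: (sdist_bound x y). Qed.

Lemma sdist_le_gap x y x' y' : (sdist x y <= sdist x' y') = (gap x y <= gap x' y').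
Proof.
have h := ltr_cos; rewrite leNgt [in RHS]leNgt; congr (~~ _).
by rewrite -(@ltr_cos R) ?in_itv ?sdist_bound//= !cos_sdist ltrD2l ltrN2.
Qed.

Lemma sdist_eq_gap x y x' y' : gap x y = gap x' y' -> sdist x y = sdist x' y'.
Proof. by move=> e; apply/eqP; rewrite eq_le !sdist_le_gap e lexx. Qed.

Lemma gap_le x y : 2 * gap x y <= sdist x y ^+ 2.
Proof. by have := one_sub_cos_le (sdist_bound x y); rewrite cos_sdist; lra. Qed.

Lemma gap_ge x y : sdist x y ^+ 2 <= 32 * gap x y.
Proof. by have := le_one_sub_cos (sdist_bound x y); rewrite cos_sdist; lra. Qed.

Lemma sdist_le_nm a b : sdist (Some a) (Some b) <= 8 * nm (a - b).
Proof.
have n0 := nm_ge0 (a - b); rewrite -(@ler_pXn2r _ 2)// ?nnegrE ?sdist_ge0 ?mulr_ge0//.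
apply: le_trans (gap_ge _ _) _; rewrite /gap exprMn.
have : nm (a - b) ^+ 2 / (spread a * spread b) <= nm (a - b) ^+ 2.
  rewrite ler_pdivrMr ?mulr_gt0 ?spread_gt0// ler_peMr ?exprn_ge0//.
  by rewrite mulr_ege1 ?spread_ge1.
lra.
Qed.

Lemma sqr_spread a : spread a <= (1 + nm a) ^+ 2.
Proof. by rewrite /spread; have := nm_ge0 a; nra. Qed.

Lemma nm_le_sdist a b :
  nm (a - b) <= (1 + nm a) * (1 + nm b) * sdist (Some a) (Some b).
Proof.
have a0 := nm_ge0 a; have b0 := nm_ge0 b.
rewrite -(@ler_pXn2r _ 2)// ?nnegrE ?nm_ge0 ?mulr_ge0 ?sdist_ge0 ?addr_ge0//.
rewrite exprMn; have := gap_le (Some a) (Some b); rewrite /gap => h.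
have s0 : 0 < spread a * spread b by rewrite mulr_gt0 ?spread_gt0.
have : nm (a - b) ^+ 2 <= (spread a * spread b) * sdist (Some a) (Some b) ^+ 2.
  rewrite mulrC -ler_pdivrMr// (le_trans _ h)//.
  have t0 : 0 <= nm (a - b) ^+ 2 / (spread a * spread b).
    by rewrite divr_ge0 ?exprn_ge0 ?nm_ge0 ?ltW.
  lra.
move/le_trans; apply; rewrite ler_wpM2r ?exprn_ge0 ?sdist_ge0//.
by rewrite exprMn ler_pM ?sqr_spread// ltW ?spread_gt0.
Qed.

Lemma sdist_infty_le a : a != 0 -> sdist (Some a) None <= 8 / nm a.
Proof.
rewrite -nm_gt0 => a0.
rewrite -(@ler_pXn2r _ 2)// ?nnegrE ?sdist_ge0 ?divr_ge0 ?nm_ge0//.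
apply: le_trans (gap_ge _ _) _; rewrite /gap exprMn exprVn.
have : (spread a)^-1 <= (nm a ^+ 2)^-1.
  by rewrite lef_pV2 ?posrE ?spread_gt0 ?exprn_gt0// /spread lerDr.
lra.
Qed.

Lemma sdist_infty_ge a : 1 <= (1 + nm a) * sdist (Some a) None.
Proof.
have a0 := nm_ge0 a.
rewrite -(@ler_pXn2r _ 2)// ?nnegrE ?mulr_ge0 ?sdist_ge0 ?addr_ge0//.
rewrite expr1n exprMn; have := gap_le (Some a) None; rewrite /gap => h.
have s0 := spread_gt0 a.
have : 1 <= spread a * sdist (Some a) None ^+ 2.
  rewrite mulrC -ler_pdivrMr// (le_trans _ h)// mulrA ler_wpM2r ?invr_ge0 ?ltW//; lra.
move/le_trans; apply; rewrite ler_wpM2r ?exprn_ge0 ?sdist_ge0//.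
exact: sqr_spread.
Qed.

(** The rotation of the sphere given, up to a scalar, by the unitary matrix with rows (conj q, 1)
    and (-1, q). It sends q to infinity, and its inverse has the same form with parameter -conj
    q. *)
Definition rot q x : S :=
  match x with
  | Some a => if a == q then None else Some ((conjc q * a + 1) / (q - a))
  | None => Some (- conjc q)
  end.

Lemma conjc_oppK q : conjc (- conjc q) = - q.
Proof. by case: q => u v; rewrite /= opprK. Qed.

Lemma rotK q : cancel (rot q) (rot (- conjc q)).
Proof.
have key : 1 + conjc q * q != 0.
  case: q => u v; rewrite eq_complex /= negb_and; apply/orP; left.
  by rewrite gt_eqF//; have := sqr_ge0 u; have := sqr_ge0 v; nra.
case=> [a|]; last by rewrite /rot eqxx.
rewrite {2}/rot; case: eqVneq => [->|aq]; first by rewrite /rot conjc_oppK opprK.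
rewrite /rot.
have qa : q - a != 0 by rewrite subr_eq0 eq_sym.
have e : (conjc q * a + 1) / (q - a) + conjc q = (1 + conjc q * q) / (q - a) by field.
rewrite -[_ == _]subr_eq0 opprK e mulf_eq0 invr_eq0 (negbTE qa) (negbTE key) /=.
congr Some; rewrite conjc_oppK.
have -> : - conjc q - (conjc q * a + 1) / (q - a) = - ((1 + conjc q * q) / (q - a)).
  by rewrite -e; ring.
by field; rewrite qa key.
Qed.

Lemma rotVK q : cancel (rot (- conjc q)) (rot q).
Proof. by have := @rotK (- conjc q); rewrite conjc_oppK opprK. Qed.

Lemma spread_rot q a : a != q ->
  spread ((conjc q * a + 1) / (q - a)) * nm (q - a) ^+ 2 = spread q * spread a.
Proof.
move=> aq; have qa : nm (q - a) != 0 by rewrite nm_eq0 subr_eq0 eq_sym.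
rewrite /spread nm_div; transitivity (nm (q - a) ^+ 2 + nm (conjc q * a + 1) ^+ 2).
  by field.
case: q a {aq qa} => [u v] [s t].
have -> : (u +i* v) - (s +i* t) = (u - s) +i* (v - t) by [].
have -> : conjc (u +i* v) * (s +i* t) + 1 = (u * s + v * t + 1) +i* (u * t - v * s).
  by simpc; apply/eqP; rewrite eq_complex /=; apply/andP; split; apply/eqP; ring.
by rewrite !nm_sqr; ring.
Qed.

Lemma sdist_rot q x y : sdist (rot q x) (rot q y) = sdist x y.
Proof.
have s0 a : spread a != 0 by rewrite gt_eqF// spread_gt0.
have s1 a : a != q -> spread ((conjc q * a + 1) / (q - a)) = spread q * spread a / nm (q - a) ^+ 2.
  by move=> aq; rewrite -spread_rot// mulfK// expf_eq0 nm_eq0 subr_eq0 eq_sym.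
have sN : spread (- conjc q) = spread q.
  by rewrite /spread nmN; case: q {s1} => u v; rewrite /= !nm_sqr sqrrN.
have key : nm (1 + conjc q * q) = spread q.
  case: q {s1 sN} => u v; have -> : 1 + conjc (u +i* v) * (u +i* v) = (1 + (u ^+ 2 + v ^+ 2))%:C.
    by simpc; apply/eqP; rewrite eq_complex /=; apply/andP; split; apply/eqP; ring.
  rewrite nm_real ger0_norm ?/spread ?nm_sqr//.
  by rewrite addr_ge0// addr_ge0// sqr_ge0.
have gapC u v : gap u v = gap v u by rewrite !gapE dot3C.
have inf a : gap (rot q (Some a)) (rot q None) = gap (Some a) None.
  rewrite /=; case: eqVneq => [->|aq] /=; first by rewrite sN.
  have qa : q - a != 0 by rewrite subr_eq0 eq_sym.
  have -> : (conjc q * a + 1) / (q - a) - (- conjc q) = (1 + conjc q * q) / (q - a) by field.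
  by rewrite sN s1// nm_div key; field; rewrite ?s0 ?nm_eq0 ?qa.
apply: sdist_eq_gap; case: x y => [a|] [b|]; rewrite ?inf//.
- rewrite /=; case: eqVneq => [->|aq]; case: eqVneq => [->|bq] //=.
  + by rewrite subrr nm0 expr0n mulr0 mul0r.
  + have qb : q - b != 0 by rewrite subr_eq0 eq_sym.
    by rewrite s1//; field; rewrite ?s0 ?nm_eq0 ?qb.
  + have qa : q - a != 0 by rewrite subr_eq0 eq_sym.
    by rewrite s1// (nmC a); field; rewrite ?s0 ?nm_eq0 ?qa.
  + have qa : q - a != 0 by rewrite subr_eq0 eq_sym.
    have qb : q - b != 0 by rewrite subr_eq0 eq_sym.
    have -> : (conjc q * a + 1) / (q - a) - (conjc q * b + 1) / (q - b) =
      (1 + conjc q * q) * (a - b) / ((q - a) * (q - b)) by field; rewrite qa qb.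
    by rewrite !s1// nm_div !nmM key; field; rewrite ?s0 ?nm_eq0 ?qa ?qb.
- by rewrite gapC inf gapC.
- by rewrite /= subrr nm0 expr0n mulr0 mul0r.
Qed.

End SphereMetric.

(** * Vanishing complex derivatives as real estimates *)

Section Derivative.
Variable R : realType.
Local Notation C := R[i].

Lemma ltc_nm (x : C) (e : C) : 0 < e -> (`|x| < e) = (nm x < complex.Re e).
Proof.
case: e => e1 e2; rewrite nmE !ltcE /= => /andP[/eqP e20 _].
by rewrite e20 eqxx.
Qed.

Lemma is_derive0P (G : C^o -> C^o) (a : C^o) :
  is_derive a 1 G 0 <-> forall e : R, 0 < e -> exists2 d : R, 0 < d &
    forall h : C, nm h < d -> nm (G (a + h) - G a) <= e * nm h.
Proof.
split => [[dG vG] e e0|H].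
- move: dG vG; rewrite /derivable /derive; set Q := (X in X @ _) => dG vG.
  have QE (h : C) : Q h = h^-1 * (G (a + h) - G a).
    by rewrite /Q /= /shift /=; congr (_ * (G _ - _)); rewrite [h%:A]mulr1 addrC.
  have := dG; rewrite vG.
  move=> /cvgrPdist_lt /(_ e%:C); rewrite ltcR => /(_ e0).
  rewrite /dnbhs /within /= => /nbhs_ballP[d]; rewrite /= => d0 hd.
  exists (complex.Re d); first by case: d d0 {hd} => u v; rewrite ltcE /= => /andP[].
  move=> h hh; have [->|h0] := eqVneq h 0; first by rewrite addr0 subrr nm0 mulr0.
  have := hd h; rewrite /ball_ /= sub0r normrN ltc_nm// => /(_ hh h0).
  rewrite sub0r normrN QE ltc_nm ?ltcR//= nmM nmV mulrC ltr_pdivrMr ?nm_gt0//.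
  exact: ltW.
- pose K : numFieldType := C.
  have key (Q : K -> C^o) : (forall h : C, Q h = h^-1 * (G (a + h) - G a)) ->
      Q h @[h --> 0^'] --> (0 : C^o).
    move=> QE; apply/cvgrPdist_lt => e e0.
    have e1 : 0 < complex.Re e by case: e e0 => u v; rewrite ltcE /= => /andP[].
    have [d d0 hd] := H _ (divr_gt0 e1 (ltr0n _ 2)).
    rewrite /dnbhs /within /=; apply/nbhs_ballP; exists d%:C => /=; first by rewrite ltcR.
    move=> h; rewrite /ball_ /= sub0r normrN ltc_nm ?ltcR//= => hh h0.
    rewrite sub0r normrN ltc_nm// QE nmM nmV mulrC ltr_pdivrMr ?nm_gt0//.
    apply: le_lt_trans (hd h hh) _.
    by rewrite ltr_pM2r ?nm_gt0//; lra.
  have QE (h : C) : h^-1 *: ((G \o shift a) (h%:A) - G a) = h^-1 * (G (a + h) - G a).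
    by rewrite /= /shift /=; congr (_ * (G _ - _)); rewrite [h%:A]mulr1 addrC.
  split; first by rewrite /derivable; apply/cvg_ex; exists 0; exact: key QE.
  by rewrite /derive; apply: cvg_lim => //; exact: key QE.
Qed.

End Derivative.

(** * Neighbourhoods, critical points and arcs on the sphere *)

Section SphereTopology.
Variable R : realType.
Local Notation C := R[i].
Local Notation S := (sphere R).
Implicit Types (a b q : C) (x y z : S).

Lemma nbhs_sdistP x (P : set S) :
  nbhs x P <-> exists2 e : R, 0 < e & forall y, sdist x y < e -> P y.
Proof.
by split => [/nbhs_ballP[e e0 h]|[e e0 h]]; [exists e|apply/nbhs_ballP; exists e].
Qed.

Lemma continuous_sdistP (f : S -> S) x : {for x, continuous f} <->
  forall e : R, 0 < e -> exists2 d : R, 0 < d & forall y, sdist x y < d -> sdist (f x) (f y) < e.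
Proof.
split => [h e e0|h P /nbhs_sdistP[e e0 he]].
  have : nbhs (f x) (fun y => sdist (f x) y < e) by apply/nbhs_sdistP; exists e.
  by move=> /h /nbhs_sdistP[d d0 hd]; exists d => // y /hd.
by have [d d0 hd] := h e e0; apply/nbhs_sdistP; exists d => // y /hd /he.
Qed.

Lemma continuous_rot q : continuous (rot q).
Proof.
by move=> x; apply/continuous_sdistP => e e0; exists e => // y; rewrite sdist_rot.
Qed.

(** A square containing the unit disc and its image under [rot 0], which is z |-> -1/z, cover the
    sphere. *)
Lemma compact_sphere : compact [set: S].
Proof.
pose f (u : R * R) : S := Some (u.1 +i* u.2).
pose Q : set (R * R) := `[-1, 1]%classic `*` `[-1, 1]%classic.
have cQ : compact Q by apply: compact_setX; exact: segment_compact.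
have fc : continuous f.
  move=> u P /nbhs_sdistP[e e0 he].
  have e4 : 0 < e / 17 by rewrite divr_gt0.
  apply/nbhs_ballP; exists (e / 17) => // v [] /= u1 u2; apply: he.
  apply: le_lt_trans (sdist_le_nm _ _) _.
  have -> : (u.1 +i* u.2) - (v.1 +i* v.2) = (u.1 - v.1)%:C + (u.2 - v.2)%:C * 'i.
    by apply/eqP; rewrite eq_complex /=; apply/andP; split; apply/eqP; ring.
  have ni : nm ('i : C) = 1 by rewrite /nm /= expr0n expr1n add0r sqrtr1.
  have := nmD (u.1 - v.1)%:C ((u.2 - v.2)%:C * 'i); rewrite nmM ni !nm_real.
  by move: u1 u2; rewrite /ball /=; lra.
have cfQ : compact (f @` Q) by apply: continuous_compact => //; exact: continuous_subspaceT.
have cgQ : compact (rot 0 @` (f @` Q)).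
  by apply: continuous_compact => //; apply: continuous_subspaceT; exact: continuous_rot.
rewrite (_ : setT = f @` Q `|` rot 0 @` (f @` Q)); first exact: compactU.
apply/seteqP; split => // x _.
have inQ a : nm a <= 1 -> (f @` Q) (Some a).
  case: a => u v nuv; exists (u, v) => //; split; rewrite /= in_itv /=.
    by rewrite -ler_norml (le_trans (nm_re u v)).
  rewrite -ler_norml (le_trans (nm_re v u))//.
  by rewrite /nm /= addrC.
case: x => [a|].
  have [a1|a1] := leP (nm a) 1; first by left; exact: inQ.
  have a0 : a != 0 by rewrite -nm_gt0; lra.
  right; exists (Some (- a^-1)).
    by apply: inQ; rewrite nmN nmV invf_le1; lra.
  rewrite /rot oppr_eq0 invr_eq0 (negbTE a0) rmorph0 mul0r add0r sub0r opprK.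
  by rewrite div1r invrK.
right; exists (Some 0); first by apply: inQ; rewrite nm0.
by rewrite /rot eqxx.
Qed.

Lemma sdist_near_finite a y : 2 * (1 + nm a) * sdist (Some a) y < 1 ->
  exists2 b, y = Some b & nm (a - b) <= 2 * (1 + nm a) ^+ 2 * sdist (Some a) y.
Proof.
have a0 := nm_ge0 a; have s0 := sdist_ge0 (Some a) y.
case: y s0 => [b|] s0 h; last by have := sdist_infty_ge a; nra.
exists b => //; have := nm_le_sdist a b; have := nm_ge0 (a - b).
have : nm b <= nm a + nm (a - b).
  by have := nm_lerB b a; rewrite nmC; lra.
move: (nm (a - b)) (nm b) => t u tu t0 l.
have : t <= (1 + nm a) * (1 + nm a + t) * sdist (Some a) (Some b).
  apply: le_trans l _; rewrite ler_wpM2r// ler_wpM2l//; lra.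
nra.
Qed.

Lemma chart_sdist_le x a : sdist (chart_inv x a) x <= 8 * nm (a - chart x x).
Proof.
case: x => [b|] /=; first exact: sdist_le_nm.
case: eqVneq => [->|a0]; first by rewrite sdistxx mulr_ge0 ?nm_ge0.
have an : a^-1 != 0 by rewrite invr_eq0.
apply: le_trans (sdist_infty_le an) _; by rewrite nmV invrK subr0.
Qed.

Lemma chart_sdist_ge x : exists d K : R, [/\ 0 < d, 0 < K & forall z, sdist z x < d ->
  chart_inv x (chart x z) = z /\ nm (chart x z - chart x x) <= K * sdist z x].
Proof.
case: x => [a|].
  have a0 := nm_ge0 a.
  exists (2 * (1 + nm a))^-1, (2 * (1 + nm a) ^+ 2); split.
  - by rewrite invr_gt0; lra.
  - by rewrite mulr_gt0 ?exprn_gt0//; lra.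
  move=> z; rewrite sdist_sym => zd.
  have [|b -> h] := @sdist_near_finite a z; last by rewrite nmC.
  by rewrite mulrC -ltr_pdivlMr ?div1r//; lra.
exists 2^-1, 2; split => // -[a|] h /=; last by rewrite eqxx subrr nm0 sdistxx mulr0.
have h1 := sdist_infty_ge a; have a0 := nm_ge0 a.
have a1 : 1 <= nm a by nra.
have an0 : a != 0 by rewrite -nm_gt0; lra.
rewrite invr_eq0 (negbTE an0) invrK subr0 nmV; split => //.
rewrite -div1r ler_pdivrMr; nra.
Qed.

(** The vanishing of the derivative in metric form: free of charts, hence invariant under rotations.
    It makes sense at every x, fixed or not; with f x = x it gives a super-attracting fixed
    point. *)
Definition superattracting (f : S -> S) x := forall e : R, 0 < e ->
  exists2 d : R, 0 < d & forall z, sdist z x < d -> sdist (f z) (f x) <= e * sdist z x.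

(** The charts at x and at f x are locally bi-Lipschitz for the spherical metric, and continuity
    keeps f z within reach of the chart at f x. *)
Lemma critical_pointP (f : S -> S) x : {for x, continuous f} ->
  critical_point f x <-> superattracting f x.
Proof.
move=> fc; rewrite /critical_point /has_derivative.
rewrite is_derive0P.
have [d1 [K1 [d10 K10 h1]]] := chart_sdist_ge x.
have [d2 [K2 [d20 K20 h2]]] := chart_sdist_ge (f x).
have cx : chart_inv x (chart x x) = x by case: (h1 x) => //; rewrite sdistxx.
split => H e e0.
- have e1 : 0 < e / (8 * K1) by rewrite divr_gt0// mulr_gt0.
  have [d d0 hd] := H _ e1.
  have [d3 d30 h3] := (continuous_sdistP f x).1 fc _ d20.
  exists (Num.min (Num.min d1 d3) (d / K1)).
    by rewrite !lt_min d10 d30 divr_gt0.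
  move=> z; rewrite !lt_min ltr_pdivlMr// => /andP[/andP[z1 z3] zd].
  have [ez lz] := h1 z z1.
  have fz : sdist (f z) (f x) < d2 by rewrite sdist_sym h3// sdist_sym.
  have [efz lfz] := h2 _ fz.
  have := hd (chart x z - chart x x); rewrite [chart x x + _]addrC subrK ez cx => hh.
  rewrite -[in leLHS]efz; apply: le_trans (chart_sdist_le _ _) _.
  have -> : e * sdist z x = 8 * (e / (8 * K1) * (K1 * sdist z x)).
    by field; rewrite gt_eqF.
  rewrite ler_pM2l//; apply: le_trans (hh _) _; first by apply: le_lt_trans lz _; lra.
  by rewrite ler_wpM2l// ltW.
- have e1 : 0 < e / (8 * K2) by rewrite divr_gt0// mulr_gt0.
  have [d d0 hd] := H _ e1.
  have [d3 d30 h3] := (continuous_sdistP f x).1 fc _ d20.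
  exists (Num.min d d3 / 8); first by rewrite divr_gt0// lt_min d0.
  move=> h; rewrite ltr_pdivlMr// lt_min => /andP[hd1 hd3].
  set z := chart_inv x (chart x x + h).
  have zx : sdist z x <= 8 * nm h.
    by apply: le_trans (chart_sdist_le _ _) _; rewrite addrC addKr.
  have zd : sdist z x < d by lra.
  have fz : sdist (f z) (f x) < d2 by rewrite sdist_sym h3// sdist_sym; lra.
  have [_ lfz] := h2 _ fz; rewrite cx; apply: le_trans lfz _.
  have -> : e * nm h = K2 * (e / (8 * K2) * (8 * nm h)).
    by field; rewrite gt_eqF.
  rewrite ler_pM2l//; apply: le_trans (hd _ zd) _.
  by rewrite ler_wpM2l// ltW.
Qed.

Lemma near_finite a (P : set S) : nbhs (Some a : S) P ->
  exists2 r : R, 0 < r & forall b, nm (b - a) < r -> P (Some b).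
Proof.
move=> /nbhs_sdistP[e e0 h]; exists (e / 8); first by rewrite divr_gt0.
move=> b ba; apply: h; apply: le_lt_trans (sdist_le_nm _ _) _.
by rewrite nmC; lra.
Qed.

Lemma near_finiteW a (r : R) (P : set S) : 0 < r ->
  (forall b, nm (b - a) < r -> P (Some b)) -> nbhs (Some a : S) P.
Proof.
move=> r0 h; have a0 := nm_ge0 a; have k0 : 0 < 2 * (1 + nm a) ^+ 2.
  by rewrite mulr_gt0 ?exprn_gt0//; lra.
have k1 : 0 < 2 * (1 + nm a) by lra.
apply/nbhs_sdistP; exists (Num.min (2 * (1 + nm a))^-1 (r / (2 * (1 + nm a) ^+ 2))).
  by rewrite lt_min invr_gt0 k1 divr_gt0.
move=> y; rewrite lt_min => /andP[y1 y2].
have [|b yb ba] := @sdist_near_finite a y; first by rewrite mulrC -ltr_pdivlMr ?div1r.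
rewrite yb; apply: h; rewrite nmC; apply: le_lt_trans ba _.
by rewrite mulrC -ltr_pdivlMr.
Qed.

Lemma near_infty (P : set S) : nbhs (None : S) P ->
  exists2 M : R, 0 < M & forall b, M <= nm b -> P (Some b).
Proof.
move=> /nbhs_sdistP[e e0 h]; exists (9 / e); first by rewrite divr_gt0.
move=> b Mb; apply: h; rewrite sdist_sym.
have b0 : 0 < nm b by apply: lt_le_trans Mb; rewrite divr_gt0.
have bn : b != 0 by rewrite -nm_gt0.
apply: le_lt_trans (sdist_infty_le bn) _; by rewrite ltr_pdivrMr//; move: Mb; rewrite ler_pdivrMr//; lra.
Qed.

Lemma near_inftyW (M : R) (P : set S) : P None -> (forall b, M <= nm b -> P (Some b)) ->
  nbhs (None : S) P.
Proof.
move=> PN h; have M1 : 0 < `|M| + 1 by rewrite ltr_wpDl.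
apply/nbhs_sdistP; exists (`|M| + 1)^-1; first by rewrite invr_gt0.
move=> [b|] // bd; apply: h; rewrite leNgt; apply/negP => bM.
have := sdist_infty_ge b; rewrite sdist_sym => h1.
move: bd; rewrite -div1r ltr_pdivlMr// ltNge => /negP; apply.
apply: le_trans h1 _; rewrite mulrC ler_wpM2l ?sdist_ge0//.
by have := ler_norm M; lra.
Qed.

Definition arc_in x y (K : set S) := exists2 G : set S, connected G &
  [/\ G x, G y & G `<=` K].

(** Two rotations, by way of infinity, bring x to 0, where a radial segment works; distance less
    than 1 keeps the other endpoint finite there. Such arcs place balls inside components and force
    crossings of boundaries. *)
Lemma ball_arc x y : sdist x y < 1 -> arc_in x y [set z | sdist x z <= sdist x y].
Proof.
have rot_arc q u v : arc_in (rot q u) (rot q v) [set z | sdist (rot q u) z <= sdist (rot q u) (rot q v)] ->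
    arc_in u v [set z | sdist u z <= sdist u v].
  move=> [G cG [Gu Gv GK]]; exists (rot (- conjc q) @` G).
    by apply: connected_continuous_connected => //; apply/continuous_subspaceT/continuous_rot.
  split; [by exists (rot q u) => //; rewrite rotK|by exists (rot q v) => //; rewrite rotK|].
  by move=> _ [z Gz <-]; have := GK z Gz; rewrite /= sdist_rot -[in leLHS](rotVK q z) sdist_rot.
have at0 v : sdist (Some 0) v < 1 -> arc_in (Some 0) v [set z | sdist (Some 0) z <= sdist (Some 0) v].
  case: v => [c|] h; last first.
    by have := sdist_infty_ge (0 : C); rewrite nm0; lra.
  pose g (t : R) : S := Some (t%:C * c).
  have gc : continuous g.
    move=> t P /nbhs_sdistP[e e0 he]; have c0 := nm_ge0 c.
    have k0 : 0 < 8 * (nm c + 1) by lra.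
    apply/nbhs_ballP; exists (e / (8 * (nm c + 1))) => /=; first by rewrite divr_gt0.
    move=> s /=; rewrite /ball /= ltr_pdivlMr// => ts; apply: he.
    apply: le_lt_trans (sdist_le_nm _ _) _; rewrite -mulrBl nmM -rmorphB nm_real.
    by have := normr_ge0 (t - s); nra.
  exists (g @` `[0, 1]).
    apply: connected_continuous_connected; last exact: continuous_subspaceT.
    exact: segment_connected.
  split.
  - by exists 0; rewrite /g /= ?in_itv /= ?lexx ?ler01// mul0r.
  - by exists 1; rewrite /g /= ?in_itv /= ?lexx ?ler01// mul1r.
  move=> _ [t /= + <-]; rewrite in_itv /= => /andP[t0 t1].
  rewrite /= sdist_le_gap /g /gap /spread nm0 !sub0r !nmN nmM nm_real ger0_norm//.
  have c0 := nm_ge0 c; rewrite expr0n /= addr0 !mul1r.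
  have s1 : 0 < 1 + (t * nm c) ^+ 2 by have := sqr_ge0 (t * nm c); lra.
  have s2 : 0 < 1 + nm c ^+ 2 by have := sqr_ge0 (nm c); lra.
  rewrite ler_pdivrMr// mulrAC ler_pdivlMr//.
  have : (t * nm c) ^+ 2 <= nm c ^+ 2.
    by rewrite lerXn2r ?nnegrE ?mulr_ge0// ler_piMl.
  nra.
have atN v : sdist None v < 1 -> arc_in None v [set z | sdist None z <= sdist None v].
  have e : rot 0 None = Some (0 : C) by rewrite /rot rmorph0 oppr0.
  by move=> v1; apply: (rot_arc 0); rewrite e; apply: at0; rewrite -e sdist_rot.
case: x => [q|]; last exact: atN.
have e : rot q (Some q) = None by rewrite /rot eqxx.
by move=> y1; apply: (rot_arc q); rewrite e; apply: atN; rewrite -e sdist_rot.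
Qed.

End SphereTopology.

(** * Separating fractions *)

Section Topology.
Variable T : topologicalType.

(** The local hypothesis makes both Q and its complement open relative to G. This carries the
    existence of separating fractions along a component. *)
Lemma connected_locally_invariant (G Q : set T) p : connected G -> G p -> Q p ->
  (forall x, G x -> exists2 U, nbhs x U & forall u v, U u -> U v -> Q u -> Q v) ->
  G `<=` Q.
Proof.
move=> cG Gp Qp loc.
suff <- : G `&` Q = G by move=> x [].
apply: cG; first by exists p.
- exists Q^°; first exact: open_interior.
  apply/seteqP; split => x [Gx Qx]; split => //; last exact: interior_subset Qx.
  have [U xU inv] := loc x Gx; have Ux := nbhs_singleton xU.
  by apply: filterS xU => u Uu; exact: inv Ux Uu Qx.
- exists (~` (~` Q)^°); first by apply: open_closedC; exact: open_interior.
  apply/seteqP; split => x [Gx Qx]; split => //.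
    by move=> /interior_subset.
  apply: contrapT => nQ; apply: Qx; have [U xU inv] := loc x Gx.
  have Ux := nbhs_singleton xU.
  by apply: filterS xU => u Uu Qu; apply: nQ; exact: inv Uu Ux Qu.
Qed.

(** The sets U such that Q holds of K minus U form a filter; were Q K false it would be proper, and
    its cluster point in K contradicts the local hypothesis. Local constants become uniform in this
    way. *)
Lemma compact_induction (K : set T) (Q : set T -> Prop) : compact K -> Q set0 ->
  (forall U V, Q U -> Q V -> Q (U `|` V)) -> (forall U V, U `<=` V -> Q V -> Q U) ->
  (forall x, K x -> exists2 U, nbhs x U & Q U) -> Q K.
Proof.
move=> cK Q0 QU Qsub loc; apply: contrapT => nQK.
pose F : set_system T := [set U | Q (K `\` U)].
have FF : Filter F.
  split; rewrite /F /=.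
  - by rewrite setDT.
  - move=> U V hU hV; apply: Qsub (QU _ _ hU hV) => y [Ky nUV].
    by have [Uy|nUy] := pselect (U y); [right; split => // Vy; apply: nUV|left].
  - by move=> U V UV; apply: Qsub; exact: setDS.
have PF : ProperFilter F by split => //; rewrite /F /= setD0.
have [|x [Kx xF]] := cK F PF; first by rewrite /F /= setDv.
have [U xU hU] := loc x Kx.
have [|y [/= nUy Uy]] := xF (~` U) U _ xU; last by [].
by rewrite /F /=; apply: Qsub hU => y [_ /contrapT].
Qed.

End Topology.

Section Separation.
Variable R : realType.
Local Notation C := R[i].
Local Notation S := (sphere R).
Variables (A K : set S) (s : seq C) (q : C).
Hypothesis A_open : open A.
Hypothesis A_infty : A None.
Hypothesis A_s : forall c, c \in s -> A (Some c).
Hypothesis A_q : ~ A (Some q).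
Hypothesis F_inf : forall t : seq C, exists2 z, ~ A (Some z) & z \notin t.
Hypothesis K_compact : compact K.
Hypothesis K_A : K `<=` A.
Hypothesis K_components : forall x, K x ->
  exists2 p, p = None \/ (exists2 c, c \in s & p = Some c) & connected_component A p x.

Let F : set C := [set z | ~ A (Some z)].
Let D : {poly C} := \prod_(c <- s) ('X - c%:P).

Let rootD c : root D c = (c \in s).
Proof. exact: root_prod_XsubC. Qed.

Let D_neq0 c : (D.[c] != 0) = (c \notin s).
Proof. by rewrite -rootD. Qed.

Let DF z : F z -> D.[z] != 0.
Proof. by move=> Fz; rewrite D_neq0; apply/negP => /A_s. Qed.

Let A_nbhs x : A x -> nbhs x A.
Proof. by move=> Ax; apply: open_nbhs_nbhs; split. Qed.

Let F_bounded : exists2 M : R, 0 < M & forall z, F z -> nm z <= M.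
Proof.
have [M M0 h] := near_infty (A_nbhs A_infty); exists M => // z Fz.
by rewrite leNgt; apply/negP => /ltW/h.
Qed.

Let F_dist a : A (Some a) -> exists2 r : R, 0 < r & forall z, F z -> r <= nm (z - a).
Proof.
move=> Aa; have [r r0 h] := near_finite (A_nbhs Aa); exists r => // z Fz.
by rewrite leNgt; apply/negP => /h.
Qed.

(** Poles count as good by convention: propagation along a component starts from them. *)
Let good : set S := [set x | match x with None => True
  | Some a => a \in s \/ separated F D a end].

(** Near infinity and near a finite pole every point is good, so the implication is trivial. Near
    any other point the neighbourhood avoids the poles and [push_separated] works between any two of
    its points. *)
Let good_loc x : A x -> exists2 U, nbhs x U & forall u v, U u -> U v -> good u -> good v.
Proof.
case: x => [a|] Ax; last first.
  have [M M0 FM] := F_bounded; have [n [k h]] := separated_near_infty D M0 FM.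
  exists good; last by [].
  apply: (@near_inftyW _ (2 * M)) => // b bM /=; case: (boolP (b \in s)); first by left.
  by rewrite -D_neq0 => Db; right; apply: separated_by_separated Db (h b bM).
have [r r0 hr] := F_dist Ax; case: (boolP (a \in s)) => [sa|].
  have [||n [k h]] := @separated_near_pole _ F D a r r0; rewrite ?rootD//.
  exists good; last by [].
  apply: (@near_finiteW _ _ (r / 2)); first by rewrite divr_gt0.
  move=> b ba /=; case: (boolP (b \in s)); first by left.
  rewrite -D_neq0 => Db; right; apply: separated_by_separated Db (h b _) => //.
  by lra.
rewrite -D_neq0 => Da.
have Da' : 0 < nm D.[a] by rewrite nm_gt0.
have [d d0 hd] := poly_continuous D a Da'.
exists [set x | exists2 b, x = Some b & D.[b] != 0 /\ nm (b - a) < r / 8].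
  apply: (@near_finiteW _ _ (Num.min d (r / 8))).
    by rewrite lt_min d0 divr_gt0.
  move=> b; rewrite lt_min => /andP[bd br]; exists b => //; split => //.
  have := hd b bd; rewrite nmC -nm_gt0; have := nm_lerBC D.[b] D.[a].
  by rewrite nmC; lra.
move=> _ _ [u -> [Du ur]] [v -> [Dv vr]] /= [us|su].
  by rewrite D_neq0 us in Du.
right; apply: (@push_separated _ F D DF u v (r / 2)) => //.
- by rewrite divr_gt0.
- by move=> z /hr; have := nm_triangle u z a; lra.
- by have := nm_triangle a v u; rewrite (nmC a); lra.
Qed.

Let K_good : K `<=` good.
Proof.
move=> x Kx; have [p Pp px] := K_components Kx.
have Ap : A p by case: Pp => [->//|[c cs ->]]; exact: A_s.
apply: (@connected_locally_invariant _ (connected_component A p) good p) px.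
- exact: component_connected.
- exact: connected_component_refl.
- by case: Pp => [->//|[c cs ->]]; left.
- by move=> y /connected_component_sub; exact: good_loc.
Qed.

(** Each point of K has a pair (n, k) valid nearby; finitely many pairs are merged by multiplying
    with powers of D. *)
Let K_separated : exists n k, forall a, K (Some a) -> D.[a] != 0 ->
  separated_by F D (3 / 2) n k a.
Proof.
pose Q (V : set S) := exists n k, forall a, V (Some a) -> D.[a] != 0 ->
  separated_by F D (3 / 2) n k a.
apply: (@compact_induction _ K Q) => //; first by exists 0%N, 0%N.
- move=> U V [n1 [k1 h1]] [n2 [k2 h2]].
  pose e := (size D).-1; exists (n1 + e * k2 + (n2 + e * k1))%N, (k1 + k2)%N.
  move=> a [/h1 h Da|/h2 h Da]; last rewrite (addnC k1).
    by apply: (separated_by_mono (h Da)); exact: leq_addr.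
  by apply: (separated_by_mono (h Da)); exact: leq_addl.
- by move=> U V UV [n [k h]]; exists n, k => a /UV; exact: h.
move=> x Kx; have := K_good Kx; have := K_A Kx; case: x {Kx} => [a|] Ax /=.
  have [r r0 hr] := F_dist Ax; case: (boolP (a \in s)) => [sa _|].
    have [||n [k h]] := @separated_near_pole _ F D a r r0; rewrite ?rootD//.
    exists [set x | exists2 b, x = Some b & nm (b - a) < r / 2].
      by apply: (@near_finiteW _ _ (r / 2)); [rewrite divr_gt0|move=> b ba; exists b].
    exists n, k => _ [b [->] ba] _; apply: separated_byW; first by lra.
    by apply: h; lra.
  move=> nsa [//|/(separated_by_near DF)[n [k [d d0 h]]]].
  exists [set x | exists2 b, x = Some b & nm (b - a) < d].
    by apply: (@near_finiteW _ _ d) => // b ba; exists b.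
  by exists n, k => _ [b [->] ba] _; exact: h.
have [M M0 FM] := F_bounded; have [n [k h]] := separated_near_infty D M0 FM.
exists [set x | if x is Some b then 2 * M <= nm b else True].
  exact: (@near_inftyW _ (2 * M)).
by exists n, k => b /= bM _; apply: separated_byW; [lra|exact: h].
Qed.

Let K_dist : exists2 dlt : R, 0 < dlt &
  forall a z, K (Some a) -> F z -> dlt <= nm (a - z).
Proof.
pose Q (V : set S) := exists2 dlt : R, 0 < dlt &
  forall a z, V (Some a) -> F z -> dlt <= nm (a - z).
apply: (@compact_induction _ K Q) => //; first by exists 1.
- move=> U V [d1 d10 h1] [d2 d20 h2]; exists (Num.min d1 d2); first by rewrite lt_min d10.
  by move=> a z [/h1 h|/h2 h] /h; rewrite ge_min => ->; rewrite ?orbT.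
- by move=> U V UV [d d0 h]; exists d => // a z /UV; exact: h.
move=> x /K_A; case: x => [a|] Ax.
  have [r r0 hr] := F_dist Ax.
  exists [set x | exists2 b, x = Some b & nm (b - a) < r / 2].
    by apply: (@near_finiteW _ _ (r / 2)); [rewrite divr_gt0|move=> b ba; exists b].
  exists (r / 2); first by rewrite divr_gt0.
  move=> _ z [b [->] ba] /hr; have := nm_triangle b z a; rewrite (nmC z b); lra.
have [M M0 FM] := F_bounded.
exists [set x | if x is Some b then M + 1 <= nm b else True].
  exact: (@near_inftyW _ (M + 1)).
exists 1 => // b z /= bM /FM; have := nm_lerB b z; lra.
Qed.

(** The Fekete fraction is multiplied by t (z - q), which makes q a zero. This factor z - q is at
    most 2 M off A and at least dlt on K; the separation 32 M / dlt and t = 1 / (8 m M) absorb it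
    and leave 1/4 and 4. The value 1/4 leaves room for a later scaling by up to 2. *)
Lemma exists_separating_fraction : exists T E : {poly C},
  [/\ E != 0, coprimep T E, (size E < size T)%N & T.[q] = 0] /\
  [/\ forall z, root E z = (z \in s),
      forall z, ~ A (Some z) -> nm T.[z] <= 4^-1 * nm E.[z] &
      forall a, K (Some a) -> 4 * nm E.[a] <= nm T.[a]].
Proof.
have [M M0 FM] := F_bounded.
have [dlt dlt0 Kdlt] := K_dist.
have [n [k hK]] := K_separated.
have [d0 d00 Dd0] : exists2 d0 : R, 0 < d0 & forall z, F z -> d0 <= nm D.[z].
  have [r r0 hr] : exists2 r : R, 0 < r &
      forall c, c \in s -> forall z, F z -> r <= nm (z - c).
    apply: finite_radius => [c r r' rr h z /h|c cs]; first exact: le_trans.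
    exact: F_dist (A_s cs).
  exists (r ^+ size s) => [|z Fz]; first exact: exprn_gt0.
  rewrite /D horner_prod nm_prod.
  have : forall c, c \in s -> r <= nm (z - c) by move=> c cs; exact: hr.
  elim: (s) => [|c t IH] ht; first by rewrite big_nil expr0.
  have rge0 := ltW r0; rewrite big_cons exprS ler_pM ?exprn_ge0//.
    by rewrite hornerXsubC ht// mem_head.
  by apply: IH => b bt; rewrite ht// in_cons bt orbT.
(* The exponent k + 1 is positive, so every point of s is a pole. The summand (k + 1) e lets the
   numerator win in degree, so infinity is a pole as well. *)
pose e := (size D).-1; pose b := (n + e * 1 + k.+1 * e)%N.
pose K' : set C := [set a | K (Some a) /\ D.[a] != 0].
have Lam0 : 0 < 32 * M / dlt by rewrite divr_gt0// mulr_gt0.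
have [||l [l0 [w [Fw [m m0]]]]] := @fekete_separation _ F K' D b k.+1 M d0 dlt _ d00 dlt0 Lam0
    F_inf FM Dd0.
- by move=> a [Ka Da]; split => // z Fz; exact: Kdlt.
- move=> a [Ka Da]; suff : separated_by F D (3 / 2) b (k + 1) a by rewrite addn1.
  by apply: (separated_by_mono (hK a Ka Da)); rewrite /b leq_addr.
set P := \prod_i _ => -[FP KP].
pose E := D ^+ (k.+1 * l).
pose t : R := (8 * m * M)^-1.
have t0 : 0 < t by rewrite invr_gt0 !mulr_gt0.
pose T := t%:C *: (P * ('X - q%:P)).
have D0 : D != 0 by rewrite monic_neq0// monic_prod_XsubC.
have P0 : P != 0 by rewrite monic_neq0// monic_prod_XsubC.
have tC0 : t%:C != 0 :> C by rewrite -nm_gt0 nm_real gtr0_norm.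
have rE z : root E z = (z \in s).
  by rewrite /E rootE horner_exp expf_eq0 muln_gt0 l0 /= -rootE rootD.
have TE z : nm T.[z] = t * (nm P.[z] * nm (z - q)).
  by rewrite /T hornerZ hornerM hornerXsubC !nmM nm_real gtr0_norm.
exists T, E; split; split => //.
- by rewrite expf_neq0.
- rewrite coprimepZl//; apply: coprimep_expr; rewrite /D.
  have nT c : c \in s -> ~~ root (P * ('X - q%:P)) c.
    move=> cs; rewrite rootM root_XsubC negb_or; apply/andP; split; last first.
      by apply/eqP => cq; apply: A_q; rewrite -cq; exact: A_s.
    rewrite /P rootE horner_prod; apply/prodf_neq0 => i _.
    rewrite hornerXsubC subr_eq0; apply/eqP => cw.
    by apply: (Fw i); rewrite -cw; exact: A_s.
  elim: (s) nT => [|c u IH] nT; first by rewrite big_nil coprimep1.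
  rewrite big_cons coprimepMr IH ?andbT; last by move=> x xu; apply: nT; rewrite in_cons xu orbT.
  by rewrite coprimep_XsubC nT// mem_head.
- rewrite size_scale// size_Mmonic ?monicXsubC// size_XsubC addn2 /=.
  rewrite /P size_prod_XsubC /= /index_enum -enumT size_enum_ord.
  apply: leq_ltn_trans (size_poly_exp_leq _ _) _.
  by rewrite !ltnS -/e mulnA leqW// leq_mul2r /b [(e * k.+1)%N]mulnC leq_addl orbT.
- by rewrite /T hornerZ hornerM hornerXsubC subrr !mulr0.
- move=> z Fz; rewrite TE /E horner_exp nmX.
  have h1 := FP z Fz; have h2 := FM z Fz; have h3 := FM q A_q.
  have zq : nm (z - q) <= 2 * M by have := nmB z q; lra.
  have -> : 4^-1 * nm D.[z] ^+ (k.+1 * l) = t * (m * nm D.[z] ^+ (k.+1 * l) * (2 * M)).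
    by rewrite /t; field; rewrite !gt_eqF.
  by rewrite ler_pM2l// ler_pM ?nm_ge0.
- move=> a Ka; have [/eqP Da|Da] := eqVneq D.[a] 0.
    have -> : E.[a] = 0 by apply/eqP; rewrite -[_ == 0]/(root E a) rE -rootD.
    by rewrite nm0 mulr0 nm_ge0.
  rewrite TE /E horner_exp nmX.
  have h1 := KP a (conj Ka Da); have h2 := Kdlt a q Ka A_q.
  have -> : 4 * nm D.[a] ^+ (k.+1 * l) =
     t * (32 * M / dlt * m * nm D.[a] ^+ (k.+1 * l) * dlt).
    by rewrite /t; field; rewrite !gt_eqF.
  rewrite ler_pM2l// ler_pM ?(ltW dlt0)// !mulr_ge0 ?exprn_ge0 ?nm_ge0 ?(ltW m0) ?(ltW M0)//.
  by rewrite invr_ge0 ltW.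
Qed.

End Separation.

(** * Rational maps of the sphere *)

Section RationalMaps.
Variable R : realType.
Local Notation C := R[i].
Local Notation S := (sphere R).
Implicit Types (p q : {poly C}) (a c z : C) (x y : S).

Lemma coprimep_noroot p q a : coprimep p q -> q.[a] = 0 -> p.[a] != 0.
Proof.
move=> cpq qa; apply/negP => /eqP pa; have := coprimep_root cpq.
by move=> /(_ a); rewrite rootE pa eqxx => /(_ isT); rewrite qa eqxx.
Qed.

Lemma ratfun_near_infty p q (z : C) (e : R) : p.[z] != 0 -> nm q.[z] <= e * nm p.[z] ->
  sdist None (ratfun p q (Some z)) <= 8 * e.
Proof.
move=> pz le; have pz0 : 0 < nm p.[z] by rewrite nm_gt0.
have e0 : 0 <= e by have := nm_ge0 q.[z]; nra.
rewrite /=; case: eqVneq => [_|qz]; first by rewrite sdistxx mulr_ge0.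
have qz0 : 0 < nm q.[z] by rewrite nm_gt0.
have pq0 : p.[z] / q.[z] != 0 by rewrite mulf_neq0// invr_eq0.
rewrite sdist_sym; apply: le_trans (sdist_infty_le pq0) _.
by rewrite nm_div invf_div ler_pM2l// ler_pdivrMr.
Qed.

Lemma ratfun_continuous p q : coprimep p q -> continuous (ratfun p q).
Proof.
move=> cpq [a|]; apply/continuous_sdistP => e e0.
- suff [r r0 hr] : exists2 r : R, 0 < r & forall z, nm (z - a) < r ->
      sdist (ratfun p q (Some a)) (ratfun p q (Some z)) < e.
    have /nbhs_sdistP[d d0 hd] : nbhs (Some a : S)
        (fun y => sdist (ratfun p q (Some a)) (ratfun p q y) < e).
      exact: near_finiteW r0 hr.
    by exists d.
  have [qa|qa] := eqVneq q.[a] 0.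
    have pa := coprimep_noroot cpq qa; have pa0 : 0 < nm p.[a] by rewrite nm_gt0.
    have p20 : 0 < nm p.[a] / 2 by rewrite divr_gt0.
    have [d1 d10 h1] := poly_continuous p a p20.
    have e20 : 0 < e / 9 * (nm p.[a] / 2) by rewrite mulr_gt0// divr_gt0.
    have [d2 d20 h2] := poly_continuous q a e20.
    exists (Num.min d1 d2); first by rewrite lt_min d10.
    move=> z; rewrite lt_min => /andP[/h1 z1 /h2]; rewrite qa subr0 => z2.
    have pz : nm p.[a] / 2 <= nm p.[z] by have := nm_lerBC p.[z] p.[a]; lra.
    have {1}-> : ratfun p q (Some a) = None by rewrite /= qa eqxx.
    apply: (@le_lt_trans _ _ (8 * (e / 9))); last lra.
    apply: ratfun_near_infty; first by rewrite -nm_gt0; lra.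
    by apply: ltW; apply: lt_le_trans z2 _; rewrite ler_pM2l// divr_gt0.
  have qa0 : 0 < nm q.[a] by rewrite nm_gt0.
  have q20 : 0 < nm q.[a] / 2 by rewrite divr_gt0.
  have [d1 d10 h1] := poly_continuous q a q20.
  pose r := q.[a] *: p - p.[a] *: q.
  have e20 : 0 < e / 8 * (nm q.[a] * (nm q.[a] / 2)) by rewrite !mulr_gt0// divr_gt0.
  have [d2 d20 h2] := poly_continuous r a e20.
  exists (Num.min d1 d2); first by rewrite lt_min d10.
  have ra : r.[a] = 0 by rewrite /r !hornerE; ring.
  move=> z; rewrite lt_min => /andP[/h1 z1 /h2]; rewrite ra subr0 => z2.
  have qz : nm q.[a] / 2 <= nm q.[z] by have := nm_lerBC q.[z] q.[a]; lra.
  have qz0 : q.[z] != 0 by rewrite -nm_gt0; lra.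
  rewrite /= (negbTE qa) (negbTE qz0) sdist_sym.
  apply: le_lt_trans (sdist_le_nm _ _) _.
  have -> : p.[z] / q.[z] - p.[a] / q.[a] = r.[z] / (q.[a] * q.[z]).
    by rewrite /r !hornerE; field; rewrite qa qz0.
  rewrite nm_div nmM mulrC -ltr_pdivlMr// ltr_pdivrMr; last first.
    by rewrite mulr_gt0// nm_gt0.
  by apply: lt_le_trans z2 _; rewrite !ler_pM2l ?divr_gt0.
- suff [M hM] : exists M : R, forall z, M <= nm z ->
      sdist (ratfun p q None) (ratfun p q (Some z)) < e.
    have /nbhs_sdistP[d d0 hd] : nbhs (None : S)
        (fun y => sdist (ratfun p q None) (ratfun p q y) < e).
      by apply: near_inftyW hM; rewrite sdistxx.
    by exists d.
  have e9 : 0 < e / 9 by rewrite divr_gt0.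
  case: (ltnP (size q) (size p)) => [spq|spq].
    have [M hM] := poly_little_o spq e9; exists M => z /hM h.
    have {1}-> : ratfun p q None = None by rewrite /= spq.
    apply: (@le_lt_trans _ _ (8 * (e / 9))); last lra.
    apply: ratfun_near_infty => //; apply/negP => /eqP pz.
    move: h; rewrite pz nm0 mulr0 => h.
    have : q.[z] == 0 by rewrite -nm_eq0 eq_le h nm_ge0.
    by move=> /eqP /(coprimep_noroot cpq); rewrite pz eqxx.
  have q0 : q != 0.
    apply/eqP => q0; move: spq cpq; rewrite q0 size_poly0 leqn0 size_poly_eq0 => /eqP ->.
    by rewrite coprimep0 -size_poly_eq1 size_poly0.
  set c := p`_(size q).-1 / lead_coef q.
  have sr : (size (p - c *: q)%R < size q)%N.
    have sq : (0 < size q)%N by rewrite size_poly_gt0.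
    have : (size (p - c *: q)%R <= size q)%N.
      rewrite (leq_trans (size_polyD _ _))// geq_max spq size_polyN.
      exact: size_scale_leq.
    rewrite leq_eqVlt => /predU1P[e1|//]; exfalso.
    have : (p - c *: q)`_(size q).-1 = 0.
      by rewrite coefB coefZ -lead_coefE /c divfK ?subrr// lead_coef_eq0.
    rewrite -e1 -lead_coefE => /eqP; rewrite lead_coef_eq0 => /eqP r0.
    by move: sq; rewrite -e1 r0 size_poly0.
  have [M hM] := poly_little_o sr e9; exists M => z /hM h.
  have qz : q.[z] != 0.
    apply/negP => /eqP qz; have := coprimep_noroot cpq qz.
    by move: h; rewrite !hornerE qz mulr0 subr0 nm0 mulr0 -nm_gt0; lra.
  rewrite /= ltnNge spq /= (negbTE qz) sdist_sym -/c.
  apply: le_lt_trans (sdist_le_nm _ _) _.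
  have -> : p.[z] / q.[z] - c = (p - c *: q).[z] / q.[z].
    by rewrite !hornerE; field.
  by rewrite nm_div mulrC -ltr_pdivlMr// ltr_pdivrMr ?nm_gt0//; apply: le_lt_trans h _;
     rewrite ltr_pM2r ?nm_gt0//; lra.
Qed.

Lemma nonroot_near p x (d : R) : p != 0 -> 0 < d ->
  exists2 a, p.[a] != 0 & sdist x (Some a) < d.
Proof.
move=> p0 d0; have [s ps _] := poly_factor p0.
have nroot a : a \notin s -> p.[a] != 0.
  rewrite -[_ != 0]/(~~ root p a) {1}ps rootZ ?lead_coef_eq0//.
  by rewrite root_prod_XsubC.
case: x => [b|].
  have [t /andP[t1 t2] ts] := exists_notin [seq complex.Re (c - b) * (17 / d) | c <- s].
  exists (b + (t * (d / 17))%:C).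
    apply: nroot; apply: contra ts => as_; apply/mapP; exists (b + (t * (d / 17))%:C) => //.
    by rewrite addrC addKr /=; field; rewrite gt_eqF.
  apply: le_lt_trans (sdist_le_nm _ _) _; rewrite opprD addNKr nmN nm_real.
  by rewrite ger0_norm; nra.
have [t /andP[t1 t2] ts] := exists_notin [seq complex.Re c * (d / 9) | c <- s].
have t0 : 0 < t * (9 / d) by rewrite mulr_gt0 ?divr_gt0//; lra.
exists (t * (9 / d))%:C.
  apply: nroot; apply: contra ts => as_; apply/mapP; exists (t * (9 / d))%:C => //=.
  by field; rewrite gt_eqF.
rewrite sdist_sym; apply: le_lt_trans (sdist_infty_le _) _.
  by rewrite -nm_gt0 nm_real normr_gt0 gt_eqF.
rewrite nm_real gtr0_norm// ltr_pdivrMr//.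
rewrite (_ : d * (t * (9 / d)) = 9 * t); first by lra.
by field; rewrite gt_eqF.
Qed.

(** The fraction p / q in lowest terms is continuous on the whole sphere and agrees with f off the
    roots of s and at finite points, a dense set. *)
Lemma continuous_rational_map (f : S -> S) p q (s : {poly C}) : continuous f -> s != 0 ->
  (forall a, s.[a] != 0 -> q.[a] != 0 /\ f (Some a) = Some (p.[a] / q.[a])) ->
  rational_map f.
Proof.
move=> fc s0 hs.
have q0 : q != 0.
  have [a sa _] := nonroot_near None s0 ltr01.
  by apply: contraTneq (hs a sa).1 => ->; rewrite horner0 eqxx.
pose g := gcdp p q; pose p1 := p %/ g; pose q1 := q %/ g.
have pg : p = p1 * g by rewrite divpK// dvdp_gcdl.
have qg : q = q1 * g by rewrite divpK// dvdp_gcdr.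
have c1 : coprimep p1 q1 by apply: coprimep_div_gcd; rewrite q0 orbT.
exists p1, q1; split => //; apply/funext => x.
apply: sdist_positivity; apply/eqP; rewrite eq_le sdist_ge0 andbT.
rewrite leNgt; apply/negP => e0.
have e2 : 0 < sdist (f x) (ratfun p1 q1 x) / 2 by rewrite divr_gt0.
have [d1 d10 h1] := (continuous_sdistP f x).1 (fc x) _ e2.
have [d2 d20 h2] := (continuous_sdistP _ x).1 (@ratfun_continuous p1 q1 c1 x) _ e2.
have d0 : 0 < Num.min d1 d2 by rewrite lt_min d10.
have [a sa] := nonroot_near x s0 d0; rewrite lt_min => /andP[/h1 x1 /h2 x2].
have [qa fa] := hs a sa.
have : f (Some a) = ratfun p1 q1 (Some a).
  rewrite fa /=; move: qa; rewrite qg hornerM mulf_eq0 negb_or => /andP[q1a ga].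
  by rewrite (negbTE q1a) pg hornerM; congr Some; field; rewrite q1a ga.
move=> e; rewrite e in x1.
have := sdist_triangle (ratfun p1 q1 (Some a)) (f x) (ratfun p1 q1 x).
rewrite (sdist_sym (ratfun p1 q1 (Some a))); lra.
Qed.

Definition homogenize (U V : {poly C}) d p : {poly C} :=
  \sum_(i < d.+1) p`_i *: (U ^+ i * V ^+ (d - i)).

Lemma homogenizeE (U V : {poly C}) d p a : (size p <= d.+1)%N -> V.[a] != 0 ->
  (homogenize U V d p).[a] = V.[a] ^+ d * p.[U.[a] / V.[a]].
Proof.
move=> sp Va; rewrite (horner_coef_wide _ sp) mulr_sumr /homogenize horner_sum.
apply: eq_bigr => i _; rewrite hornerZ hornerM !horner_exp expr_div_n.
have id : (i <= d)%N by rewrite -ltnS.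
have -> : V.[a] ^+ d = V.[a] ^+ (d - i) * V.[a] ^+ i by rewrite -exprD subnK.
by field; rewrite expf_neq0.
Qed.

(** The conjugate is computed by homogenising off the roots of one polynomial; continuity settles
    the remaining points, among them infinity and the poles. *)
Lemma rational_map_conj_rot p q c : coprimep p q -> (size q < size p)%N -> q != 0 ->
  rational_map (rot (- conjc c) \o ratfun p q \o rot c).
Proof.
move=> cpq sqp q0; pose U : {poly C} := conjc c *: 'X + 1; pose V : {poly C} := c%:P - 'X.
pose d := size p; pose c1 : C := - conjc c; rewrite -[- conjc c]/c1.
pose H := homogenize U V d; pose N : {poly C} := conjc c1 *: p + q.
pose Q : {poly C} := c1 *: q - p.
have Ua a : U.[a] = conjc c * a + 1 by rewrite /U !hornerE.
have Va a : V.[a] = c - a by rewrite /V !hornerE.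
have sN : (size N <= d.+1)%N.
  rewrite (leq_trans (size_polyD _ _))// geq_max (leq_trans (size_scale_leq _ _))//.
  exact: leqW (ltnW _).
have sQ : (size Q <= d.+1)%N.
  rewrite (leq_trans (size_polyD _ _))// geq_max size_polyN leqnSn andbT.
  by rewrite (leq_trans (size_scale_leq _ _))// leqW// ltnW.
have sq : (size q <= d.+1)%N by rewrite leqW// ltnW.
have Q0 : Q != 0.
  rewrite -size_poly_eq0 -size_polyN opprB size_polyDl ?size_poly_eq0.
    by rewrite -size_poly_gt0 (leq_ltn_trans _ sqp).
  by rewrite size_polyN (leq_ltn_trans (size_scale_leq _ _)).
(* A point w where r does not vanish, other than the image c1 of infinity, is the image under
   [rot c] of a finite a; there the homogenised polynomial is nonzero. *)
have H0 (r : {poly C}) : (size r <= d.+1)%N -> r != 0 -> H r != 0.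
  move=> sr r0.
  have r1 : r * ('X - c1%:P) != 0 by rewrite mulf_neq0// polyXsubC_eq0.
  have [w rw _] := nonroot_near None r1 ltr01.
  move: rw; rewrite hornerM hornerXsubC mulf_eq0 negb_or subr_eq0 => /andP[rw wc].
  have [a ea] : exists a, rot c (Some a) = Some w.
    have e := rotVK c (Some w); rewrite -/c1 {2}/rot (negbTE wc) in e.
    by exists ((conjc c1 * w + 1) / (c1 - w)).
  have ac : a != c by apply/negP => /eqP ac; move: ea; rewrite /rot ac eqxx.
  have V0 : V.[a] != 0 by rewrite Va subr_eq0 eq_sym.
  have wE : U.[a] / V.[a] = w by move: ea; rewrite /rot (negbTE ac) Ua Va => -[].
  apply/negP => /eqP Hr; have := homogenizeE U sr V0; rewrite -/(H r) Hr horner0 wE.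
  by move/esym/eqP; rewrite mulf_eq0 expf_eq0 (negbTE V0) andbF (negbTE rw).
apply: (@continuous_rational_map _ (H N) (H Q) (V * (H q * H Q))).
- move=> x; apply: continuous_comp; first exact: continuous_rot.
  by apply: continuous_comp; [exact: ratfun_continuous|exact: continuous_rot].
- rewrite !mulf_neq0 ?H0// -size_poly_eq0 -size_polyN opprB.
  by rewrite -[c%:P]/(c%:P) size_XsubC.
move=> a; rewrite !hornerM !mulf_eq0 !negb_or => /andP[V0 /andP[Hq HQ]]; split => //.
have ac : a != c by move: V0; rewrite Va subr_eq0 eq_sym.
have Vd : V.[a] ^+ d != 0 by rewrite expf_neq0.
move: Hq HQ; rewrite !homogenizeE// !mulf_eq0 !negb_or => /andP[_ qw] /andP[_ Qw].
rewrite /= (negbTE ac) -Ua -Va /= (negbTE qw).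
set w := U.[a] / V.[a] in qw Qw *.
have pqc : p.[w] / q.[w] != c1.
  by apply: contraNneq Qw => e; rewrite /Q hornerD hornerN hornerZ -e divfK ?subrr.
rewrite /rot (negbTE pqc) -/c1; congr Some; move: (V.[a] ^+ d) Vd => v v0; rewrite /N /Q !(hornerD, hornerN, hornerZ).
move: Qw; rewrite /Q hornerD hornerN hornerZ => Qw.
have k : c1 - p.[w] / q.[w] = (c1 * q.[w] - p.[w]) / q.[w] by rewrite mulrBl mulfK.
rewrite k; move: (c1 * q.[w] - p.[w]) Qw (conjc c1) => t t0 u.
by field; rewrite ?v0 ?t0 ?qw.
Qed.

End RationalMaps.

(** * Dynamics of q + (T / E)^n *)

Section Attraction.
Variable R : realType.
Local Notation C := R[i].
Local Notation S := (sphere R).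

Lemma pow_large (h B : R) : 0 < h -> exists N, forall n, (N <= n)%N -> B <= (1 + h) ^+ n.
Proof.
move=> h0; exists (Num.bound (`|B| / h)) => n hn.
have B0 : 0 <= `|B| / h by rewrite divr_ge0 ?normr_ge0// ltW.
have nh : `|B| / h <= n%:R.
  by rewrite (le_trans (ltW (archi_boundP B0)))// ler_nat.
have bern : 1 + n%:R * h <= (1 + h) ^+ n.
  elim: (n) => [|k IH]; first by rewrite mul0r addr0 expr0.
  by rewrite exprS -natr1; have k0 : 0 <= k%:R :> R by []; nra.
move: nh; rewrite ler_pdivrMr// => nh; have := ler_norm B; lra.
Qed.

Lemma pow_small (x e : R) : 0 < x < 1 -> 0 < e -> exists N, forall n, (N <= n)%N -> x ^+ n <= e.
Proof.
move=> /andP[x0 x1] e0; have h0 : 0 < x^-1 - 1 by rewrite subr_gt0 invf_gt1.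
have [N hN] := pow_large e^-1 h0; exists N => n /hN; rewrite addrC subrK exprVn.
by rewrite lef_pV2 ?posrE ?exprn_gt0.
Qed.

Definition attracted (f : S -> S) (x z : S) := forall e : R, 0 < e ->
  exists N, forall n, (N <= n)%N -> sdist (iter n f z) x < e.

Lemma attracted_image f x z : attracted f x (f z) <-> attracted f x z.
Proof.
split => h e /h [N hN].
  by exists N.+1 => -[//|n]; rewrite ltnS iterSr; exact: hN.
by exists N => n Nn; rewrite -iterSr; apply: hN; exact: leqW.
Qed.

(** [mu] is a Lyapunov function: it will be 1 / |z| near infinity and |z - q| near q. *)
Lemma attracted_trap f x (V : set S) (mu : S -> R) (c : R) z :
  (forall y, V y -> V (f y) /\ mu (f y) <= mu y / 2) ->
  (forall y, V y -> 0 <= mu y /\ sdist y x <= c * mu y) -> 0 <= c ->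
  V z -> attracted f x z.
Proof.
move=> Vf Vmu c0 Vz.
have it n : V (iter n f z) /\ mu (iter n f z) <= 2^-1 ^+ n * mu z.
  elim: n => [|n [Vn IH]]; first by rewrite expr0 mul1r.
  have [h1 h2] := Vf _ Vn; split => //=; apply: le_trans h2 _.
  by rewrite exprS -mulrA mulrC ler_pM2l// invr_gt0.
have [mu0 _] := Vmu z Vz.
move=> e e0; have k0 : 0 < c * mu z + 1 by rewrite ltr_wpDl// mulr_ge0.
have [|N hN] := @pow_small 2^-1 (e / (c * mu z + 1)) _ (divr_gt0 e0 k0).
  by apply/andP; split; lra.
exists N => n Nn; have [Vn mun] := it n; have [_ h] := Vmu _ Vn.
apply: le_lt_trans h _; apply: (@le_lt_trans _ _ (c * (2^-1 ^+ n * mu z))).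
  by rewrite ler_wpM2l.
rewrite mulrCA; have := hN n Nn; rewrite ler_pdivlMr//.
have : 0 < 2^-1 ^+ n :> R by rewrite exprn_gt0// invr_gt0.
have : 0 <= c * mu z by rewrite mulr_ge0.
by move: (2^-1 ^+ n) (c * mu z) => u v; nra.
Qed.

End Attraction.

Section Core.
Variable R : realType.
Local Notation C := R[i].
Local Notation S := (sphere R).
Variables (T E : {poly C}) (q : C).
Hypothesis E0 : E != 0.
Hypothesis cTE : coprimep T E.
Hypothesis sET : (size E < size T)%N.
Hypothesis Tq : T.[q] = 0.
Hypothesis regular_modulus : forall c, root (wronskian T E) c -> nm T.[c] != nm E.[c].
Implicit Types (a b z w : C).

Let Eq : E.[q] != 0.
Proof. by apply: coprimep_noroot Tq; rewrite coprimep_sym. Qed.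

Let t a := T.[a] / E.[a].

Let T0 : T != 0. Proof. by rewrite -size_poly_gt0 (leq_ltn_trans _ sET). Qed.
Let sE : (0 < size E)%N. Proof. by rewrite size_poly_gt0. Qed.

Let size_pow (p : {poly C}) (n : nat) : p != 0 -> size (p ^+ n) = ((size p).-1 * n).+1.
Proof. by move=> p0; rewrite -size_exp prednK// size_poly_gt0 expf_neq0. Qed.

Let size_TE (n : nat) : (0 < n)%N -> (size (E ^+ n)%R < size (T ^+ n)%R)%N.
Proof.
move=> n0; rewrite !size_pow// ltnS ltn_mul2r n0 /= -ltnS !prednK//.
exact: leq_trans sET.
Qed.

(** T has larger degree than E, so z E^2 has smaller degree than T^2. Thus |z| = o(|t|^2), and n >=
    2 already makes infinity superattracting. *)
Let t_infty (e : R) : 0 < e -> exists M : R, forall z, M <= nm z -> E.[z] != 0 ->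
  2 <= nm (t z) /\ nm z <= e * nm (t z) ^+ 2.
Proof.
move=> e0.
have [M1 h1] : exists M : R, forall z, M <= nm z -> nm E.[z] <= 2^-1 * nm T.[z].
  by apply: poly_little_o; rewrite ?invr_gt0.
have sXE : (size ('X * E ^+ 2)%R < size (T ^+ 2)%R)%N.
  rewrite mulrC size_mulX ?expf_neq0// !size_pow//.
  have -> : ((size E).-1 * 2).+2 = (size E * 2)%N by rewrite -{2}(prednK sE) mulSn.
  by rewrite ltnS leq_mul2r /= -ltnS prednK// (leq_trans _ sET).
have [M2 h2] := poly_little_o sXE e0.
exists (Num.max M1 M2) => z; rewrite ge_max => /andP[/h1 z1 /h2 z2] Ez.
have Ez0 : 0 < nm E.[z] by rewrite nm_gt0.
rewrite /t nm_div; split; first by rewrite ler_pdivlMr//; lra.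
move: z2; rewrite hornerM hornerX !horner_exp nmM !nmX expr_div_n [e * (_ / _)]mulrA.
by rewrite ler_pdivlMr ?exprn_gt0.
Qed.

Let small_near_q : exists c r : R, [/\ 0 < c, 0 < r & forall z, nm (z - q) <= r ->
  E.[z] != 0 /\ nm (t z) <= c * nm (z - q)].
Proof.
have [L L0 hL] := poly_lipschitz T q.
have e0 : 0 < nm E.[q] / 2 by rewrite divr_gt0 ?nm_gt0.
have [d d0 hd] := poly_continuous E q e0.
exists (L / (nm E.[q] / 2)), (Num.min 1 (d / 2)); split; first by rewrite divr_gt0.
  by rewrite lt_min ltr01 divr_gt0.
move=> z; rewrite le_min => /andP[z1 zd].
have Ez : nm E.[q] / 2 <= nm E.[z].
  have : nm (z - q) < d by lra.
  by move=> /hd; have := nm_lerBC E.[z] E.[q]; lra.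
have Ez0 : 0 < nm E.[z] by lra.
split; first by rewrite -nm_gt0.
rewrite /t nm_div ler_pdivrMr//; have := hL z z1; rewrite Tq subr0.
move/le_trans; apply; rewrite [leRHS]mulrAC ler_wpM2r ?nm_ge0//.
by rewrite mulrAC ler_pdivlMr// ler_pM2l.
Qed.

Section Iteration.
Variable n : nat.
Hypothesis n_ge2 : (2 <= n)%N.

Definition power_map : S -> S := ratfun (q *: E ^+ n + T ^+ n) (E ^+ n).
Let f := power_map.

Let n_gt0 : (0 < n)%N. Proof. exact: ltnW. Qed.

Lemma size_power_map : (size (E ^+ n)%R < size (q *: E ^+ n + T ^+ n)%R)%N.
Proof.
rewrite addrC size_polyDl ?size_TE//.
exact: leq_ltn_trans (size_scale_leq _ _) (size_TE n_gt0).
Qed.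

Lemma coprime_power_map : coprimep (q *: E ^+ n + T ^+ n) (E ^+ n).
Proof.
rewrite coprimep_sym -mul_polyC coprimep_addl_mul.
by apply: coprimep_expl; apply: coprimep_expr; rewrite coprimep_sym.
Qed.

Lemma power_map_infty : f None = None.
Proof. by rewrite /f /power_map /= size_power_map. Qed.

Lemma power_map_pole a : E.[a] = 0 -> f (Some a) = None.
Proof. by move=> Ea; rewrite /f /power_map /= horner_exp Ea expr0n gtn_eqF// eqxx. Qed.

Lemma power_mapE a : E.[a] != 0 -> f (Some a) = Some (q + (T.[a] / E.[a]) ^+ n).
Proof.
move=> Ea; rewrite /f /power_map /= horner_exp expf_eq0 (negbTE Ea) andbF.
congr Some; rewrite hornerD hornerZ !horner_exp expr_div_n; field.
by rewrite expf_neq0.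
Qed.

Let pow_le2 (x : R) : 1 <= x -> x ^+ 2 <= x ^+ n.
Proof. by move=> x1; rewrite ler_weXn2l. Qed.

Let pow_le2' (x : R) : 0 <= x <= 1 -> x ^+ n <= x ^+ 2.
Proof. by move=> /andP[x0 x1]; rewrite ler_wiXn2l. Qed.

Lemma power_map_superattracting_infty : superattracting f None.
Proof.
move=> e e0; have e1 : 0 < e / 32 by rewrite divr_gt0.
have [M hM] := t_infty e1.
suff : nbhs (None : S) (fun z : S => sdist (f z) (f None) <= e * sdist z None).
  by move=> /nbhs_sdistP[d d0 hd]; exists d => // z zd; apply: hd; rewrite sdist_sym.
apply: (@near_inftyW _ (`|M| + nm q * e + e + 1)).
  by rewrite !sdistxx mulr0.
move=> z zM; have qe : 0 <= nm q * e by rewrite mulr_ge0 ?nm_ge0// ltW.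
have M0 := normr_ge0 M; have M1 := ler_norm M.
have z1 : 1 <= nm z by lra.
rewrite power_map_infty; have [Ez|Ez] := eqVneq E.[z] 0.
  by rewrite power_map_pole// sdistxx mulr_ge0 ?sdist_ge0// ltW.
have [|t2 tz] := hM z _ Ez; first lra.
rewrite power_mapE// -/(t z); set w := q + _.
have tn : nm (t z) ^+ 2 <= nm (t z ^+ n) by rewrite nmX pow_le2//; lra.
have wz : 16 * nm z <= e * nm w.
  have := nm_lerD (t z ^+ n) q; rewrite [t z ^+ n + q]addrC -/w => h.
  have h32 : 32 * nm z <= e * nm (t z) ^+ 2 by lra.
  have := ler_wpM2l (ltW e0) (le_trans (lerD tn (lexx (- nm q))) h).
  by rewrite mulrBr; lra.
have w0 : 0 < nm w by nra.
have wn0 : w != 0 by rewrite -nm_gt0.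
apply: le_trans (sdist_infty_le wn0) _; rewrite ler_pdivrMr//.
have h := sdist_infty_ge z; have s0 := sdist_ge0 (Some z) None.
have h2 : 1 <= 2 * nm z * sdist (Some z) None by nra.
rewrite mulrAC; apply: (@le_trans _ _ (16 * nm z * sdist (Some z) None)); first lra.
by rewrite ler_wpM2r.
Qed.

Lemma power_map_q : f (Some q) = Some q.
Proof. by rewrite power_mapE// Tq mul0r expr0n gtn_eqF// addr0. Qed.

Lemma power_map_superattracting_q : superattracting f (Some q).
Proof.
move=> e e0; have [c [r [c0 r0 hr]]] := small_near_q.
have q0 := nm_ge0 q.
pose k := 8 * c ^+ 2 * (1 + nm q) * (2 + nm q).
have k0 : 0 < k by rewrite !mulr_gt0 ?exprn_gt0//; lra.
pose d := Num.min (Num.min r 1) (Num.min c^-1 (e / k)).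
have d0 : 0 < d by rewrite !lt_min r0 ltr01 invr_gt0 c0 divr_gt0.
suff : nbhs (Some q : S) (fun z : S => sdist (f z) (f (Some q)) <= e * sdist z (Some q)).
  by move=> /nbhs_sdistP[d' d'0 hd]; exists d' => // z zd; apply: hd; rewrite sdist_sym.
apply: near_finiteW d0 _ => z.
rewrite !lt_min => /andP[/andP[zr z1] /andP[zc ze]].
have [Ez tz] := hr z (ltW zr).
rewrite power_map_q power_mapE// -/(t z).
apply: le_trans (sdist_le_nm _ _) _; rewrite addrC addKr nmX.
have zq0 := nm_ge0 (z - q).
have t1 : 0 <= nm (t z) <= 1.
  by rewrite nm_ge0 (le_trans tz)// -ler_pdivlMl// mulr1 ltW.
apply: le_trans (_ : 8 * (c * nm (z - q)) ^+ 2 <= _).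
  rewrite ler_pM2l// (le_trans (pow_le2' t1))// lerXn2r ?nnegrE ?nm_ge0//.
  by rewrite mulr_ge0 ?(ltW c0).
have h := nm_le_sdist z q.
have zb : nm z <= nm q + 1 by have := nm_lerB z q; lra.
have s0 := sdist_ge0 (Some z) (Some q).
have h2 : nm (z - q) <= (2 + nm q) * (1 + nm q) * sdist (Some z) (Some q).
  apply: le_trans h _; rewrite ler_wpM2r// ler_wpM2r//; lra.
have zk : nm (z - q) * k <= e by rewrite -ler_pdivlMr// ltW.
have -> : 8 * (c * nm (z - q)) ^+ 2 = nm (z - q) * (8 * c ^+ 2) * nm (z - q) by ring.
apply: (@le_trans _ _ (nm (z - q) * (8 * c ^+ 2) * ((2 + nm q) * (1 + nm q) * sdist (Some z) (Some q)))).
  by rewrite ler_wpM2l// !mulr_ge0 ?exprn_ge0// ltW.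
rewrite (_ : _ * _ = nm (z - q) * k * sdist (Some z) (Some q)); last by rewrite /k; ring.
by rewrite ler_wpM2r.
Qed.

End Iteration.

(** The radius serves every n >= 2: it has to be fixed first, because n is chosen in terms of it.
    Beyond it, off the poles, |t^n| >= |t|^2 >= 4 |z|, so 1 / |z| is at least halved. *)
Lemma power_map_trap_infty : exists R0 : R, forall n a, (2 <= n)%N -> R0 <= nm a ->
  attracted (power_map n) None (Some a).
Proof.
have e4 : 0 < 4^-1 :> R by rewrite invr_gt0.
have [M near_oo] := t_infty e4; exists (`|M| + nm q + 1) => n b n2 Rb.
have fN : power_map n None = None by exact: power_map_infty.
have fP a : E.[a] = 0 -> power_map n (Some a) = None by exact: power_map_pole.
have fE a : E.[a] != 0 -> power_map n (Some a) = Some (q + t a ^+ n) by exact: power_mapE.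
move: (power_map n) fN fP fE => f fN fP fE.
have q0 := nm_ge0 q; have M0 := normr_ge0 M; have M1 := ler_norm M.
pose V (x : S) : Prop := if x is Some w then `|M| + nm q + 1 <= nm w else True.
apply: (@attracted_trap _ f None V (fun x => if x is Some w then (nm w)^-1 else 0) 8) => //.
- move=> [a|]; last by rewrite fN /= mul0r.
  rewrite /V => Ra; have a1 : 1 <= nm a by lra.
  have [Ea|Ea] := eqVneq E.[a] 0.
    by rewrite fP//= divr_ge0// invr_ge0 nm_ge0.
  have [|t2 ta] := near_oo a _ Ea; first by lra.
  have tn : nm (t a) ^+ 2 <= nm (t a ^+ n).
    by rewrite nmX ler_weXn2l//; lra.
  have := nm_lerD (t a ^+ n) q; rewrite [t a ^+ n + q]addrC => h.
  have h2 : 2 * nm a <= nm (q + t a ^+ n) by lra.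
  rewrite fE//=; split; first by lra.
  rewrite -invfM lef_pV2 ?posrE; lra.
- move=> [a|] /= Va; last by rewrite sdistxx mulr0.
  have a0 : a != 0 by rewrite -nm_gt0; lra.
  by split; [rewrite invr_ge0 nm_ge0|exact: sdist_infty_le].
Qed.

Lemma power_map_trap_q : exists2 s0 : R, 0 < s0 & forall n a, (2 <= n)%N ->
  nm (a - q) <= s0 -> attracted (power_map n) (Some q) (Some a).
Proof.
have [c [r [c0 r0 near_q]]] := small_near_q.
pose s0 := Num.min r (Num.min c^-1 (2 * c ^+ 2)^-1).
have c20 : 0 < 2 * c ^+ 2 by rewrite mulr_gt0 ?exprn_gt0.
have [s0r s0c s0cc] : [/\ s0 <= r, s0 <= c^-1 & s0 <= (2 * c ^+ 2)^-1].
  by rewrite /s0; split; rewrite !ge_min lexx ?orbT.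
exists s0; first by rewrite !lt_min r0 !invr_gt0 c0 c20.
move=> n b n2 bs0.
have fE a : E.[a] != 0 -> power_map n (Some a) = Some (q + t a ^+ n) by exact: power_mapE.
move: (power_map n) fE => f fE.
pose V (x : S) : Prop := if x is Some w then nm (w - q) <= s0 else False.
apply: (@attracted_trap _ f (Some q) V (fun x => if x is Some w then nm (w - q) else 0) 8) => //.
- move=> [a|] //= as0; have [Ea ta] := near_q a (le_trans as0 s0r).
  have a0 := nm_ge0 (a - q).
  have ac : c * nm (a - q) <= 1 by rewrite -ler_pdivlMl// mulr1 (le_trans as0).
  have ta1 : nm (t a) <= 1 by exact: le_trans ta ac.
  have ta2 : nm (t a) ^+ 2 <= nm (a - q) / 2.
    apply: (@le_trans _ _ ((c * nm (a - q)) ^+ 2)).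
      by rewrite lerXn2r ?nnegrE ?nm_ge0// mulr_ge0 ?(ltW c0).
    have : nm (a - q) * (2 * c ^+ 2) <= 1.
      by rewrite -ler_pdivlMr// div1r (le_trans as0).
    have -> : (c * nm (a - q)) ^+ 2 = nm (a - q) * (nm (a - q) * (2 * c ^+ 2)) / 2 by field.
    by move=> h; rewrite ler_pM2r ?invr_gt0// ler_piMr.
  have tn : nm (t a ^+ n) <= nm (t a) ^+ 2 by rewrite nmX ler_wiXn2l ?nm_ge0.
  by rewrite fE//= addrC addKr; split; lra.
- by move=> [a|] //= as0; split; [exact: nm_ge0|exact: sdist_le_nm].
Qed.

(** One step brings a point off the tube into a trap, once (1 + eta)^n is large and (1 - eta)^n
    small compared with the radii of the traps. *)
Lemma power_map_off_tube (eta : R) : 0 < eta < 1 -> exists N, forall n a, (2 <= n)%N ->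
  (N <= n)%N -> E.[a] != 0 -> (1 + eta <= nm (t a) -> attracted (power_map n) None (Some a)) /\
  (nm (t a) <= 1 - eta -> attracted (power_map n) (Some q) (Some a)).
Proof.
move=> /andP[eta0 eta1]; have [R0 trapN] := power_map_trap_infty.
have [s0 s00 trapQ] := power_map_trap_q.
have [N1 hN1] := pow_large (R0 + nm q) eta0.
have [|N2 hN2] := @pow_small _ (1 - eta) s0 _ s00; first by apply/andP; split; lra.
exists (N1 + N2)%N => n a n2 Nn Ea.
have {}hN1 := hN1 n (leq_trans (leq_addr _ _) Nn).
have {}hN2 := hN2 n (leq_trans (leq_addl _ _) Nn).
have fE : power_map n (Some a) = Some (q + t a ^+ n) by exact: power_mapE.
split => ta; apply/attracted_image; rewrite fE.
  apply: trapN => //; have := nm_lerD (t a ^+ n) q; rewrite [t a ^+ n + q]addrC.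
  have : (1 + eta) ^+ n <= nm (t a ^+ n) by rewrite nmX lerXn2r ?nnegrE ?nm_ge0//; lra.
  lra.
apply: trapQ => //; rewrite addrC addKr nmX; apply: le_trans hN2.
by rewrite lerXn2r ?nnegrE ?nm_ge0//; lra.
Qed.

(** Let a lie in neither basin and put w = r(a). For b near w write b - q = (w - q) (1 + xi); then
    t(a) times an n-th root of 1 + xi is close to t(a), and lifting it through T gives z with r(z) =
    b. As w lies in neither basin, |w - q| > s0, which bounds xi. The root gains (2/3)^m over the
    Lipschitz constant L and 1 / s0, both fixed before m. *)
Lemma power_map_contraction : exists n : nat, (2 <= n)%N /\
  let f := power_map n in
  [/\ forall a, E.[a] = 0 -> attracted f None (Some a),
      forall a, E.[a] != 0 -> 2 <= nm (t a) -> attracted f None (Some a),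
      forall a, E.[a] != 0 -> nm (t a) <= 2^-1 -> attracted f (Some q) (Some a) &
  exists2 sig : R, 0 < sig &
    forall a, ~ attracted f None (Some a) -> ~ attracted f (Some q) (Some a) ->
    [/\ E.[a] != 0,
        forall k, exists2 b, attracted f None (Some b) & nm (a - b) <= sig * 2^-1 ^+ k,
        forall k, exists2 b, attracted f (Some q) (Some b) & nm (a - b) <= sig * 2^-1 ^+ k &
        forall b, nm (q + t a ^+ n - b) <= sig ->
          exists z, [/\ E.[z] != 0, q + t z ^+ n = b & nm (z - a) <= nm (q + t a ^+ n - b) / 2]]].
Proof.
have [d [L [d0 L0 lift]]] := tube_lift E0 cTE sET regular_modulus.
have [s0 s00 trapQ] := power_map_trap_q.
(* The bound d / 2 leaves room to move a value of t across the tube, by up to 2 eta. The bound s0 /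
   (4 L) makes [sig] = 2 L eta at most s0 / 2, hence |xi| <= 1/2 below. *)
pose eta := Num.min (d / 2) (Num.min 4^-1 (s0 / (4 * L))).
have L40 : 0 < 4 * L by rewrite mulr_gt0.
have e4 : 0 < 4^-1 :> R by rewrite invr_gt0.
have eta0 : 0 < eta by rewrite !lt_min e4 !divr_gt0.
have [etad eta4 etas] : [/\ eta <= d / 2, eta <= 4^-1 & eta <= s0 / (4 * L)].
  by rewrite /eta; split; rewrite !ge_min lexx ?orbT.
have [|N1 off_tube] := @power_map_off_tube eta; first by apply/andP; split; lra.
have m00 : 0 < Num.min d (s0 / (4 * L)) by rewrite lt_min d0 divr_gt0.
have [|N3 hN3] := @pow_small _ (2 / 3) _ _ m00; first by apply/andP; split; lra.
(* A single m makes n = 2^m large, as m < 2^m, and (2/3)^m small. *)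
pose m := (N1 + N3).+1.
have := hN3 m; rewrite le_min => /(_ _)/andP[|md ms].
  by rewrite /m leqW// leq_addl.
pose n := (2 ^ m)%N; have mn : (m < n)%N by exact: ltn_expl.
have n2 : (2 <= n)%N by rewrite (leq_trans _ mn).
have N1n : (N1 <= n)%N by rewrite (leq_trans _ (ltnW mn))// /m leqW// leq_addr.
exists n; split => //; pose f := power_map n; rewrite -/f.
have fN : f None = None by exact: power_map_infty.
have fP a : E.[a] = 0 -> f (Some a) = None by exact: power_map_pole.
have fE a : E.[a] != 0 -> f (Some a) = Some (q + t a ^+ n) by exact: power_mapE.
have pole a : E.[a] = 0 -> attracted f None (Some a).
  move=> Ea e e0; exists 1%N => -[//|k _]; rewrite iterSr fP//.
  by rewrite (_ : iter k f None = None) ?sdistxx//; elim: k => //= k ->.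
have outer a : E.[a] != 0 -> 1 + eta <= nm (t a) -> attracted f None (Some a).
  by move=> Ea; exact: (off_tube n a n2 N1n Ea).1.
have inner a : E.[a] != 0 -> nm (t a) <= 1 - eta -> attracted f (Some q) (Some a).
  by move=> Ea; exact: (off_tube n a n2 N1n Ea).2.
have {}trapQ a : nm (a - q) <= s0 -> attracted f (Some q) (Some a) by exact: trapQ.
clearbody f.
pose J a := ~ attracted f None (Some a) /\ ~ attracted f (Some q) (Some a).
have J_tube a : J a -> E.[a] != 0 /\ `|nm (t a) - 1| < eta.
  move=> [JN JQ]; have Ea : E.[a] != 0 by apply/negP => /eqP/pole.
  split => //; rewrite ltr_norml; apply/andP; split; rewrite ltNge; apply/negP => h.
    by apply: JQ; apply: inner => //; lra.
  by apply: JN; apply: outer => //; lra.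
have J_image a : J a -> J (q + t a ^+ n).
  by move=> Ja; have [Ea _] := J_tube a Ja; case: Ja; rewrite /J -fE// !attracted_image.
have J_q a : J a -> s0 < nm (a - q).
  by move=> [_ JQ]; rewrite ltNge; apply/negP => h; exact/JQ/trapQ.
pose sig := 2 * L * eta.
have sig0 : 0 < sig by rewrite !mulr_gt0.
have sigs : sig <= s0 / 2.
  by move: etas; rewrite ler_pdivlMr// /sig; lra.
have lift_step a b : J a -> nm (q + t a ^+ n - b) <= sig ->
    exists z, [/\ E.[z] != 0, q + t z ^+ n = b & nm (z - a) <= nm (q + t a ^+ n - b) / 2].
  move=> Ja; have [Ea ta] := J_tube a Ja; have Jw := J_image a Ja.
  set w := q + t a ^+ n in Jw * => wb.
  have wq := J_q w Jw; have wq0 : w - q != 0 by rewrite -nm_gt0 (lt_trans s00).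
  pose xi := (b - w) / (w - q).
  have xib : nm xi <= nm (w - b) / s0.
    have wqp : 0 < nm (w - q) by exact: lt_trans wq.
    by rewrite /xi nm_div nmC ler_wpM2l ?nm_ge0// lef_pV2 ?posrE// ltW.
  have xi2 : nm xi <= 2^-1.
    by apply: (le_trans xib); rewrite ler_pdivrMr//; lra.
  have [zeta zn zle] := root_pow2_near1 m xi2.
  have ta2 : nm (t a) <= 2 by move: ta; rewrite ltr_norml => /andP[_]; lra.
  have vt : nm (t a * zeta - t a) <= 2 * ((2 / 3) ^+ m * nm xi).
    rewrite -{2}[t a]mulr1 -mulrBr nmM ler_pM ?nm_ge0//.
  have p0 : 0 <= (2 / 3) ^+ m :> R by rewrite exprn_ge0//; lra.
  have n0 := nm_ge0 xi.
  have [|||z [Ez tz zL]] := lift a (t a * zeta) => //.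
  - by apply: ltW; apply: lt_le_trans ta _; lra.
  - apply: le_trans vt _; nra.
  exists z; split => //.
    rewrite /t tz exprMn zn /xi mulrDr mulr1.
    have -> : t a ^+ n = w - q by rewrite /w addrC addKr.
    by rewrite mulrC divfK//; ring.
  apply: le_trans zL _; apply: (@le_trans _ _ (L * (2 * (s0 / (4 * L) * (nm (w - b) / s0))))).
    rewrite ler_pM2l//; apply: le_trans vt _; rewrite ler_pM2l//.
    by rewrite ler_pM ?nm_ge0.
  by rewrite le_eqVlt; apply/orP; left; apply/eqP; field; rewrite !gt_eqF.
(* Lifting halves the distance from a point outside both basins to a basin. *)
have dense (B : C -> Prop) (rho : R) : 0 < rho -> `|rho - 1| <= eta ->
    (forall z, E.[z] != 0 -> nm (t z) = rho -> B z) ->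
    (forall z, E.[z] != 0 -> B (q + t z ^+ n) -> B z) ->
    forall k a, J a -> exists2 b, B b & nm (a - b) <= sig * 2^-1 ^+ k.
  move=> rho0 rho1 B1 B2; elim => [|k IH] a Ja; have [Ea ta] := J_tube a Ja.
    have ta0 : 0 < nm (t a) by move: ta; rewrite ltr_norml => /andP[h _]; lra.
    (* t(a) is moved radially onto the circle of radius rho, which in the application is an edge of
       the tube, and lifted; the lift is within 2 L eta = [sig] of a. *)
    pose v := t a * (rho / nm (t a))%:C.
    have vt : nm (v - t a) <= 2 * eta.
      have -> : v - t a = t a * (rho / nm (t a) - 1)%:C.
        by rewrite /v rmorphB /= rmorph1; ring.
      rewrite nmM nm_real.
      have -> : nm (t a) * `|rho / nm (t a) - 1| = `|rho - nm (t a)|.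
        rewrite -[X in X * _](gtr0_norm ta0) -normrM; congr (`|_|).
        by field; rewrite gt_eqF.
      have := ler_distD 1 rho (nm (t a)); rewrite (distrC 1); lra.
    have [|||z [Ez tz zL]] := lift a v => //.
    - by apply: ltW; apply: lt_le_trans ta _; lra.
    - by apply: le_trans vt _; lra.
    exists z; first by apply: B1 => //; rewrite /t tz /v nmM nm_real ger0_norm ?divr_ge0 ?ltW// mulrC divfK// gt_eqF.
    rewrite expr0 mulr1 nmC; apply: le_trans zL _.
    by apply: le_trans (ler_wpM2l (ltW L0) vt) _; rewrite /sig; lra.
  have [b Bb wb] := IH _ (J_image a Ja).
  have [|z [Ez zb za]] := lift_step a b Ja.
    apply: le_trans wb _; rewrite -[leRHS]mulr1 ler_pM2l// exprn_ile1//; lra.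
  exists z; first by apply: B2; rewrite ?zb.
  rewrite nmC; apply: le_trans za _; rewrite exprSr mulrA ler_pM2r//.
have dense_N := dense (fun z => attracted f None (Some z)) (1 + eta).
have dense_Q := dense (fun z => attracted f (Some q) (Some z)) (1 - eta).
have {}dense_N k a : J a -> exists2 b, attracted f None (Some b) & nm (a - b) <= sig * 2^-1 ^+ k.
  apply: dense_N; first lra.
  - by rewrite addrC addKr gtr0_norm.
  - by move=> z Ez tz; apply: outer; rewrite // tz.
  - by move=> z Ez; rewrite -fE// attracted_image.
have {}dense_Q k a : J a -> exists2 b, attracted f (Some q) (Some b) & nm (a - b) <= sig * 2^-1 ^+ k.
  apply: dense_Q; first lra.
  - by rewrite addrC addKr normrN gtr0_norm.
  - by move=> z Ez tz; apply: inner; rewrite // tz.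
  - by move=> z Ez; rewrite -fE// attracted_image.
split => //.
- by move=> a Ea ta; apply: outer => //; lra.
- by move=> a Ea ta; apply: inner => //; lra.
exists sig => // a JN JQ; have Ja : J a by [].
split; first by case: (J_tube a Ja).
- by move=> k; exact: dense_N.
- by move=> k; exact: dense_Q.
- by move=> b; exact: lift_step.
Qed.

Lemma power_map_dichotomy : exists n : nat, (2 <= n)%N /\
  let f := power_map n in
  [/\ forall a, 4 * nm E.[a] <= nm T.[a] -> attracted f None (Some a),
      forall a, nm T.[a] <= 2^-1 * nm E.[a] -> attracted f (Some q) (Some a) &
      forall x, ~ attracted f None x -> ~ attracted f (Some q) x ->
        [/\ forall e : R, 0 < e -> exists2 y, sdist x y < e & attracted f None y,
            forall e : R, 0 < e -> exists2 y, sdist x y < e & attracted f (Some q) y &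
            ~ superattracting f x]].
Proof.
have [n [n2 [pole outer inner [sig sig0 hJ]]]] := power_map_contraction.
exists n; split => //; move: pole outer inner hJ; set f := power_map n.
have fN : f None = None by exact: power_map_infty.
have fE a : E.[a] != 0 -> f (Some a) = Some (q + t a ^+ n) by exact: power_mapE.
clearbody f => pole outer inner hJ.
have sig_small (e : R) : 0 < e -> exists k, sig * 2^-1 ^+ k < e.
  move=> ep; have [||k hk] := @pow_small _ 2^-1 (e / (2 * sig)).
  - by apply/andP; split; lra.
  - by rewrite divr_gt0// mulr_gt0.
  exists k; have := hk k (leqnn k); rewrite ler_pdivlMr ?mulr_gt0//; lra.
split.
- move=> a Ta; have [/pole//|Ea] := eqVneq E.[a] 0; apply: outer => //.
  by rewrite /t nm_div ler_pdivlMr ?nm_gt0//; have := nm_ge0 E.[a]; lra.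
- move=> a Ta; have Ea : E.[a] != 0.
    apply/negP => /eqP Ea; have := coprimep_noroot cTE Ea.
    by rewrite -nm_gt0; move: Ta; rewrite Ea nm0 mulr0; lra.
  by apply: inner => //; rewrite /t nm_div ler_pdivrMr ?nm_gt0.
move=> [a|] JN JQ; last first.
  case: JN => e e0; exists 0%N => k _; have -> : iter k f None = None by elim: k => //= k ->.
  by rewrite sdistxx.
have [Ea dN dQ lift] := hJ a JN JQ.
have near_dense (P : S -> Prop) : (forall k, exists2 b, P (Some b) & nm (a - b) <= sig * 2^-1 ^+ k) ->
    forall e : R, 0 < e -> exists2 y, sdist (Some a) y < e & P y.
  move=> h e ep; have [|k hk] := sig_small (e / 8); first by rewrite divr_gt0.
  have [b Pb ab] := h k; exists (Some b) => //.
  by apply: le_lt_trans (sdist_le_nm _ _) _; lra.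
split; [exact: near_dense dN|exact: near_dense dQ|move=> sa].
have JwN : ~ attracted f None (f (Some a)) by rewrite attracted_image.
have JwQ : ~ attracted f (Some q) (f (Some a)) by rewrite attracted_image.
move: JwN JwQ lift; rewrite fE//; set w := q + t a ^+ n => JwN JwQ lift.
have [_ wN _ _] := hJ w JwN JwQ.
have w0 := nm_ge0 w.
(* With zero derivative at a, |b - w| would be o(|z - a|), whereas lifts satisfy |z - a| <= |b - w|
   / 2. Taking b in the basin of infinity ensures that b differs from w. The constant k pays for
   passing between the plane and the spherical distance near w and leaves a factor 1/2. *)
pose k := 16 * (1 + nm w) ^+ 2.
have k0 : 0 < k by rewrite mulr_gt0// exprn_gt0//; lra.
have ik0 : 0 < k^-1 by rewrite invr_gt0.
have [dl dl0 hdl] := sa k^-1 ik0.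
have [|j hj] := sig_small (Num.min (Num.min sig 1) (dl / 4)).
  by rewrite !lt_min sig0 ltr01 divr_gt0.
move: hj; rewrite !lt_min => /andP[/andP[j1 j2] j3].
have [b bN wb] := wN j.
have bw : 0 < nm (w - b).
  by rewrite nm_gt0 subr_eq0; apply/eqP => e; apply: JwN; rewrite e.
have [|z [Ez zb za]] := lift b; first lra.
have zaS : sdist (Some z) (Some a) <= 4 * nm (w - b).
  by apply: le_trans (sdist_le_nm _ _) _; lra.
have := hdl (Some z); rewrite !fE// zb -/w => /(_ _) h.
have : sdist (Some b) (Some w) <= k^-1 * (4 * nm (w - b)).
  apply: le_trans (h _) _; first lra.
  by rewrite ler_wpM2l// ltW.
have hbw := nm_le_sdist b w; rewrite nmC in hbw.
have bw2 : 1 + nm b <= 2 * (1 + nm w) by have := nm_lerBC w b; lra.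
have s0 := sdist_ge0 (Some b) (Some w).
rewrite mulrC ler_pdivlMr// => h1.
have : nm (w - b) <= 2 * (1 + nm w) * (1 + nm w) * sdist (Some b) (Some w).
  apply: le_trans hbw _; rewrite ler_wpM2r// ler_wpM2r//; lra.
move: h1; rewrite /k; nra.
Qed.

End Core.

(** * Basins and the Julia set *)

Section Basins.
Variable R : realType.
Local Notation S := (sphere R).
Implicit Types (f : S -> S) (x y z : S) (A B U : set S).

Lemma edist_sdist x y : edist (x, y) = (sdist x y)%:E.
Proof.
apply/eqP; rewrite eq_le; apply/andP; split.
  apply/lee_addgt0Pr => e e0; apply: ereal_inf_lbound => /=.
  exists (sdist x y + e); last by rewrite EFinD.
  by split; [rewrite ltr_wpDl// sdist_ge0|rewrite /ball /= ltrDl].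
by apply: le_ereal_inf_tmp => _ /= [r [r0 xyr] <-]; rewrite lee_fin ltW.
Qed.

Lemma edist_inf1 x y : edist_inf [set x] y = (sdist y x)%:E.
Proof. by rewrite /edist_inf image_set1 ereal_inf1 edist_sdist. Qed.

Lemma orbit_converges_to1P f x z : orbit_converges_to f [set x] z <-> attracted f x z.
Proof.
rewrite /orbit_converges_to; under eq_fun do rewrite edist_inf1.
split => [/fine_cvgP[_ /cvgrPdist_lt h] e e0|h].
  have [N _ hN] := h e e0; exists N => n /hN /=.
  by rewrite sub0r normrN ger0_norm ?sdist_ge0.
apply: cvg_EFin; first by apply: nearW.
apply/cvgrPdist_lt => e e0; have [N hN] := h e e0; exists N => // n /hN /=.
by rewrite sub0r normrN ger0_norm ?sdist_ge0.
Qed.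

Lemma basin1E f x : basin f [set x] = [set z | attracted f x z].
Proof. by apply/seteqP; split => z /orbit_converges_to1P. Qed.

Lemma superattracting_cycle f x : {for x, continuous f} -> f x = x ->
  superattracting f x -> attracting_cycle f [set x].
Proof.
move=> fc fx sf; exists x.
  exists 1%N => //; split => //; exists 0; last by rewrite normr0.
  exact: (critical_pointP fc).2.
apply/seteqP; split => [_ ->|_ [n _ <-]]; first by exists 0%N.
by elim: n => //= n ->.
Qed.

Lemma superattracting_trap f x : f x = x -> superattracting f x ->
  exists2 d : R, 0 < d & forall e : R, 0 < e -> exists N, forall n, (N <= n)%N ->
      forall z, sdist z x < d -> sdist (iter n f z) x < e.
Proof.
move=> fx sf; have h2 : 0 < 2^-1 :> R by rewrite invr_gt0.
have [d d0 hd] := sf _ h2; exists d => // e e0.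
have it n z : sdist z x < d -> sdist (iter n f z) x <= 2^-1 ^+ n * d.
  move=> zd; suff : sdist (iter n f z) x < d /\ sdist (iter n f z) x <= 2^-1 ^+ n * d by case.
  elim: n => [|n [IH1 IH2]]; first by rewrite expr0 mul1r ltW.
  have := hd _ IH1; rewrite fx => h; have s0 := sdist_ge0 (iter n f z) x.
  rewrite iterS exprS -mulrA; split; lra.
have [||N hN] := @pow_small _ 2^-1 (e / (2 * d)).
- by apply/andP; split; lra.
- by rewrite divr_gt0// mulr_gt0.
exists N => n /hN; rewrite ler_pdivlMr ?mulr_gt0// => h z /(it n); lra.
Qed.

Lemma continuous_iter f n : continuous f -> continuous (iter n f).
Proof.
move=> fc; elim: n => [|n IH] x; first exact: cvg_id.
exact: (continuous_comp (IH x) (fc _)).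
Qed.

(** The trap is pulled back by an iterate that takes z into it. Convergence is then uniform near z,
    which serves both the openness of basins and normality. *)
Lemma attracted_nbhs f x z : continuous f -> f x = x -> superattracting f x ->
  attracted f x z -> exists U, [/\ open U, U z & forall e : R, 0 < e ->
    exists N, forall n, (N <= n)%N -> forall y, U y -> sdist (iter n f y) x < e].
Proof.
move=> fc fx sf zx; have [d d0 hd] := superattracting_trap fx sf.
have [M hM] := zx d d0.
exists ((iter M f @^-1` (ball x d))^°); split.
- exact: open_interior.
- apply: (@continuous_iter f M fc z); apply/nbhs_sdistP.
  have /= h := hM M (leqnn M); exists (d - sdist (iter M f z) x); first by rewrite subr_gt0.
  move=> y yM; rewrite /ball /=.
  have := sdist_triangle (iter M f z) x y; rewrite (sdist_sym x (iter M f z)); lra.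
- move=> e /hd [N hN]; exists (N + M)%N => n NMn y /interior_subset /= yx.
  rewrite -(subnK (leq_trans (leq_addl _ _) NMn)) iterD; apply: hN.
    by rewrite leq_subRL 1?addnC// (leq_trans _ NMn)// leq_addl.
  by rewrite sdist_sym.
Qed.

Lemma open_attracted f x : continuous f -> f x = x -> superattracting f x ->
  open [set z | attracted f x z].
Proof.
move=> fc fx sf; rewrite openE => z /(attracted_nbhs fc fx sf)[U [oU Uz hU]].
apply: (filterS _ (open_nbhs_nbhs (conj oU Uz))) => y Uy e /hU[N hN].
by exists N => n /hN; exact.
Qed.

Lemma uniform_sdistP (K : set S) (s : nat -> S -> S) (g : S -> S) :
  {uniform K, s @ \oo --> g} <-> forall e : R, 0 < e -> exists N, forall n, (N <= n)%N ->
    forall y, K y -> sdist (g y) (s n y) < e.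
Proof.
split => [h e e0|h P].
  have : nbhs (g : {uniform` K -> S}) [set u | forall y, K y -> sdist (g y) (u y) < e].
    apply/uniform_nbhs; exists [set u | ball u.1 e u.2]; split => //.
    by rewrite -(@entourage_ballE R S); exists e.
  by move=> /h [N _ hN]; exists N => n Nn; exact: hN.
move=> /uniform_nbhs[E [entE EP]].
move: entE; rewrite -entourage_ballE => -[e /= e0 eE].
have [N hN] := h e e0; exists N => // n Nn; apply: EP => y Ky.
by apply: eE => /=; exact: hN.
Qed.

(** A sequence from the family is f^(k n) with k arbitrary. Either some exponent recurs infinitely
    often and gives a constant subsequence, or k tends to infinity and the sequence itself converges
    to x uniformly near z. *)
Lemma attracted_fatou f x z : continuous f -> f x = x -> superattracting f x ->
  attracted f x z -> fatou_set f z.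
Proof.
move=> fc fx sf /(attracted_nbhs fc fx sf)[U [oU Uz hU]]; exists U; split => //.
move=> s /(_ _) hs; have /choice[k hk] : forall n, exists k, iter k f = s n.
  by move=> n; have [k _ e] := hs n; exists k.
have [[m hm]|nm] := pselect (exists m, forall N, exists2 n, (N <= n)%N & k n = m).
  have /choice[h hh] : forall N, exists n, (N <= n)%N /\ k n = m.
    by move=> N; have [n ? ?] := hm N; exists n.
  pose phi n := iter n (fun i => h i.+1) (h 0%N).
  exists phi; split.
    apply: homo_ltn; first exact: ltn_trans.
    by move=> i; rewrite /phi iterS; case: (hh (phi i).+1).
  exists (iter m f) => K _ _; apply/uniform_sdistP => e e0; exists 0%N => n _ y _.
  have kphi : k (phi n) = m by case: n => [|n]; [exact: (hh 0%N).2|exact: (hh _).2].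
  by rewrite -hk kphi sdistxx.
have k_oo M : exists N, forall n, (N <= n)%N -> (M <= k n)%N.
  elim: M => [|M [N hN]]; first by exists 0%N.
  have [N' hN'] : exists N', forall n, (N' <= n)%N -> k n <> M.
    apply: contrapT => h; apply: nm; exists M => N1; apply: contrapT => h1.
    apply: h; exists N1 => n N1n kn; apply: h1; by exists n.
  exists (maxn N N') => n; rewrite geq_max => /andP[/hN n1 /hN' n2].
  by rewrite ltn_neqAle n1 andbT eq_sym; apply/eqP.
exists id; split => //; exists (fun=> x) => K _ KU; apply/uniform_sdistP => e /hU[N hN].
have [N' hN'] := k_oo N; exists N' => n /hN' kn y /KU Uy.
by rewrite -hk sdist_sym; exact: hN.
Qed.

(** On a closed ball, compact as the sphere is, a limit g of iterates equals x1 on one basin and x2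
    on the other. A late iterate is uniformly close to g, so by continuity at z its value at z would
    be closer than half the distance between x1 and x2 to both. *)
Lemma adherent_two_basins f x1 x2 z : continuous f -> x1 <> x2 ->
  (forall e : R, 0 < e -> exists2 y, sdist z y < e & attracted f x1 y) ->
  (forall e : R, 0 < e -> exists2 y, sdist z y < e & attracted f x2 y) ->
  ~ fatou_set f z.
Proof.
move=> fc x12 h1 h2 [U [oU Uz nU]].
have [|phi [phi_homo [g hg]]] := nU (fun n => iter n f); first by move=> n; exists n.
have phi_ge n : (n <= phi n)%N.
  by elim: n => // n IH; apply: leq_ltn_trans IH _; exact: phi_homo.
have /nbhs_sdistP[r r0 hr] : nbhs z U by exact: open_nbhs_nbhs.
pose K := [set y | sdist z y <= r / 2].
have cK : compact K.
  have key y w : sdist y w < sdist z y - r / 2 -> r / 2 < sdist z w.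
    by have := sdist_triangle w z y; rewrite (sdist_sym w); lra.
  apply: subclosed_compact (@compact_sphere R) _ => //.
  rewrite -[K]setCK; apply: open_closedC; rewrite openE => y /= /negP; rewrite -ltNge => ry.
  apply/nbhs_sdistP; exists (sdist z y - r / 2); first by rewrite subr_gt0.
  move=> w yw /=; apply/negP; rewrite -ltNge.
  exact: key yw.
have KU : K `<=` U by move=> y /= zy; apply: hr; apply: le_lt_trans zy _; lra.
have /uniform_sdistP hu := hg K cK KU.
have glim x y : K y -> attracted f x y -> g y = x.
  move=> Ky yx; apply: sdist_positivity; apply/eqP; rewrite eq_le sdist_ge0 andbT.
  rewrite leNgt; apply/negP => D0.
  have D2 : 0 < sdist (g y) x / 2 by rewrite divr_gt0.
  have [N hN] := hu _ D2; have [M hM] := yx _ D2.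
  have := hN (maxn N M) (leq_maxl _ _) y Ky.
  have := hM (phi (maxn N M)) (leq_trans (leq_maxr _ _) (phi_ge _)).
  have := sdist_triangle (iter (phi (maxn N M)) f y) (g y) x; lra.
have D0 : 0 < sdist x1 x2.
  rewrite lt_neqAle sdist_ge0 andbT; apply/eqP => /esym/sdist_positivity.
  exact: x12.
have D4 : 0 < sdist x1 x2 / 4 by rewrite divr_gt0.
have [N hN] := hu _ D4.
have [d d0 hd] := (continuous_sdistP _ z).1 (@continuous_iter f (phi N) fc z) _ D4.
have close x : (forall e : R, 0 < e -> exists2 y, sdist z y < e & attracted f x y) ->
    sdist (iter (phi N) f z) x < sdist x1 x2 / 2.
  move=> hx; have [|y] := hx (Num.min d (r / 2)); first by rewrite lt_min d0 divr_gt0.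
  rewrite lt_min => /andP[yd yr] yx.
  have Ky : K y by rewrite /K /= ltW.
  have := hN N (leqnn N) y Ky; rewrite (glim x y Ky yx) sdist_sym.
  have := hd y yd; have := sdist_triangle (iter (phi N) f y) (iter (phi N) f z) x; lra.
have := close x1 h1; have := close x2 h2.
have := sdist_triangle (iter (phi N) f z) x1 x2.
rewrite (sdist_sym x1 (iter (phi N) f z)); lra.
Qed.

Lemma hausdorff_dist_lt A B (e e' : R) : e < e' ->
  (forall a, A a -> exists2 b, B b & sdist a b <= e) ->
  (forall b, B b -> exists2 a, A a & sdist b a <= e) ->
  (hausdorff_dist A B < e'%:E)%E.
Proof.
move=> ee' hA hB; apply: (@le_lt_trans _ _ e%:E); last by rewrite lte_fin.
have bound (X Y : set S) : (forall a, X a -> exists2 b, Y b & sdist a b <= e) ->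
    (ereal_sup [set edist_inf Y a | a in X] <= e%:E)%E.
  move=> h; apply: ge_ereal_sup => _ [a Xa <-]; have [b Yb ab] := h a Xa.
  apply: le_trans (_ : edist (a, b) <= _)%E; last by rewrite edist_sdist lee_fin.
  by apply: ereal_inf_lbound; exists b.
by rewrite /hausdorff_dist ge_max !bound.
Qed.

Lemma connected_meets_complement (G U V : set S) x y : connected G -> open U -> open V ->
  U `&` V = set0 -> G x -> G y -> U x -> V y -> exists2 z, G z & ~ U z /\ ~ V z.
Proof.
move=> cG oU oV UV Gx Gy Ux Vy; apply: contrapT => h.
have cov z : G z -> U z \/ V z.
  move=> Gz; apply: contrapT => /not_orP nz; apply: h; by exists z.
have dis z : U z -> V z -> False.
  by move=> Uz Vz; have : (U `&` V) z by []; rewrite UV.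
have : G `&` U = G.
  apply: cG; first by exists x.
  - by exists U.
  - exists (~` V); first exact: open_closedC.
    apply/seteqP; split => z [Gz hz]; split => //.
      by move=> Vz; exact: dis hz Vz.
    by case: (cov z Gz).
by move=> /seteqP[_ /(_ y Gy)[_ Uy]]; exact: dis Uy Vy.
Qed.

Lemma closure_sdistP A x : closure A x <-> forall e : R, 0 < e ->
  exists2 y, A y & sdist x y < e.
Proof.
split => [h e e0|h U /nbhs_sdistP[e e0 he]].
  have [|y [Ay xy]] := h [set y | sdist x y < e]; last by exists y.
  by apply/nbhs_sdistP; exists e.
by have [y Ay /he Uy] := h e e0; exists y.
Qed.

End Basins.

(** * Assembly *)

Section Assembly.
Variable R : realType.
Local Notation C := R[i].
Local Notation S := (sphere R).
Implicit Types (f r : S -> S) (x y p q : S) (A K P : set S).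

(** What the construction has to deliver for a core K of A. Apart from rationality the clauses are
    invariant under isometries, so that p may be moved to infinity; the last one identifies the
    Julia set and keeps critical points off it. *)
Definition realises A K P p q r :=
  [/\ [/\ rational_map r, continuous r, r p = p & r q = q],
      superattracting r p /\ superattracting r q,
      r @^-1` [set p] = P,
      K `<=` attracted r p /\ ~` A `<=` attracted r q &
      forall x, ~ attracted r p x -> ~ attracted r q x ->
        [/\ forall e : R, 0 < e -> exists2 y, sdist x y < e & attracted r p y,
            forall e : R, 0 < e -> exists2 y, sdist x y < e & attracted r q y &
            ~ superattracting r x]].

Lemma realises_infty A K (s : seq C) (q : C) : open A -> A None ->
  (forall c, c \in s -> A (Some c)) -> ~ A (Some q) ->
  (forall t : seq C, exists2 z, ~ A (Some z) & z \notin t) ->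
  compact K -> K `<=` A ->
  (forall x, K x -> exists2 p, p = None \/ (exists2 c, c \in s & p = Some c) &
     connected_component A p x) ->
  exists p1 q1 : {poly C}, let r := ratfun p1 q1 in
  [/\ coprimep p1 q1, (size q1 < size p1)%N & q1 != 0] /\
  realises A K [set x | x = None \/ (exists2 c, c \in s & x = Some c)] None (Some q) r.
Proof.
move=> oA AN As Aq Finf cK KA Kcomp.
have [T0 [E [[E0 cT0 sET0 T0q] [rE FT KT]]]] :=
  exists_separating_fraction oA AN As Aq Finf cK KA Kcomp.
(* With tau in [1, 2] the bound 1/4 off A becomes at most 1/2 and the bound 4 on K persists, while
   finite critical points leave the curve |T| = |E|. *)
have [tau /andP[tau1 tau2] hW] := generic_scale cT0 E0 sET0.
have tau0 : 0 < tau by lra.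
have tC : tau%:C != 0 :> C by rewrite -nm_gt0 nm_real gtr0_norm.
pose T := tau%:C *: T0.
have Tz z : nm T.[z] = tau * nm T0.[z] by rewrite /T hornerZ nmM nm_real gtr0_norm.
have cT : coprimep T E by rewrite /T coprimepZl.
have sET : (size E < size T)%N by rewrite /T size_scale.
have Tq : T.[q] = 0 by rewrite /T hornerZ T0q mulr0.
have hWT c : root (wronskian T E) c -> nm T.[c] != nm E.[c].
  rewrite Tz (_ : wronskian T E = tau%:C *: wronskian T0 E) ?rootZ//; first exact: hW.
  by rewrite /wronskian /T derivZ -!scalerAl -scalerBr.
have [n [n2 [hN hQ hJ]]] := power_map_dichotomy E0 cT sET Tq hWT.
have EQ : power_map T E q n = ratfun (q *: E ^+ n + T ^+ n) (E ^+ n) by [].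
exists (q *: E ^+ n + T ^+ n), (E ^+ n); rewrite -EQ /=; split.
  by split; [exact: coprime_power_map|exact: size_power_map|rewrite expf_neq0].
split.
- split; [| |exact: power_map_infty|exact: power_map_q].
    by exists (q *: E ^+ n + T ^+ n), (E ^+ n); split => //; exact: coprime_power_map.
  exact/ratfun_continuous/coprime_power_map.
- by split; [exact: power_map_superattracting_infty|exact: power_map_superattracting_q].
- apply/seteqP; split => [[a|] h|_ [->|[c cs ->]]].
  + right; exists a => //; rewrite -rE; apply/negPn/negP => Ea.
    have : power_map T E q n (Some a) = None by exact: h.
    by rewrite power_mapE.
  + by left.
  + exact: power_map_infty.
  + by apply: power_map_pole => //; apply/eqP; rewrite -[_ == 0]/(root E c) rE.
- split.
    move=> [a|] Ka /=; last first.
      by move=> e e0; exists 0%N => k _; rewrite (_ : iter k _ None = None) ?sdistxx//;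
         elim: k => //= k ->; exact: power_map_infty.
    apply: hN; rewrite Tz; have := KT a Ka; have := nm_ge0 T0.[a]; nra.
  move=> [a|] nA //=; apply: hQ; rewrite Tz; have := FT a nA.
  by have := nm_ge0 T0.[a]; have := nm_ge0 E.[a]; nra.
- exact: hJ.
Qed.

(** The identity takes care of p at infinity, because no [rot c] fixes infinity. *)
Lemma normaliser p : exists s s' : S -> S,
  [/\ cancel s s', cancel s' s, forall x y, sdist (s x) (s y) = sdist x y,
      s p = None &
      forall p1 q1 : {poly C}, coprimep p1 q1 -> (size q1 < size p1)%N -> q1 != 0 ->
        rational_map (s' \o ratfun p1 q1 \o s)].
Proof.
case: p => [c|]; last first.
  by exists id, id; split => // p1 q1 c1 _ _; exists p1, q1.
exists (rot c), (rot (- conjc c)); split.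
- exact: rotK.
- exact: rotVK.
- exact: sdist_rot.
- by rewrite /rot eqxx.
- by move=> p1 q1; exact: rational_map_conj_rot.
Qed.

Lemma mem_finite_part (l : seq S) (c : C) :
  (c \in pmap id (l : seq (option C))) = (Some c \in l).
Proof. by elim: l => //= -[a|] u IH /=; rewrite !in_cons IH. Qed.

Lemma exists_realisation A K P p q : open A -> finite_set P -> P `<=` A -> P p ->
  ~ A q -> (forall l : seq S, exists2 x, ~ A x & x \notin l) ->
  compact K -> K `<=` A ->
  (forall x, K x -> exists2 y, P y & connected_component A y x) ->
  exists r, realises A K P p q r.
Proof.
move=> oA finP PA Pp nAq Ainf cK KA Kcomp.
have [s [s' [sK s'K iso sp rat]]] := normaliser p.
have iso' x y : sdist (s' x) (s' y) = sdist x y by rewrite -iso !s'K.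
have cont (u : S -> S) : (forall x y, sdist (u x) (u y) = sdist x y) -> continuous u.
  by move=> hu x; apply/continuous_sdistP => e e0; exists e => // y; rewrite hu.
have cs := cont s iso; have cs' := cont s' iso'.
pose A' : set S := s' @^-1` A.
have [l lP] : exists l : seq S, forall x, P x <-> x \in l.
  by have /finite_seqP[l Pl] := finP; exists l => x; rewrite Pl.
pose t : seq C := pmap id (map s l).
have tP c : (c \in t) = (Some c \in map s l).
  exact: mem_finite_part.
have tPs c : (c \in t) <-> P (s' (Some c)).
  rewrite tP lP; split => [/mapP[x xl ->]|h]; first by rewrite sK.
  by apply/mapP; exists (s' (Some c)); rewrite ?s'K.
have oA' : open A' by apply: open_comp => // x _; exact: cs'.
have s'N : s' None = p by rewrite -sp sK.
have [b sq] : exists b : C, s q = Some b.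
  case e: (s q) => [b|]; first by exists b.
  by case: nAq; rewrite -(sK q) e s'N; exact: PA.
have s'q : s' (Some b) = q by rewrite -sq sK.
have [|||||||p1 [q1 /= [[c1 sz q10]
    [[rm cr rN rq] [saN saq] rpre [hK hA] hJ]]]] :=
  @realises_infty A' (s @` K) t b oA'.
- by rewrite /A' /= s'N; exact: PA.
- by move=> c /tPs; exact: PA.
- by rewrite /A' /= s'q.
(* Listing p keeps [s x] finite, since s sends p to infinity. *)
- move=> u; have [x nAx xl] := Ainf (p :: map (fun c => s' (Some c)) u).
  case e: (s x) => [z|]; last by move: xl; rewrite -(sK x) e s'N in_cons eqxx.
  exists z; first by rewrite /A' /= -e sK.
  apply: contra xl => zu; rewrite in_cons; apply/orP; right; apply/mapP; exists z => //.
  by rewrite -e sK.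
- by apply: continuous_compact => //; exact: continuous_subspaceT.
- by move=> _ [x Kx <-]; rewrite /A' /= sK; exact: KA.
- move=> _ [x Kx <-]; have [y Py yx] := Kcomp x Kx; exists (s y).
    case e: (s y) => [c|]; [right|by left]; exists c => //.
    by apply/tPs; rewrite -e sK.
  have Ay := PA _ Py.
  have : (s @` connected_component A y) (s x) by exists x.
  apply: connected_component_max.
  + by exists y => //; exact: connected_component_refl.
  + by move=> _ [z /connected_component_sub Az <-]; rewrite /A' /= sK.
  + apply: connected_continuous_connected; first exact: component_connected.
    exact: continuous_subspaceT.
have := rat _ _ c1 sz q10.
set f := ratfun p1 q1 in rm cr rN rq saN saq rpre hK hA hJ * => ratf; clearbody f.
pose r := s' \o f \o s; exists r.
have rE x : r x = s' (f (s x)) by [].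
have iter_r k x : iter k r x = s' (iter k f (s x)).
  by elim: k => [|k IH] /=; rewrite ?sK// IH rE s'K.
have att x y : attracted r (s' x) (s' y) = attracted f x y.
  by apply/propext; split => h e /h[N hN]; exists N => k /hN; rewrite iter_r iso' s'K.
have sup x : superattracting r (s' x) = superattracting f x.
  apply/propext; split => h e /h[d d0 hd]; exists d => // z.
    by have := hd (s' z); rewrite !rE !s'K !iso'.
  have -> : sdist z (s' x) = sdist (s z) x by rewrite -iso s'K.
  by rewrite !rE s'K iso'; exact: hd.
split.
- split; first exact: ratf.
  + move=> x; apply: continuous_comp; first exact: cs.
    by apply: continuous_comp; [exact: cr|exact: cs'].
  + by rewrite rE sp rN.
  + by rewrite rE sq rq.
- by rewrite -s'N -s'q !sup.
- apply/seteqP; split => x.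
    rewrite /= rE => e; have : (f @^-1` [set None]) (s x) by rewrite /= -(s'K (f (s x))) e sp.
    rewrite rpre => -[|[c ct]] sx.
      by rewrite -(sK x) sx s'N.
    by rewrite -(sK x) sx; apply/tPs.
  move=> Px; suff : r x = p by []; rewrite rE.
  suff : (f @^-1` [set None]) (s x) by move=> fx; rewrite [f (s x)]fx s'N.
  rewrite rpre; case e: (s x) => [c|]; [right|by left]; exists c => //.
  by apply/tPs; rewrite -e sK.
- split => x Kx.
    by rewrite -(sK x) -s'N; rewrite att; apply: hK; exists x.
  by rewrite -(sK x) -s'q; rewrite att; apply: hA; rewrite /A' /= sK.
- move=> x; rewrite -(sK x) -s'N -s'q !att sup => h1 h2.
  have [d1 d2 d3] := hJ _ h1 h2; split => // e.
    by move=> /d1[y xy ya]; exists (s' y); rewrite ?iso' ?att.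
  by move=> /d2[y xy ya]; exists (s' y); rewrite ?iso' ?att.
Qed.

(** Each point of closure A is close to some point of A, which has a ball inside A; compactness of
    the sphere makes the radius of that ball uniform. *)
Lemma inner_core A (e : R) : 0 < e -> exists2 d : R, 0 < d & forall y, closure A y ->
  open A -> exists2 x, sdist y x < e & forall w, sdist x w < d -> A w.
Proof.
move=> e0; pose Q (V : set S) := exists2 d : R, 0 < d & forall y, V y -> closure A y ->
  open A -> exists2 x, sdist y x < e & forall w, sdist x w < d -> A w.
suff [d d0 hd] : Q setT by exists d => // y; exact: hd.
apply: (@compact_induction _ _ Q (@compact_sphere R)).
- by exists 1.
- move=> U V [d1 d10 h1] [d2 d20 h2]; exists (Num.min d1 d2); first by rewrite lt_min d10.
  move=> y [Uy|Vy] cy oA.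
    have [x yx hx] := h1 y Uy cy oA; exists x => // w.
    by rewrite lt_min => /andP[/hx].
  have [x yx hx] := h2 y Vy cy oA; exists x => // w.
  by rewrite lt_min => /andP[_ /hx].
- by move=> U V UV [d d0 h]; exists d => // y /UV; exact: h.
move=> y _; have e2 : 0 < e / 2 by rewrite divr_gt0.
have [[oA cy]|ny] := pselect (open A /\ closure A y); last first.
  have [oA|noA] := pselect (open A); last first.
    by exists setT; [exact: filterT|exists 1].
  exists (~` closure A); last by exists 1 => // z nz.
  apply: open_nbhs_nbhs; split; last by move=> cy; apply: ny.
  exact/closed_openC/closed_closure.
have [x Ax yx] := (closure_sdistP A y).1 cy _ e2.
have /nbhs_sdistP[d d0 hd] : nbhs x A by exact: open_nbhs_nbhs.
exists [set z | sdist y z < e / 2]; first by apply/nbhs_sdistP; exists (e / 2).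
exists d => // z /= yz _ _; exists x; last exact: hd.
by have := sdist_triangle y z x; rewrite (sdist_sym z y); lra.
Qed.

End Assembly.

(** * Choice of the core and Hausdorff estimates *)

Section Approximation.
Variable R : realType.
Local Notation C := R[i].
Local Notation S := (sphere R).
Implicit Types (r : S -> S) (x y : S).

Lemma attracted_unique r p q x : attracted r p x -> attracted r q x -> p = q.
Proof.
move=> hp hq; apply: sdist_positivity; apply/eqP; rewrite eq_le sdist_ge0 andbT.
rewrite leNgt; apply/negP => D0; have D2 : 0 < sdist p q / 2 by rewrite divr_gt0.
have [N hN] := hp _ D2; have [M hM] := hq _ D2.
have := hN _ (leq_maxl N M); have := hM _ (leq_maxr N M).
have := sdist_triangle (iter (maxn N M) r x) p q.
rewrite (sdist_sym p (iter _ _ _)); lra.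
Qed.

Lemma compact_core (A : set S) (d : R) : 0 < d ->
  compact [set x | forall w, sdist x w < d -> A w].
Proof.
move=> d0; apply: subclosed_compact (@compact_sphere R) _ => //.
rewrite -[X in closed X]setCK; apply: open_closedC; rewrite openE => x /= nx.
have [w xw nAw] : exists2 w, sdist x w < d & ~ A w.
  by apply: contrapT => h; apply: nx => w xw; apply: contrapT => nA; apply: h; exists w.
apply/nbhs_sdistP; exists (d - sdist x w); first by rewrite subr_gt0.
move=> y xy /= hy; apply: nAw; apply: hy.
apply: le_lt_trans (sdist_triangle x _ _) _.
by rewrite (sdist_sym y) -ltrBrDr.
Qed.

Section Realisation.
Variables (eps : R) (A1 A2 J : set S).
Hypothesis eps_gt0 : 0 < eps.
Hypothesis A1_open : open A1.
Hypothesis A2_open : open A2.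
Hypothesis bdA1 : boundary A1 = J.
Hypothesis bdA2 : boundary A2 = J.
Hypothesis cover : disjoint_cover3 A1 A2 J.

(** K consists of the points whose d-ball lies in [A1]. Points off [A1] go to q, so the basin of p
    lies between K and [A1] and that of q contains [A2] and J; the estimates follow from K being
    e-dense in [A1]. K comes before P because the first claim of the theorem picks P in terms of
    K. *)
Lemma approximating_core : exists K, [/\ compact K, K `<=` A1 &
  forall P p q r, P `<=` A1 -> ~ A1 q -> realises A1 K P p q r ->
    approximates eps A1 A2 J r (basin r [set p]) (basin r [set q])].
Proof.
case: cover => cov A12 A1J A2J.
(* The bound 1/2 lets [ball_arc] apply at distances below e; eps / 4 leaves room for 2 e. *)
pose e := Num.min (eps / 4) 2^-1.
have e0 : 0 < e by rewrite lt_min divr_gt0//= invr_gt0.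
have [e_eps e1] : e <= eps / 4 /\ e <= 2^-1 by split; rewrite /e ge_min lexx ?orbT.
have [d' d'0 core'] := inner_core A1 e0.
pose d := Num.min d' e.
have d0 : 0 < d by rewrite lt_min d'0.
have [dd' de] : d <= d' /\ d <= e by split; rewrite /d ge_min lexx ?orbT.
pose K := [set x | forall w, sdist x w < d -> A1 w].
have KA : K `<=` A1 by move=> x; apply; rewrite sdistxx.
have core y : closure A1 y -> exists2 x, K x & sdist y x < e.
  move=> /core' /(_ A1_open)[x yx hx]; exists x => // w xw; apply: hx.
  exact: lt_le_trans xw dd'.
have notK x : ~ K x -> exists2 w, ~ A1 w & sdist x w < d.
  by move=> nK; apply: contrapT => h; apply: nK => w xw; apply: contrapT => nA; apply: h; exists w.
exists K; split; [exact: compact_core|exact: KA|].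
move=> P p q r PA nAq [[rat cr rp rq] [sp sq] rpre [KB AB] rest].
have Pp : P p by rewrite -rpre.
have pq : p <> q by move=> e'; apply: nAq; rewrite -e'; exact: PA.
rewrite !basin1E; set B1 := [set z | attracted r p z]; set B2 := [set z | attracted r q z].
have oB1 : open B1 by exact: open_attracted.
have oB2 : open B2 by exact: open_attracted.
have B12 x : B1 x -> B2 x -> False by move=> h1 h2; apply: pq; exact: attracted_unique h1 h2.
have B1A : B1 `<=` A1.
  by move=> x B1x; apply: contrapT => /AB; exact: B12.
have nA1 x : ~ A1 x -> A2 x \/ J x.
  by move=> nx; have : [set: S] x by []; rewrite -cov => -[[]|]; auto.
have JA1 x : J x -> ~ A1 x by move=> Jx Ax; have : (A1 `&` J) x by []; rewrite A1J.
have A2A1 x : A2 x -> ~ A1 x by move=> A2x Ax; have : (A1 `&` A2) x by []; rewrite A12.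
have Jcl1 x : J x -> closure A1 x by rewrite -bdA1 => -[].
have Jcl2 x : J x -> closure A2 x by rewrite -bdA2 => -[].
(* Basins of superattracting fixed points lie in the Fatou set, and a point in neither basin is
   adherent to both. *)
have juliaE : julia_set r = ~` B1 `&` ~` B2.
  apply/seteqP; split => x.
    by move=> nF; split => Bx; apply: nF; [exact: attracted_fatou cr rp sp Bx|exact: attracted_fatou cr rq sq Bx].
  by move=> [n1 n2]; have [h1 h2 _] := rest x n1 n2; exact: adherent_two_basins cr pq h1 h2.
have cycle_p : attracting_cycle r [set p] by exact: superattracting_cycle (cr p) rp sp.
have cycle_q : attracting_cycle r [set q] by exact: superattracting_cycle (cr q) rq sq.
have adherent x : ~ B1 x -> ~ B2 x -> closure B1 x /\ closure B2 x.
  move=> n1 n2; have [h1 h2 _] := rest x n1 n2.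
  by split; apply/closure_sdistP => t t0;
     [have [y xy By] := h1 t t0|have [y xy By] := h2 t t0]; exists y.
have open_sep (U V : set S) x : open U -> (forall x, U x -> V x -> False) -> U x -> ~ closure V x.
  move=> oU UV Ux clV; have [|y [Vy Uy]] := clV U; first exact: open_nbhs_nbhs.
  exact: UV Uy Vy.
have boundaryE (U V : set S) : open U -> open V -> (forall x, U x -> V x -> False) ->
    (forall x, ~ U x -> ~ V x -> closure U x) -> boundary U = ~` U `&` ~` V.
  move=> oU oV UV cl; apply/seteqP; split => x.
    move=> [clU clnU]; split => [Ux|Vx].
      by apply: (open_sep U (~` U) x) clnU.
    by apply: (open_sep V U x) clU => // y Vy Uy; exact: UV Uy Vy.
  move=> [nU nV]; split; first exact: cl.
  exact: subset_closure.
split.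
- split; first exact: rat.
  move=> c /(critical_pointP (cr c)) sc.
  have [B1c|n1] := pselect (B1 c).
    by exists [set p] => //; apply/orbit_converges_to1P.
  have [B2c|n2] := pselect (B2 c).
    by exists [set q] => //; apply/orbit_converges_to1P.
  by have [_ _] := rest c n1 n2.
- by split; [exists [set p]|exists [set q]]; rewrite ?basin1E.
- rewrite juliaE; split.
    by apply: boundaryE => // x n1 n2; case: (adherent x n1 n2).
  rewrite setIC; apply: boundaryE => // [x b2 b1|x n2 n1]; first exact: B12 b1 b2.
  by case: (adherent x n1 n2).
- rewrite juliaE; split.
  + apply/seteqP; split => // x _.
    have [b1|n1] := pselect (B1 x); first by left; left.
    by have [b2|n2] := pselect (B2 x); [left; right|right].
  + by apply/seteqP; split => x // -[]; exact: B12.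
  + by apply/seteqP; split => x // -[b1 []].
  + by apply/seteqP; split => x // -[b1 []].
- have eps2 : 2 * e < eps by lra.
  have two_e : e <= 2 * e by lra.
  split.
  + apply: (hausdorff_dist_lt eps2) => [a Aa|b Bb].
      have [x Kx ax] := core a (subset_closure Aa); exists x; first exact: KB.
      by rewrite (le_trans (ltW ax)).
    by exists b; [exact: B1A|rewrite sdistxx mulr_ge0// ltW].
  + have near2 y : ~ A1 y -> exists2 a, A2 a & sdist y a < e.
      move=> /nA1[A2y|/Jcl2/closure_sdistP/(_ e e0)//].
      by exists y; rewrite ?sdistxx.
    apply: (hausdorff_dist_lt eps2) => [a Aa|b Bb].
      by exists a; [exact/AB/A2A1|rewrite sdistxx mulr_ge0// ltW].
    have [w nAw bw] : exists2 w, ~ A1 w & sdist b w < d.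
      by apply: notK => /KB B1b; exact: B12 B1b Bb.
    have [a A2a wa] := near2 w nAw; exists a => //.
    by have := sdist_triangle w b a; lra.
  (* A point of J is in the basin of q and close to a point of K, in the basin of p; the short arc
     between them leaves both basins somewhere. Conversely a point z of the Julia set lies in [A1]
     but not in K, hence close to some w off [A1]; if w is in [A2], the arc from z to w crosses
     J. *)
  + apply: (hausdorff_dist_lt eps2) => [y Jy|z].
      have [x Kx yx] := core y (Jcl1 y Jy).
      have [|G cG [Gy Gx GK]] := @ball_arc R y x; first lra.
      have [z Gz [n1 n2]] : exists2 z, G z & ~ B1 z /\ ~ B2 z.
        apply: (connected_meets_complement cG oB1 oB2 _ Gx Gy (KB x Kx) (AB y (JA1 y Jy))).
        by apply/seteqP; split => t // -[]; exact: B12.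
      exists z; first by rewrite juliaE.
      by have := GK z Gz; rewrite /=; lra.
    rewrite juliaE => -[n1 n2].
    have A1z : A1 z by apply: contrapT => /AB.
    have [w nAw zw] : exists2 w, ~ A1 w & sdist z w < d by apply: notK => /KB.
    have [A2w|Jw] := nA1 w nAw; last by exists w => //; lra.
    have [|G cG [Gz Gw GK]] := @ball_arc R z w; first lra.
    have [u Gu [n1u n2u]] : exists2 u, G u & ~ A1 u /\ ~ A2 u.
      exact: (connected_meets_complement cG A1_open A2_open A12 Gz Gw A1z A2w).
    exists u; first by case: (nA1 u n1u).
    by have := GK u Gu; rewrite /=; lra.
Qed.

End Realisation.

Lemma open_infinite (A : set S) : open A -> A !=set0 ->
  forall l : seq S, exists2 x, A x & x \notin l.
Proof.
move=> oA [x0 Ax0] l.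
have /nbhs_sdistP[d d0 hd] : nbhs x0 A by exact: open_nbhs_nbhs.
pose g : {poly C} := \prod_(c <- pmap id (l : seq (option C))) ('X - c%:P).
have g0 : g != 0 by rewrite monic_neq0// monic_prod_XsubC.
have [a ga xa] := nonroot_near x0 g0 d0; exists (Some a); first exact: hd.
apply: contra ga => al; rewrite -[_ == 0]/(root g a) root_prod_XsubC.
by rewrite mem_finite_part.
Qed.

End Approximation.

Theorem theorem3 (R : realType) (eps : R) (A1 A2 J : set (sphere R))
    (eps_gt0 : 0 < eps)
    (A1_open : open A1) (A2_open : open A2)
    (A1_neq0 : A1 !=set0) (A2_neq0 : A2 !=set0)
    (bdA1 : boundary A1 = J) (bdA2 : boundary A2 = J)
    (cover : disjoint_cover3 A1 A2 J) :
  (exists (r : sphere R -> sphere R) (B1 B2 : set (sphere R)),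
      approximates eps A1 A2 J r B1 B2) /\
  (forall (P : set (sphere R)) (p : sphere R),
      finite_set (components A1) -> component_transversal A1 P -> P p ->
      exists (r : sphere R -> sphere R) (B1 B2 : set (sphere R)),
        [/\ approximates eps A1 A2 J r B1 B2,
            r p = p,
            r @^-1` [set p] = P,
            attracting_cycle r [set p] &
            B1 = basin r [set p]]).
Proof.
have [K [cK KA1 approx]] := approximating_core eps_gt0 A1_open A2_open bdA1 bdA2 cover.
have A2A1 x : A2 x -> ~ A1 x.
  by case: cover => _ A12 _ _ A2x A1x; have : (A1 `&` A2) x by []; rewrite A12.
have Ainf (l : seq (sphere R)) : exists2 x, ~ A1 x & x \notin l.
  have [x A2x xl] := open_infinite A2_open A2_neq0 l.
  by exists x => //; exact: A2A1.
have [q /A2A1 nA1q] := A2_neq0.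
split.
  (* Small balls lie in a single component, so by compactness K meets finitely many components of
     [A1]. The list may hold several points of one component, which the construction allows. *)
  have [l lA lK] : exists2 l : seq (sphere R), (forall y, y \in l -> A1 y) &
      forall x, K x -> exists2 y, y \in l & connected_component A1 y x.
    pose Q (V : set (sphere R)) := exists2 l : seq (sphere R), (forall y, y \in l -> A1 y) &
      forall x, V x -> exists2 y, y \in l & connected_component A1 y x.
    apply: (@compact_induction _ K Q cK).
    - by exists [::].
    - move=> U V [l1 h1 k1] [l2 h2 k2]; exists (l1 ++ l2) => [y|x].
        by rewrite mem_cat => /orP[/h1|/h2].
      by move=> [/k1|/k2] [y yl yx]; exists y => //; rewrite mem_cat yl ?orbT.
    - by move=> U V UV [l h k]; exists l => // x /UV; exact: k.
    move=> x /KA1 A1x; have /nbhs_sdistP[d d0 hd] : nbhs x A1 by exact: open_nbhs_nbhs.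
    exists [set y | sdist x y < Num.min d 1].
      by apply/nbhs_sdistP; exists (Num.min d 1); rewrite // lt_min d0 ltr01.
    exists [:: x] => [y|y /=]; first by rewrite inE => /eqP ->.
    rewrite lt_min => /andP[yd y1]; exists x; first by rewrite inE.
    have [G cG [Gx Gy GK]] := ball_arc y1.
    apply: (connected_component_max Gx _ cG) => // z /GK /= zy; apply: hd.
    exact: le_lt_trans zy yd.
  have [p A1p] := A1_neq0.
  pose P := [set` p :: l].
  have PA1 : P `<=` A1 by move=> x; rewrite /P /= in_cons => /predU1P[->|/lA].
  have Pp : P p by rewrite /P /= in_cons eqxx.
  have KP x : K x -> exists2 y, P y & connected_component A1 y x.
    by move=> /lK[y yl yx]; exists y; rewrite // /P /= in_cons yl orbT.
  have [r hr] := exists_realisation A1_open (finite_seq _) PA1 Pp nA1q Ainf cK KA1 KP.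
  exists r, (basin r [set p]), (basin r [set q]).
  exact: approx PA1 nA1q hr.
move=> P p fin [PA1 Ptr] Pp.
have comp x : A1 x -> exists2 y, P y & connected_component A1 y x.
  move=> A1x; have [|y Py] := Ptr (connected_component A1 x); first by exists x.
  have [Py' xy] : (P `&` connected_component A1 x) y by rewrite Py.
  by exists y => //; exact: connected_component_sym.
have finP : finite_set P.
  (* P is contained in the image of the finite set of components under the choice of their points;
     on a component the default [None] of [xget] does not occur. *)
  pose h (V : set (sphere R)) := xget None (P `&` V).
  apply: (@sub_finite_set _ _ (h @` components A1)); last exact: finite_image.
  move=> y Py; have A1y := PA1 y Py; exists (connected_component A1 y); first by exists y.
  have [|z Pz] := Ptr (connected_component A1 y); first by exists y.
  have : (P `&` connected_component A1 y) y by split => //; exact: connected_component_refl.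
  by rewrite /h Pz => ->; apply: xget_subset1 => // a b -> ->.
have KP x : K x -> exists2 y, P y & connected_component A1 y x by move=> /KA1; exact: comp.
have [r hr] := exists_realisation A1_open finP PA1 Pp nA1q Ainf cK KA1 KP.
have [[_ cr rp _] [sp _] rpre _ _] := hr.
exists r, (basin r [set p]), (basin r [set q]); split => //.
- exact: approx PA1 nA1q hr.
- exact: superattracting_cycle (cr p) rp sp.
Qed.
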